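(* Let $p\ge 2$ and assume $U$ is a simple right $\underline{\mathcal{P}}$-module lying in $\tilde{\mathcal{S}}(p)$. Then $$\bigoplus_{a=0,\ldots,p-2,\; b=0,1}\tau^{4a+b}s^{3a+b}(U)$$ is a tilting object in the triangulated category $\underline{\tilde{\mathcal{S}}}(p)$ with endomorphism ring $A(2(p-1),3)$.
   Context: Let $k$ be a field. The infinite $p$-ladder $\underline{\mathcal{P}}$ is the $k$-linear path category of the quiver with vertices $u_n,\ell_n$ ($n\in\mathbb{Z}$) and arrows $x\colon u_n\to u_{n+1}$, $x\colon\ell_n\to\ell_{n+1}$, $y\colon u_n\to\ell_n$, modulo all commutativities $xy=yx$ and all relations $x^p=0$. $\mathrm{mod}\,\underline{\mathcal{P}}$ is the category of finitely presented (= finite dimensional) right $\underline{\mathcal{P}}$-modules, i.e. contravariant $k$-linear functors; such a module $N$ is the same as a morphism $U\to M$ of finite dimensional $\mathbb{Z}$-graded $k[x]/(x^p)$-modules ($\deg x=1$), where $M_n=N(u_{-n})$ and $U_n=N(\ell_{-n})$. $\tilde{\mathcal{S}}(p)$ is the full extension-closed subcategory of $\mathrm{mod}\,\underline{\mathcal{P}}$ of all such morphisms that are monomorphisms. With the inherited exact structure it is a Frobenius category whose projective-injective objects are the projectives of $\mathrm{mod}\,\underline{\mathcal{P}}$; $\underline{\tilde{\mathcal{S}}}(p)$ is its triangulated stable category, with suspension $[1]$. It has Serre duality; $\tau$ denotes its Auslander-Reiten translation ($\tau=\mathbb{S}[-1]$, $\mathbb{S}$ the Serre functor). $s$ is the degree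 shift sending $U\to M$ to $U(1)\to M(1)$, where $M(1)_n=M_{n+1}$. An object $T$ of a triangulated category $\mathcal{T}$ is a tilting object if $\mathrm{Hom}(T,T[n])=0$ for each integer $n\neq0$, and the condition $\mathrm{Hom}(T,X[n])=0$ for all integers $n$ forces $X=0$. $A(m,3)$ is the Nakayama algebra given by the quiver $1\xrightarrow{x}2\xrightarrow{x}\cdots\xrightarrow{x}m$ with all nilpotency relations $x^3=0$. *)

(* Defs.v *)
From HB Require Import structures.
From mathcomp Require Import all_boot all_order all_algebra.
From mathcomp Require Import boolp.

Set Implicit Arguments.
Unset Strict Implicit.
Unset Printing Implicit Defensive.

Import GRing.Theory.
Local Open Scope ring_scope.

Definition is_submod (k : fieldType) (V : lmodType k) (P : V -> Prop) : Prop :=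
  P 0 /\ forall (a : k) x y, P x -> P y -> P (a *: x + y).

Section LmodQuotient.
Variables (k : fieldType) (V : lmodType k) (P : V -> Prop) (hP : is_submod P).

Definition submod_pred of is_submod P : {pred V} := fun x => `[< P x >].
Local Notation S := (submod_pred hP).

Lemma submod_predP x : reflect (P x) (x \in S).
Proof. exact: asboolP. Qed.

Lemma submod_predZD a x y : x \in S -> y \in S -> a *: x + y \in S.
Proof.
by move=> /submod_predP Px /submod_predP Py; apply/submod_predP/hP.2.
Qed.
Lemma submod_pred0 : 0 \in S. Proof. exact/submod_predP/hP.1. Qed.
Lemma submod_predZ a x : x \in S -> a *: x \in S.
Proof. by move=> Sx; rewrite -[X in X \in _]addr0 submod_predZD ?submod_pred0. Qed.
Lemma submod_pred_zmod : zmod_closed S.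
Proof.
split=> [|x y Sx Sy]; first exact: submod_pred0.
by rewrite addrC -scaleN1r submod_predZD.
Qed.
HB.instance Definition _ := GRing.isZmodClosed.Build V S submod_pred_zmod.

Definition lquot : Type := Quotient.quot S.
HB.instance Definition _ := GRing.Zmodule.on lquot.

Definition lpi (x : V) : lquot := (\pi_(Quotient.quot S) x)%qT.
Definition lrepr (x : lquot) : V := repr (x : Quotient.quot S).

Lemma lreprK x : lpi (lrepr x) = x.
Proof. exact: reprK. Qed.

Lemma lpiP x y : lpi x = lpi y <-> P (x - y).
Proof.
split=> [/eqP|/submod_predP]; rewrite ?Quotient.idealrBE.
  by rewrite -Quotient.idealrBE => /submod_predP.
by move=> /eqP.
Qed.

Lemma lpiB x y : lpi (x - y) = lpi x - lpi y.
Proof. exact: raddfB. Qed.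
Lemma lpiD x y : lpi (x + y) = lpi x + lpi y.
Proof. exact: raddfD. Qed.

Lemma lreprB x : P (lrepr (lpi x) - x).
Proof. by apply/lpiP; rewrite lreprK. Qed.

Definition lqscale (a : k) (x : lquot) : lquot := lpi (a *: lrepr x).

Lemma lqscale_pi a x : lqscale a (lpi x) = lpi (a *: x).
Proof. apply/lpiP; rewrite -scalerBr; apply/submod_predP/submod_predZ.
exact/submod_predP/lreprB. Qed.

Lemma lqscaleA a b x : lqscale a (lqscale b x) = lqscale (a * b) x.
Proof. by rewrite -[x]lreprK !lqscale_pi scalerA. Qed.
Lemma lqscale1 : left_id 1 lqscale.
Proof. by move=> x; rewrite -[x]lreprK !lqscale_pi scale1r. Qed.
Lemma lqscaleDr : right_distributive lqscale +%R.
Proof.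
move=> a x y; rewrite -[x]lreprK -[y]lreprK -lpiD !lqscale_pi -lpiD.
by rewrite scalerDr.
Qed.
Lemma lqscaleDl x : {morph lqscale^~ x : a b / a + b}.
Proof. by move=> a b; rewrite -[x]lreprK !lqscale_pi -lpiD scalerDl. Qed.

HB.instance Definition _ :=
  GRing.Zmodule_isLmodule.Build k lquot lqscaleA lqscale1 lqscaleDr lqscaleDl.

Lemma lpi_is_linear : linear lpi.
Proof. by move=> a x y; rewrite lpiD -lqscale_pi. Qed.
HB.instance Definition _ := GRing.isLinear.Build k V lquot _ lpi lpi_is_linear.

End LmodQuotient.

Record lincat (k : fieldType) := LinCat {
  ob :> Type;
  hom : ob -> ob -> lmodType k;
  idc : forall X, hom X X;
  ccomp : forall X Y Z, hom Y Z -> hom X Y -> hom X Z;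
  ccompA : forall W X Y Z (h : hom Y Z) (g : hom X Y) (f : hom W X),
    ccomp h (ccomp g f) = ccomp (ccomp h g) f;
  ccomp1c : forall X Y (f : hom X Y), ccomp (idc Y) f = f;
  ccompc1 : forall X Y (f : hom X Y), ccomp f (idc X) = f;
  ccomp_linl : forall X Y Z (f : hom X Y), linear (fun g : hom Y Z => ccomp g f);
  ccomp_linr : forall X Y Z (g : hom Y Z), linear (fun f : hom X Y => ccomp g f)
}.

Section LinearCategories.
Variables (k : fieldType).
Implicit Types C D : lincat k.

Definition is_zero C (X : C) : Prop := idc X = 0.

Definition isomorphic C (X Y : C) : Prop :=
  exists (f : hom X Y) (g : hom Y X), ccomp g f = idc X /\ ccomp f g = idc Y.

Definition End C (X : C) : Type := hom X X.

Section EndRing.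
Variables (C : lincat k) (X : C).
HB.instance Definition _ := GRing.Lmodule.on (End X).
Let mul (f g : End X) : End X := ccomp f g.
Let mulA : associative mul. Proof. by move=> f g h; exact: ccompA. Qed.
Let mul1 : left_id (idc X : End X) mul. Proof. by move=> f; exact: ccomp1c. Qed.
Let mulr1 : right_id (idc X : End X) mul.
Proof. by move=> f; exact: ccompc1. Qed.
Let mulDl : left_distributive mul +%R.
Proof.
by move=> f g h; have := ccomp_linl h 1 f g; rewrite !scale1r.
Qed.
Let mulDr : right_distributive mul +%R.
Proof.
by move=> f g h; have := ccomp_linr f 1 g h; rewrite !scale1r.
Qed.
HB.instance Definition _ :=
  GRing.Zmodule_isPzRing.Build (End X) mulA mul1 mulr1 mulDl mulDr.
End EndRing.

Record functor C D := Functor {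
  fob :> C -> D;
  fhom : forall X Y : C, {linear hom X Y -> hom (fob X) (fob Y)};
  fhom1 : forall X : C, fhom X X (idc X) = idc (fob X);
  fhomM : forall (X Y Z : C) (g : hom Y Z) (f : hom X Y),
    fhom X Z (ccomp g f) = ccomp (fhom Y Z g) (fhom X Y f)
}.

Definition is_equivalence C D (F : functor C D) : Prop :=
  (forall X Y : C, bijective (@fhom C D F X Y)) /\
  (forall Y : D, exists X : C, isomorphic (F X) Y).

(* [serre_pair f g] is the value at [g] of the linear form on Hom(Y, S X)
   that corresponds to [f] under Hom(X, Y) = D Hom(Y, S X). *)
Record serre_functor C := SerreFunctor {
  serre :> functor C C;
  serre_equiv : is_equivalence serre;
  serre_pair : forall X Y : C, hom X Y -> {scalar (hom Y (serre X))};
  serre_linear : forall (X Y : C) (a : k) (f f' : hom X Y) g,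
    serre_pair (a *: f + f') g = a * serre_pair f g + serre_pair f' g;
  serre_bij : forall (X Y : C) (phi : {scalar (hom Y (serre X))}),
    exists! f : hom X Y, forall g, serre_pair f g = phi g;
  serre_natr : forall (X Y Y' : C) (h : hom Y Y') (f : hom X Y)
      (g : hom Y' (serre X)),
    serre_pair (ccomp h f) g = serre_pair f (ccomp g h);
  serre_natl : forall (X X' Y : C) (e : hom X' X) (f : hom X Y)
      (g : hom Y (serre X')),
    serre_pair (ccomp f e) g = serre_pair f (ccomp (fhom serre X' X e) g)
}.

Definition tilting C (sh : int -> C -> C) (T : C) : Prop :=
  (forall n : int, n != 0 -> forall f : hom T (sh n T), f = 0) /\
  (forall X : C, (forall (n : int) (f : hom T (sh n X)), f = 0) -> is_zero X).

End LinearCategories.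

Section Ladder.
Variables (k : fieldType) (p : nat).

Definition is_grading (V : vectType k) (V_ : int -> {vspace V}) : Prop :=
  exists2 D : seq int, uniq D &
    [/\ (\sum_(n <- D) V_ n)%VS = fullv, directv (\sum_(n <- D) V_ n)%VS
      & forall n, n \notin D -> V_ n = 0%VS].

Record grmod := GrMod {
  gsp :> vectType k;
  gdeg : int -> {vspace gsp};
  gx : 'End(gsp);
  gdegP : is_grading gdeg;
  gx_deg : forall n, (gx @: gdeg n <= gdeg (n + 1)%R)%VS;
  gx_nil : forall v : gsp, iter p gx v = 0
}.

Definition grhom (M N : grmod) (f : 'Hom(M, N)) : Prop :=
  (forall n, (f @: gdeg M n <= gdeg N n)%VS) /\
  (forall v, f (gx M v) = gx N (f v)).

(* The right module N over the p-ladder is stored as the morphism U -> M with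
   M_n = N(u_(-n)) and U_n = N(l_(-n)). *)
Record ladder := Ladder {
  lU : grmod;
  lM : grmod;
  lmap : 'Hom(lU, lM);
  lmapP : grhom lmap
}.

Definition is_lhom (X Y : ladder)
    (h : 'Hom(lU X, lU Y) * 'Hom(lM X, lM Y)) : Prop :=
  [/\ grhom h.1, grhom h.2 & forall u, h.2 (lmap X u) = lmap Y (h.1 u)].

Definition lhom_pred (X Y : ladder) : {pred 'Hom(lU X, lU Y) * 'Hom(lM X, lM Y)} :=
  fun h => `[< is_lhom h >].
Arguments lhom_pred : clear implicits.

Lemma lhom_predP X Y h : reflect (is_lhom h) (h \in lhom_pred X Y).
Proof. exact: asboolP. Qed.

Record lhom (X Y : ladder) := LHom {
  lhom_val :> 'Hom(lU X, lU Y) * 'Hom(lM X, lM Y);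
  lhom_valP : lhom_val \in lhom_pred X Y
}.
HB.instance Definition _ X Y := [isSub for @lhom_val X Y].
HB.instance Definition _ X Y := [Choice of lhom X Y by <:].

Lemma lhomP X Y (h : lhom X Y) : is_lhom (lhom_val h).
Proof. exact/lhom_predP/lhom_valP. Qed.

Definition mkHom X Y (h : 'Hom(lU X, lU Y) * 'Hom(lM X, lM Y)) (hh : is_lhom h) :
  lhom X Y := LHom (introT (lhom_predP h) hh).

Lemma grhom_linear M N a (f g : 'Hom(gsp M, gsp N)) :
  grhom f -> grhom g -> grhom (a *: f + g).
Proof.
move=> [fd fx] [gd gxx]; split=> [n|v].
  apply/subvP => _ /memv_imgP[v Mv ->]; rewrite lfunE /= lfunE /=.
  rewrite memvD ?memvZ //.
    by apply: (subvP (fd n)); exact: memv_img.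
  by apply: (subvP (gd n)); exact: memv_img.
by rewrite !lfunE /= !lfunE /= fx gxx linearD linearZ.
Qed.

Lemma grhom0 M N : @grhom M N 0.
Proof.
split=> [n|v]; last by rewrite !lfunE /= linear0.
by apply/subvP => _ /memv_imgP[v _ ->]; rewrite lfunE /= mem0v.
Qed.

Lemma grhom_id M : grhom (\1%VF : 'End(gsp M)).
Proof.
split=> [n|v]; last by rewrite !lfunE.
by rewrite lim1g.
Qed.

Lemma grhom_comp L M N (g : 'Hom(gsp M, gsp N)) (f : 'Hom(gsp L, gsp M)) :
  grhom g -> grhom f -> grhom (g \o f)%VF.
Proof.
move=> [gd gxx] [fd fx]; split=> [n|v]; last by rewrite !lfunE /= fx gxx.
by rewrite limg_comp; apply: subv_trans (limgS g (fd n)) (gd n).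
Qed.

Lemma lhom_submod X Y : submod_closed (lhom_pred X Y).
Proof.
split=> [|a f g /lhom_predP[f1 f2 fc] /lhom_predP[g1 g2 gc]]; apply/lhom_predP.
  split; [exact: grhom0 | exact: grhom0 |].
  by move=> u; rewrite !lfunE /= linear0.
split; [exact: grhom_linear | exact: grhom_linear |].
by move=> u; rewrite /= !lfunE /= !lfunE /= fc gc linearD linearZ.
Qed.
HB.instance Definition _ X Y :=
  GRing.SubChoice_isSubLmodule.Build k _ _ (lhom X Y) (lhom_submod X Y).

Lemma lhom_id_subproof X : @is_lhom X X (\1%VF, \1%VF).
Proof.
by split; [exact: grhom_id | exact: grhom_id | move=> u; rewrite !lfunE].
Qed.
Definition lhom_id X : lhom X X := mkHom (lhom_id_subproof X).

Lemma lhom_comp_subproof X Y Z (g : lhom Y Z) (f : lhom X Y) :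
  @is_lhom X Z ((g.1 \o f.1)%VF, (g.2 \o f.2)%VF).
Proof.
have [g1 g2 gc] := lhomP g; have [f1 f2 fc] := lhomP f.
split; [exact: grhom_comp | exact: grhom_comp |].
by move=> u; rewrite !lfunE /= fc gc.
Qed.
Definition lhom_comp X Y Z (g : lhom Y Z) (f : lhom X Y) : lhom X Z :=
  mkHom (lhom_comp_subproof g f).

Lemma lhomE X Y (f g : lhom X Y) : f.1 =1 g.1 -> f.2 =1 g.2 -> f = g.
Proof.
move=> e1 e2; apply: val_inj; rewrite /= [LHS]surjective_pairing.
rewrite [RHS]surjective_pairing.
by congr (_, _); apply/lfunP.
Qed.

Lemma lcompA W X Y Z (h : lhom Y Z) (g : lhom X Y) (f : lhom W X) :
  lhom_comp h (lhom_comp g f) = lhom_comp (lhom_comp h g) f.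
Proof. by apply: lhomE => v /=; rewrite !lfunE /= !lfunE. Qed.
Lemma lcomp1c X Y (f : lhom X Y) : lhom_comp (lhom_id Y) f = f.
Proof. by apply: lhomE => v /=; rewrite !lfunE /= lfunE. Qed.
Lemma lcompc1 X Y (f : lhom X Y) : lhom_comp f (lhom_id X) = f.
Proof. by apply: lhomE => v /=; rewrite !lfunE /= lfunE. Qed.
Lemma lcomp_linl X Y Z (f : lhom X Y) : linear (fun g : lhom Y Z => lhom_comp g f).
Proof. by move=> a g g'; apply: lhomE => v /=; rewrite comp_lfunDl comp_lfunZl. Qed.
Lemma lcomp_linr X Y Z (g : lhom Y Z) : linear (fun f : lhom X Y => lhom_comp g f).
Proof.
by move=> a f f'; apply: lhomE => v /=; rewrite comp_lfunDr comp_lfunZr.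
Qed.

Definition modP : lincat k :=
  LinCat lcompA lcomp1c lcompc1 lcomp_linl lcomp_linr.

Definition inj_lhom X Y (f : lhom X Y) : Prop := injective f.1 /\ injective f.2.

Definition surj_lhom X Y (f : lhom X Y) : Prop :=
  (forall y, exists x, f.1 x = y) /\ (forall y, exists x, f.2 x = y).

Definition simple (X : ladder) : Prop :=
  ~ is_zero (X : modP) /\
  forall (Y : ladder) (i : lhom Y X), inj_lhom i ->
    is_zero (Y : modP) \/ surj_lhom i.

Definition projective (X : ladder) : Prop :=
  forall (Y Z : ladder) (q : lhom Y Z) (f : lhom X Z), surj_lhom q ->
    exists g : lhom X Y, lhom_comp q g = f.

(* The objects of S~(p); morphisms between them are those of [modP]. *)
Record sobj := SObj {
  sobj_ladder :> ladder;
  sobj_mono : injective (lmap sobj_ladder)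
}.

(* Short exact sequences 0 -> X -> Y -> Z -> 0 of the exact category S~(p):
   exactness is that of the ambient module category. *)
Definition conflation (X Y Z : sobj) (i : lhom X Y) (q : lhom Y Z) : Prop :=
  [/\ inj_lhom i, surj_lhom q,
      forall y, q.1 y = 0 <-> exists x, i.1 x = y
    & forall y, q.2 y = 0 <-> exists x, i.2 x = y].

Lemma shift_grading V V_ : @is_grading V V_ -> is_grading (fun n => V_ (n + 1)).
Proof.
case=> D uD [sD dD oD]; exists [seq n - 1 | n <- D].
  by rewrite map_inj_uniq //; apply: addIr.
have E : (\sum_(n <- [seq n - 1 | n <- D]) V_ (n + 1)%R = \sum_(n <- D) V_ n)%VS.
  by rewrite big_map; apply: eq_bigr => n _; rewrite subrK.
split; first by rewrite E.
- move: dD; rewrite !directvE /= E big_map => /eqP ->; apply/eqP.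
  by apply: eq_bigr => n _; rewrite subrK.
- move=> n nD; apply: oD; apply: contra nD => nD.
  by apply/mapP; exists (n + 1); rewrite ?addrK.
Qed.

Definition gshift (M : grmod) : grmod :=
  @GrMod M (fun n => gdeg M (n + 1)) (gx M) (shift_grading (gdegP M))
    (fun n => gx_deg M (n + 1)) (gx_nil (g := M)).

Lemma lshift_subproof (X : ladder) :
  @grhom (gshift (lU X)) (gshift (lM X)) (lmap X).
Proof. by have [d xx] := lmapP X; split=> [n|//]; apply: d. Qed.
Definition lshift (X : ladder) : ladder := Ladder (lshift_subproof X).

Definition sshift (X : sobj) : sobj := @SObj (lshift X) (sobj_mono (s := X)).

Lemma zero_grading : @is_grading 'rV[k]_0 (fun=> 0%VS).
Proof.
exists [::] => //; split=> //; last by rewrite directvE /= !big_nil dimv0.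
rewrite big_nil; apply/esym/eqP; rewrite -subv0; apply/subvP => v _.
by rewrite memv0; apply/eqP/rowP => -[].
Qed.

Lemma zero_deg (n : int) : ((0 : 'End('rV[k]_0)) @: (0 : {vspace 'rV[k]_0}) <= (0 : {vspace 'rV[k]_0}))%VS.
Proof. by rewrite limg0. Qed.

Lemma rV0_eq0 (v : 'rV[k]_0) : v = 0. Proof. by apply/rowP => -[]. Qed.

Definition gzero : grmod :=
  @GrMod 'rV[k]_0 (fun=> 0%VS) 0 zero_grading zero_deg (fun v => rV0_eq0 _).

Definition lzero : ladder := Ladder (grhom0 gzero gzero).
Lemma lzero_mono : injective (lmap lzero).
Proof. by move=> u v _; rewrite (rV0_eq0 u) (rV0_eq0 v). Qed.
Definition szero : sobj := SObj lzero_mono.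

Section Product.
Implicit Types V W : vectType k.

Definition lin_inl V W : 'Hom(V, (V * W)%type) := linfun (fun v : V => (v, 0 : W)).
Definition lin_inr V W : 'Hom(W, (V * W)%type) := linfun (fun w : W => (0 : V, w)).

Lemma lin_inlE V W v : lin_inl V W v = (v, 0).
Proof.
have lin : linear (fun v : V => (v, 0 : W)).
  by move=> a x y; congr (_, _); rewrite /= scaler0 addr0.
pose L : {linear V -> (V * W)%type} := HB.pack (fun v : V => (v, 0 : W))
  (GRing.isLinear.Build _ _ _ _ _ lin).
exact: (lfunE L).
Qed.

Lemma lin_inrE V W w : lin_inr V W w = (0, w).
Proof.
have lin : linear (fun w : W => (0 : V, w)).
  by move=> a x y; congr (_, _); rewrite /= scaler0 addr0.
pose L : {linear W -> (V * W)%type} := HB.pack (fun w : W => (0 : V, w))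
  (GRing.isLinear.Build _ _ _ _ _ lin).
exact: (lfunE L).
Qed.

Definition vprod V W (A : {vspace V}) (B : {vspace W}) : {vspace (V * W)%type} :=
  (lin_inl V W @: A + lin_inr V W @: B)%VS.

Lemma mem_vprod V W (A : {vspace V}) (B : {vspace W}) v :
  (v \in vprod A B) = (v.1 \in A) && (v.2 \in B).
Proof.
apply/memv_addP/andP => [[_ /memv_imgP[a Aa ->] [_ /memv_imgP[b Bb ->] ->]]|[Aa Bb]].
  by rewrite lin_inlE lin_inrE /= addr0 add0r.
exists (lin_inl V W v.1); first exact: memv_img.
exists (lin_inr V W v.2); first exact: memv_img.
by case: v {Aa Bb} => a b; rewrite lin_inlE lin_inrE; congr (_, _); rewrite /= ?addr0 ?add0r.
Qed.

Lemma dim_vprod V W (A : {vspace V}) (B : {vspace W}) :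
  \dim (vprod A B) = (\dim A + \dim B)%N.
Proof.
rewrite dimv_disjoint_sum ?limg_dim_eq //.
- apply/eqP; rewrite -subv0; apply/subvP => w /memv_capP[_].
  by rewrite memv_ker lin_inrE memv0 => /eqP[->].
- apply/eqP; rewrite -subv0; apply/subvP => w /memv_capP[_].
  by rewrite memv_ker lin_inlE memv0 => /eqP[->].
apply/eqP; rewrite -subv0; apply/subvP => w /memv_capP[].
move=> /memv_imgP[a _ ->] /memv_imgP[b _]; rewrite lin_inlE lin_inrE memv0.
by case=> ->.
Qed.

Lemma vprod_full V W : vprod (fullv : {vspace V}) (fullv : {vspace W}) = fullv.
Proof. by apply/vspaceP => v; rewrite mem_vprod !memvf. Qed.

Definition pair_lfun V W V' W' (f : 'Hom(V, W)) (g : 'Hom(V', W')) :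
  'Hom((V * V')%type, (W * W')%type) :=
  linfun (fun v : V * V' => (f v.1, g v.2)).

Lemma pair_lfunE V W V' W' (f : 'Hom(V, W)) (g : 'Hom(V', W')) v :
  pair_lfun f g v = (f v.1, g v.2).
Proof.
have lin : linear (fun v : V * V' => (f v.1, g v.2)).
  by move=> a x y; congr (_, _); rewrite /= linearP.
pose L : {linear (V * V')%type -> (W * W')%type} :=
  HB.pack (fun v : V * V' => (f v.1, g v.2)) (GRing.isLinear.Build _ _ _ _ _ lin).
exact: (lfunE L).
Qed.

Lemma pair_lfun_img V W V' W' (f : 'Hom(V, W)) (g : 'Hom(V', W')) A A' B B' :
  (f @: A <= B)%VS -> (g @: A' <= B')%VS ->
  (pair_lfun f g @: vprod A A' <= vprod B B')%VS.
Proof.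
move=> fAB gAB; apply/subvP => _ /memv_imgP[v + ->].
rewrite !mem_vprod pair_lfunE /= => /andP[v1 v2].
by rewrite (subvP fAB) ?(subvP gAB) ?memv_img.
Qed.

Lemma big_extend (T : Type) (idx : T) (op : Monoid.com_law idx) (D D' : seq int)
    (F : int -> T) :
  uniq D -> uniq D' -> {subset D <= D'} -> (forall n, n \notin D -> F n = idx) ->
  \big[op/idx]_(n <- D') F n = \big[op/idx]_(n <- D) F n.
Proof.
move=> uD uD' sobj z; rewrite (bigID (mem D)) /= [X in op _ X]big1 //.
rewrite Monoid.mulm1 -big_filter; apply: perm_big; apply: uniq_perm => //.
  exact: filter_uniq.
by move=> n; rewrite mem_filter /=; case: (boolP (n \in D)) => //= /sobj.
Qed.

Arguments big_extend {T idx op D D' F}.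

Lemma prod_grading V W (V_ : int -> {vspace V}) (W_ : int -> {vspace W}) :
  is_grading V_ -> is_grading W_ -> is_grading (fun n => vprod (V_ n) (W_ n)).
Proof.
move=> [D uD [sD dD oD]] [E uE [sE dE oE]].
pose F := undup (D ++ E); have uF : uniq F by exact: undup_uniq.
have DF : {subset D <= F} by move=> n nD; rewrite mem_undup mem_cat nD.
have EF : {subset E <= F} by move=> n nE; rewrite mem_undup mem_cat nE orbT.
have oD' n : n \notin D -> \dim (V_ n) = 0%N by move/oD->; rewrite dimv0.
have oE' n : n \notin E -> \dim (W_ n) = 0%N by move/oE->; rewrite dimv0.
have sF : (\sum_(n <- F) vprod (V_ n) (W_ n))%VS = fullv.
  rewrite big_split /= -!limg_sum.
  rewrite (big_extend uD uF DF oD) (big_extend uE uF EF oE) sD sE.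
  exact: vprod_full.
exists F => //; split=> //; last first.
  move=> n; rewrite mem_undup mem_cat => /norP[/oD-> /oE->].
  by rewrite /vprod !limg0 addv0.
move: dD dE; rewrite !directvE /= sD sE sF => /eqP dD /eqP dE.
rewrite -vprod_full; apply/eqP; apply: (etrans (dim_vprod _ _)); rewrite dD dE.
rewrite [RHS](eq_bigr (fun n => \dim (V_ n) + \dim (W_ n))%N); last first.
  by move=> n _; exact: dim_vprod.
by rewrite big_split /= (big_extend uD uF DF oD') (big_extend uE uF EF oE').
Qed.

End Product.

Section DirectSum.

Section GradedSum.
Variables M N : grmod.

Lemma gsum_deg n :
  (pair_lfun (gx M) (gx N) @: vprod (gdeg M n) (gdeg N n)
     <= vprod (gdeg M (n + 1)%R) (gdeg N (n + 1)%R))%VS.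
Proof. by apply: pair_lfun_img; exact: gx_deg. Qed.

Lemma gsum_nil v : iter p (pair_lfun (gx M) (gx N)) v = 0.
Proof.
have -> : iter p (pair_lfun (gx M) (gx N)) v = (iter p (gx M) v.1, iter p (gx N) v.2).
  by elim: p => [|j IH]; [case: v | rewrite /= IH pair_lfunE].
by rewrite !gx_nil.
Qed.

Definition gsum : grmod :=
  GrMod (prod_grading (gdegP M) (gdegP N)) gsum_deg gsum_nil.

End GradedSum.

Lemma gsum_hom M N M' N' (f : 'Hom(gsp M, gsp M')) (g : 'Hom(gsp N, gsp N')) :
  grhom f -> grhom g -> @grhom (gsum M N) (gsum M' N') (pair_lfun f g).
Proof.
move=> [fd fx] [gd gxx]; split=> [n|v]; first exact: pair_lfun_img.
by rewrite /= !pair_lfunE /= fx gxx.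
Qed.

Definition lsum (X Y : ladder) : ladder := Ladder (gsum_hom (lmapP X) (lmapP Y)).

Lemma lsum_mono (X Y : sobj) : injective (lmap (lsum X Y)).
Proof.
move=> u v; rewrite !pair_lfunE => -[/sobj_mono e1 /sobj_mono e2].
by rewrite [u]surjective_pairing e1 e2 -surjective_pairing.
Qed.
Definition ssum (X Y : sobj) : sobj := SObj (@lsum_mono X Y).

Definition lin_fst (V W : vectType k) : 'Hom((V * W)%type, V) := linfun fst.
Definition lin_snd (V W : vectType k) : 'Hom((V * W)%type, W) := linfun snd.

Lemma lin_fstE V W v : lin_fst V W v = v.1. Proof. exact: lfunE. Qed.
Lemma lin_sndE V W v : lin_snd V W v = v.2. Proof. exact: lfunE. Qed.

Lemma ginl_hom M N : @grhom M (gsum M N) (lin_inl M N).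
Proof.
split=> [n|v]; last by rewrite /= !lin_inlE pair_lfunE /= linear0.
by apply/subvP => _ /memv_imgP[v Mv ->]; rewrite mem_vprod lin_inlE Mv /= mem0v.
Qed.

Lemma ginr_hom M N : @grhom N (gsum M N) (lin_inr M N).
Proof.
split=> [n|v]; last by rewrite /= !lin_inrE pair_lfunE /= linear0.
by apply/subvP => _ /memv_imgP[v Mv ->]; rewrite mem_vprod lin_inrE Mv /= mem0v.
Qed.

Lemma gfst_hom M N : @grhom (gsum M N) M (lin_fst M N).
Proof.
split=> [n|v]; last by rewrite /= !lin_fstE pair_lfunE.
apply/subvP => _ /memv_imgP[v + ->]; rewrite mem_vprod lin_fstE.
by case/andP.
Qed.

Lemma gsnd_hom M N : @grhom (gsum M N) N (lin_snd M N).
Proof.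
split=> [n|v]; last by rewrite /= !lin_sndE pair_lfunE.
apply/subvP => _ /memv_imgP[v + ->]; rewrite mem_vprod lin_sndE.
by case/andP.
Qed.

Section LadderSum.
Variables X Y : ladder.

Lemma linl_subproof :
  @is_lhom X (lsum X Y) (lin_inl (lU X) (lU Y), lin_inl (lM X) (lM Y)).
Proof.
split; [exact: ginl_hom | exact: ginl_hom |].
by move=> u; rewrite /= !lin_inlE pair_lfunE /= linear0.
Qed.
Definition linl : lhom X (lsum X Y) := mkHom linl_subproof.

Lemma linr_subproof :
  @is_lhom Y (lsum X Y) (lin_inr (lU X) (lU Y), lin_inr (lM X) (lM Y)).
Proof.
split; [exact: ginr_hom | exact: ginr_hom |].
by move=> u; rewrite /= !lin_inrE pair_lfunE /= linear0.
Qed.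
Definition linr : lhom Y (lsum X Y) := mkHom linr_subproof.

Lemma lfst_subproof :
  @is_lhom (lsum X Y) X (lin_fst (lU X) (lU Y), lin_fst (lM X) (lM Y)).
Proof.
split; [exact: gfst_hom | exact: gfst_hom |].
by move=> u; rewrite /= !lin_fstE pair_lfunE.
Qed.
Definition lfst : lhom (lsum X Y) X := mkHom lfst_subproof.

Lemma lsnd_subproof :
  @is_lhom (lsum X Y) Y (lin_snd (lU X) (lU Y), lin_snd (lM X) (lM Y)).
Proof.
split; [exact: gsnd_hom | exact: gsnd_hom |].
by move=> u; rewrite /= !lin_sndE pair_lfunE.
Qed.
Definition lsnd : lhom (lsum X Y) Y := mkHom lsnd_subproof.

Lemma lsumE : lhom_comp linl lfst + lhom_comp linr lsnd = lhom_id (lsum X Y).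
Proof.
apply: lhomE => v /=; rewrite !lfunE /= !lfunE /=;
rewrite ?lin_inlE ?lin_inrE ?lin_fstE ?lin_sndE;
by case: v => a b; congr (_, _); rewrite /= ?addr0 ?add0r.
Qed.

Lemma lfst_linl : lhom_comp lfst linl = lhom_id X.
Proof. by apply: lhomE => v; rewrite /= !lfunE /= lin_fstE lin_inlE. Qed.
Lemma lsnd_linr : lhom_comp lsnd linr = lhom_id Y.
Proof. by apply: lhomE => v; rewrite /= !lfunE /= lin_sndE lin_inrE. Qed.
Lemma lfst_linr : lhom_comp lfst linr = 0.
Proof. by apply: lhomE => v; rewrite /= !lfunE /= lin_fstE lin_inrE. Qed.
Lemma lsnd_linl : lhom_comp lsnd linl = 0.
Proof. by apply: lhomE => v; rewrite /= !lfunE /= lin_sndE lin_inlE. Qed.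

End LadderSum.

Lemma lcompDl X Y Z (g g' : lhom Y Z) (f : lhom X Y) :
  lhom_comp (g + g') f = lhom_comp g f + lhom_comp g' f.
Proof. by have := lcomp_linl f 1 g g'; rewrite !scale1r. Qed.
Lemma lcompDr X Y Z (g : lhom Y Z) (f f' : lhom X Y) :
  lhom_comp g (f + f') = lhom_comp g f + lhom_comp g f'.
Proof. by have := lcomp_linr g 1 f f'; rewrite !scale1r. Qed.
Lemma lcomp0l X Y Z (f : lhom X Y) : lhom_comp (0 : lhom Y Z) f = 0.
Proof. by apply: (addIr (lhom_comp 0 f)); rewrite -lcompDl !add0r. Qed.
Lemma lcomp0r X Y Z (g : lhom Y Z) : lhom_comp g (0 : lhom X Y) = 0.
Proof. by apply: (addIr (lhom_comp g 0)); rewrite -lcompDr !add0r. Qed.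
Lemma lcompZl X Y Z a (g : lhom Y Z) (f : lhom X Y) :
  lhom_comp (a *: g) f = a *: lhom_comp g f.
Proof. by have := lcomp_linl f a g 0; rewrite !addr0 lcomp0l addr0. Qed.
Lemma lcompZr X Y Z a (g : lhom Y Z) (f : lhom X Y) :
  lhom_comp g (a *: f) = a *: lhom_comp g f.
Proof. by have := lcomp_linr g a f 0; rewrite !addr0 lcomp0r addr0. Qed.

Lemma projective_sum X Y : projective X -> projective Y -> projective (lsum X Y).
Proof.
move=> pX pY A B q f sq.
have [g1 e1] := pX _ _ q (lhom_comp f (linl X Y)) sq.
have [g2 e2] := pY _ _ q (lhom_comp f (linr X Y)) sq.
exists (lhom_comp g1 (lfst X Y) + lhom_comp g2 (lsnd X Y)).
by rewrite lcompDr !lcompA e1 e2 -!lcompA -lcompDr lsumE lcompc1.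
Qed.

Lemma projective_zero : projective lzero.
Proof.
move=> A B q f sq; exists 0; rewrite lcomp0r.
by apply: lhomE => v; rewrite /= [v]rV0_eq0 !linear0.
Qed.

End DirectSum.

(* The projective-injective objects of S~(p) are the projectives of [modP]. *)
Definition stably_zero (X Y : sobj) (f : lhom X Y) : Prop :=
  exists Q : sobj, projective Q /\
    exists (a : lhom X Q) (b : lhom Q Y), f = lhom_comp b a.

Lemma stably_zero_submod X Y : is_submod (@stably_zero X Y).
Proof.
split=> [|c f g [Q [pQ [a [b ->]]]] [R [pR [a' [b' ->]]]]].
  exists szero; split; first exact: projective_zero.
  by exists 0, 0; rewrite lcomp0r.
exists (ssum Q R); split; first exact: projective_sum.
exists (lhom_comp (linl Q R) a + lhom_comp (linr Q R) a').
exists (c *: lhom_comp b (lfst Q R) + lhom_comp b' (lsnd Q R)).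
rewrite lcompDl !lcompDr !lcompZl -!lcompA.
rewrite ![lhom_comp (lfst _ _) (lhom_comp _ _)]lcompA.
rewrite ![lhom_comp (lsnd _ _) (lhom_comp _ _)]lcompA.
rewrite lfst_linl lfst_linr lsnd_linl lsnd_linr !lcomp1c !lcomp0l !lcomp0r.
by rewrite scaler0 addr0 add0r.
Qed.

Definition shom (X Y : sobj) : lmodType k := lquot (@stably_zero_submod X Y).
Definition spi (X Y : sobj) (f : lhom X Y) : shom X Y := lpi (@stably_zero_submod X Y) f.
Definition srepr X Y (f : shom X Y) : lhom X Y := lrepr f.

Lemma sreprK X Y (f : shom X Y) : spi (srepr f) = f.
Proof. exact: lreprK. Qed.

Lemma spiP (X Y : sobj) (f g : lhom X Y) : spi f = spi g <-> stably_zero (f - g).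
Proof. exact: lpiP. Qed.

Lemma spi_linear (X Y : sobj) a (f g : lhom X Y) : spi (a *: f + g) = a *: spi f + spi g.
Proof. exact: lpi_is_linear. Qed.

Definition scomp X Y Z (g : shom Y Z) (f : shom X Y) : shom X Z :=
  spi (lhom_comp (srepr g) (srepr f)).

Lemma lcompBl X Y Z (g g' : lhom Y Z) (f : lhom X Y) :
  lhom_comp (g - g') f = lhom_comp g f - lhom_comp g' f.
Proof. by rewrite -scaleN1r lcompDl lcompZl scaleN1r. Qed.
Lemma lcompBr X Y Z (g : lhom Y Z) (f f' : lhom X Y) :
  lhom_comp g (f - f') = lhom_comp g f - lhom_comp g f'.
Proof. by rewrite -scaleN1r lcompDr lcompZr scaleN1r. Qed.

Lemma scomp_spi (X Y Z : sobj) (g : lhom Y Z) (f : lhom X Y) :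
  scomp (spi g) (spi f) = spi (lhom_comp g f).
Proof.
apply: (@etrans _ _ (spi (lhom_comp g (srepr (spi f))))); apply/spiP.
  rewrite -lcompBl; have /spiP[Q [pQ [a [b ->]]]] := sreprK (spi g).
  by exists Q; split=> //; exists (lhom_comp a (srepr (spi f))), b; rewrite lcompA.
rewrite -lcompBr; have /spiP[Q [pQ [a [b ->]]]] := sreprK (spi f).
by exists Q; split=> //; exists a, (lhom_comp g b); rewrite lcompA.
Qed.

Definition sid (X : sobj) : shom X X := spi (lhom_id X).

Lemma scompA W X Y Z (h : shom Y Z) (g : shom X Y) (f : shom W X) :
  scomp h (scomp g f) = scomp (scomp h g) f.
Proof.
by rewrite -[h]sreprK -[g]sreprK -[f]sreprK !scomp_spi lcompA.
Qed.
Lemma scomp1c X Y (f : shom X Y) : scomp (sid Y) f = f.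
Proof. by rewrite -[f]sreprK scomp_spi lcomp1c. Qed.
Lemma scompc1 X Y (f : shom X Y) : scomp f (sid X) = f.
Proof. by rewrite -[f]sreprK scomp_spi lcompc1. Qed.
Lemma scomp_linl X Y Z (f : shom X Y) : linear (fun g : shom Y Z => scomp g f).
Proof.
move=> a g g'; rewrite -[f]sreprK -[g]sreprK -[g']sreprK -spi_linear !scomp_spi.
by rewrite lcomp_linl spi_linear.
Qed.
Lemma scomp_linr X Y Z (g : shom Y Z) : linear (fun f : shom X Y => scomp g f).
Proof.
move=> a f f'; rewrite -[f]sreprK -[g]sreprK -[f']sreprK -spi_linear !scomp_spi.
by rewrite lcomp_linr spi_linear.
Qed.

Definition stab : lincat k :=
  LinCat scompA scomp1c scompc1 scomp_linl scomp_linr.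

(* A choice of [X[1]] and [X[-1]] for every object, by means of short exact
   sequences X -> I -> X[1] and X[-1] -> P -> X with projective (= injective)
   middle terms; any two choices agree up to isomorphism in [stab]. *)
Record suspension := Suspension {
  susp : stab -> stab;
  desusp : stab -> stab;
  suspP : forall X : stab, exists (I : sobj) (i : lhom (X : sobj) I)
    (q : lhom I (susp X : sobj)), projective I /\ conflation i q;
  desuspP : forall X : stab, exists (P : sobj) (i : lhom (desusp X : sobj) P)
    (q : lhom P (X : sobj)), projective P /\ conflation i q
}.

Definition shift (Sg : suspension) (n : int) (X : stab) : stab :=
  match n with
  | Posz m => iter m (susp Sg) X
  | Negz m => iter m.+1 (desusp Sg) X
  end.

Definition tau (Sg : suspension) (Se : serre_functor stab) (X : stab) : stab :=
  Se (shift Sg (-1) X).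

End Ladder.

Section Nakayama.
Variables (k : fieldType) (m : nat).

(* There is a unique path from i to j in the quiver 1 -> 2 -> ... -> m when
   i <= j, of length j - i, and none otherwise. *)
Definition path_ : finType := {w : 'I_m * 'I_m | (w.1 <= w.2)%N}.
Definition psrc (w : path_) : 'I_m := (val w).1.
Definition ptgt (w : path_) : 'I_m := (val w).2.
Definition plength (w : path_) : nat := (ptgt w - psrc w)%N.

(* [is_pcat u v w]: w is the path u followed by the path v. *)
Definition is_pcat (u v w : path_) : bool :=
  [&& ptgt u == psrc v, psrc w == psrc u & ptgt w == ptgt v].

Definition path_alg : Type := {ffun path_ -> k^o}.
HB.instance Definition _ := GRing.Lmodule.on path_alg.

Definition pbase (w : path_) : path_alg := [ffun v => (v == w)%:R].

Definition pa_one : path_alg := [ffun w => (psrc w == ptgt w)%:R].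
Definition pa_mul (f g : path_alg) : path_alg :=
  [ffun w => \sum_(uv : path_ * path_ | is_pcat uv.1 uv.2 w) f uv.1 * g uv.2].

(* Upper triangular matrices, used only to check the ring axioms. *)
Definition pmx (f : path_alg) : 'M[k]_m :=
  \matrix_(i, j) (if insub (i, j) is Some w then f w else 0).

Lemma pmxE f (w : path_) : pmx f (psrc w) (ptgt w) = f w.
Proof.
rewrite mxE -surjective_pairing; case: insubP => [v _ e|]; last by rewrite (valP w).
by congr (f _); apply: val_inj.
Qed.

Lemma pmx0 f (i j : 'I_m) : (j < i)%N -> pmx f i j = 0.
Proof. by move=> ji; rewrite mxE insubF //= leqNgt ji. Qed.

Lemma pmx_inj : injective pmx.
Proof. by move=> f g e; apply/ffunP => w; rewrite -!pmxE e. Qed.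

Lemma pmxP (f : path_alg) (A : 'M[k]_m) : (forall i j : 'I_m, (j < i)%N -> A i j = 0) ->
  (forall w, f w = A (psrc w) (ptgt w)) -> pmx f = A.
Proof.
move=> lo up; apply/matrixP => i j; case: (ltnP j i) => [ji|ij].
  by rewrite pmx0 // lo.
pose w : path_ := Sub (i, j) ij.
by rewrite -[i]/(psrc w) -[j]/(ptgt w) pmxE up.
Qed.

Lemma pmx1 : pmx pa_one = 1%:M.
Proof.
apply: pmxP => [i j ji|w]; rewrite ?mxE ?ffunE //.
by case: eqP ji => // ->; rewrite ltnn.
Qed.

Lemma pmxD f g : pmx (f + g) = pmx f + pmx g.
Proof.
apply: pmxP => [i j ji|w]; first by rewrite mxE !pmx0 ?addr0.
by rewrite [RHS]mxE !pmxE ffunE.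
Qed.

Lemma psrc_insubd w (i j : 'I_m) : (i <= j)%N -> psrc (insubd w (i, j)) = i.
Proof. by move=> ij; rewrite /psrc val_insubd /= ij. Qed.
Lemma ptgt_insubd w (i j : 'I_m) : (i <= j)%N -> ptgt (insubd w (i, j)) = j.
Proof. by move=> ij; rewrite /ptgt val_insubd /= ij. Qed.

Lemma pmxM f g : pmx (pa_mul f g) = pmx f *m pmx g.
Proof.
apply: pmxP => [i j ji|w].
  rewrite mxE; apply: big1 => t _; case: (ltnP t i) => [ti|it]; first by rewrite pmx0 ?mul0r.
  by rewrite [pmx g t j]pmx0 ?mulr0 // (leq_trans ji).
rewrite ffunE [RHS]mxE [RHS](bigID (fun t : 'I_m => psrc w <= t <= ptgt w)%N) /=.
rewrite [X in _ = _ + X]big1 ?addr0; last first.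
  move=> t; rewrite negb_and -!ltnNge => /orP[h|h].
    by rewrite pmx0 ?mul0r.
  by rewrite [pmx g _ _]pmx0 ?mulr0.
rewrite (reindex_onto (fun uv : path_ * path_ => ptgt uv.1)
  (fun t => (insubd w (psrc w, t), insubd w (t, ptgt w)))) /=; last first.
  by move=> t /andP[h _]; rewrite /ptgt val_insubd /= h.
apply: eq_big => [[u v]|[u v] /and3P[/eqP h1 /eqP h2 /eqP h3]] /=; last first.
  by rewrite -!pmxE /= h2 h3 -h1.
rewrite /is_pcat /=; apply/and3P/andP => [[/eqP h1 /eqP h2 /eqP h3]|[/andP[h1 h2]]].
  have uP := valP u; have vP := valP v.
  have e1 : (psrc w <= ptgt u)%N by rewrite h2.
  have e2 : (ptgt u <= ptgt w)%N by rewrite h1 h3.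
  split; first by rewrite e1.
  apply/eqP; congr (_, _); apply: val_inj; rewrite val_insubd /= ?e1 ?e2.
    by rewrite h2 -surjective_pairing.
  by rewrite h1 h3 -surjective_pairing.
case/eqP => eu ev; have := congr1 ptgt ev; have := congr1 psrc ev.
have := congr1 psrc eu; rewrite !psrc_insubd // ptgt_insubd //.
by move=> <- <- <-; rewrite !eqxx.
Qed.

Lemma pa_mulA : associative pa_mul.
Proof. by move=> f g h; apply: pmx_inj; rewrite !pmxM mulmxA. Qed.
Lemma pa_mul1 : left_id pa_one pa_mul.
Proof. by move=> f; apply: pmx_inj; rewrite !pmxM pmx1 mul1mx. Qed.
Lemma pa_mulr1 : right_id pa_one pa_mul.
Proof. by move=> f; apply: pmx_inj; rewrite !pmxM pmx1 mulmx1. Qed.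
Lemma pa_mulDl : left_distributive pa_mul +%R.
Proof. by move=> f g h; apply: pmx_inj; rewrite !(pmxM, pmxD) mulmxDl. Qed.
Lemma pa_mulDr : right_distributive pa_mul +%R.
Proof. by move=> f g h; apply: pmx_inj; rewrite !(pmxM, pmxD) mulmxDr. Qed.

HB.instance Definition _ := GRing.Zmodule_isPzRing.Build path_alg
  pa_mulA pa_mul1 pa_mulr1 pa_mulDl pa_mulDr.

End Nakayama.

Section NakayamaQuotient.
Variables (k : fieldType) (m r : nat).
Local Notation A := (path_alg k m).

Definition is_ideal (J : A -> Prop) : Prop :=
  is_submod J /\ forall a x, J x -> J (a * x) /\ J (x * a).

(* The two-sided ideal generated by the paths x^r. *)
Definition nak_ideal (a : A) : Prop :=
  forall J : A -> Prop, is_ideal J ->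
    (forall w, plength w = r -> J (pbase k w)) -> J a.

Lemma nak_ideal_submod : is_submod nak_ideal.
Proof.
split=> [J [[J0 _] _] _ //|c x y nx ny J idJ gJ].
by have [[_ h] _] := idJ; apply: h; [exact: nx | exact: ny].
Qed.

Lemma nak_idealMl a x : nak_ideal x -> nak_ideal (a * x).
Proof. by move=> nx J idJ gJ; have [_ h] := idJ; case: (h a x (nx J idJ gJ)). Qed.
Lemma nak_idealMr a x : nak_ideal x -> nak_ideal (x * a).
Proof. by move=> nx J idJ gJ; have [_ h] := idJ; case: (h a x (nx J idJ gJ)). Qed.

Definition nakayama : Type := lquot nak_ideal_submod.
HB.instance Definition _ := GRing.Lmodule.on nakayama.

Definition npi (a : A) : nakayama := lpi nak_ideal_submod a.
Definition nrepr (a : nakayama) : A := lrepr a.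
Lemma nreprK a : npi (nrepr a) = a. Proof. exact: lreprK. Qed.
Lemma npiP a b : npi a = npi b <-> nak_ideal (a - b). Proof. exact: lpiP. Qed.
Lemma npiD a b : npi (a + b) = npi a + npi b. Proof. exact: lpiD. Qed.

Definition nak_mul (a b : nakayama) : nakayama := npi (nrepr a * nrepr b).

Lemma nak_mul_pi a b : nak_mul (npi a) (npi b) = npi (a * b).
Proof.
apply: (@etrans _ _ (npi (a * nrepr (npi b)))); apply/npiP.
  by rewrite -mulrBl; apply: nak_idealMr; apply/npiP; rewrite nreprK.
by rewrite -mulrBr; apply: nak_idealMl; apply/npiP; rewrite nreprK.
Qed.

Lemma nak_mulA : associative nak_mul.
Proof.
move=> a b c; rewrite -[a]nreprK -[b]nreprK -[c]nreprK.
by rewrite !nak_mul_pi mulrA.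
Qed.
Lemma nak_mul1 : left_id (npi 1) nak_mul.
Proof. by move=> a; rewrite -[a]nreprK nak_mul_pi mul1r. Qed.
Lemma nak_mulr1 : right_id (npi 1) nak_mul.
Proof. by move=> a; rewrite -[a]nreprK nak_mul_pi mulr1. Qed.
Lemma nak_mulDl : left_distributive nak_mul +%R.
Proof.
move=> a b c; rewrite -[a]nreprK -[b]nreprK -[c]nreprK.
by rewrite -npiD !nak_mul_pi mulrDl npiD.
Qed.
Lemma nak_mulDr : right_distributive nak_mul +%R.
Proof.
move=> a b c; rewrite -[a]nreprK -[b]nreprK -[c]nreprK.
by rewrite -npiD !nak_mul_pi mulrDr npiD.
Qed.

HB.instance Definition _ := GRing.Zmodule_isPzRing.Build nakayama
  nak_mulA nak_mul1 nak_mulr1 nak_mulDl nak_mulDr.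

End NakayamaQuotient.

(* Main.v *)
From HB Require Import structures.
Require Import Defs.
From mathcomp Require Import all_boot all_order all_algebra.
From mathcomp Require Import boolp.
From mathcomp Require Import zify.
(** An object of the category is an inclusion U -> M of graded
    k[x]/(x^p)-modules. Rotating such an arrow to M -> M/U, and making the
    result injective again by adding a projective to the target, is an
    autoequivalence R of the stable category with R^3 = [1]. The Serre
    functor of arrows is the one of graded k[x]/(x^p)-modules composed with
    R; since the translation of k[x]/(x^p) is s^(-1), one finds tau = R
    s^(-1) and S = tau [1], while [2] = s^p. A simple object is A = (0 in
    k), and so the summand tau^(4a+b) s^(3a+b) A is R^(4a+b) s^(-a) A.
    Numbering the summands X_i with i = 2a + b, one gets X_(i+2) = S X_i.

    All objects in sight are intervals (N_a in N_b), where N_b = k[x]/(x^b)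
    ([ivl]). Maps from an interval to (U in M) are elements of M, among
    which the stably zero ones are explicit ([ivl_st0]), and maps from (U in
    M) to an interval are linear forms on M. This gives the Serre dual of an
    interval ([serre_ivl]), through the uniqueness of representing objects
    ([serre_unique]). Suspensions of intervals come from explicit short
    exact sequences ([confl_ivl], [suspC]). So R is only needed on the
    objects [robj h r t] = R^r s^(-t) A, on which S, [1] and tau act by
    translation of the indices (r, t) ([robj_serre], [robj_susp],
    [tau_robj]). A given suspension is only a choice of objects; it acts on
    morphisms up to stably zero maps ([heller]), which is enough to carry
    isomorphisms and the vanishing of Hom along suspensions.

    By translation, the vanishing of Hom between the X_i and their
    suspensions reduces to maps out of A, which are socle elements of the
    target ([robj_vanish], [summand_vanish]). The only nonzero spaces are
    those from X_i to X_i, X_(i+1) and X_(i+2). They are lines, and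
    composites of two consecutive generators are nonzero by Serre duality,
    as X_(i+2) = S X_i ([line_serre], [line_comp]). Hence the endomorphism
    ring is that of the linear quiver with x^3 = 0 ([end_nakayama]).

    For generation, let W be orthogonal to all suspensions of the X_i. For
    each a, the summands X_(2a) and X_(2a+1) are two consecutive rotations
    of s^(-a) A, so the triangle joining three consecutive rotations gives
    all of them ([orth_rot01]). This covers the simple objects (0 in k) and
    (k in k) in p - 1 consecutive degrees, and iterated extensions reach all
    degrees ([fam_orth]). Then every socle element of the two modules of W
    is divisible by x^(p-1), so projective summands can be split off until
    nothing is left ([zero_of_orth]). *)

Set Implicit Arguments.
Unset Strict Implicit.
Unset Printing Implicit Defensive.
Import Order.TTheory GRing.Theory Num.Theory.
Local Open Scope ring_scope.
Local Notation hom := Defs.hom.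

(** * Linear forms and homogeneous components *)

Section LinearAlgebra.
Variable k : fieldType.
Implicit Types V W L : vectType k.

Definition mk_lfun V W (f : V -> W) (lin : linear f) : 'Hom(V, W) :=
  linfun (HB.pack f (GRing.isLinear.Build _ _ _ _ _ lin) : {linear V -> W}).

Lemma mk_lfunE V W (f : V -> W) (lin : linear f) v : mk_lfun lin v = f v.
Proof. by rewrite lfunE. Qed.

Lemma lfun_addE V W (f : 'Hom(V, W)) v w : f (v + w) = f v + f w.
Proof. exact: linearD. Qed.

Lemma lfun_scaleE V W (f : 'Hom(V, W)) a v : f (a *: v) = a *: f v.
Proof. exact: linearZ. Qed.

(** A linear left inverse of [h] on its image does it: [h^-1 (h v) - v] lies
    in the kernel of [h], hence in that of [f]. *)
Lemma lfun_factor V W L (h : 'Hom(V, W)) (f : 'Hom(V, L)) :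
  (forall v, h v = 0 -> f v = 0) -> exists F : 'Hom(W, L), forall v, F (h v) = f v.
Proof.
move=> hf; exists (f \o h^-1)%VF => v; rewrite lfunE /=; apply/eqP.
rewrite -subr_eq0 -linearB; apply/eqP/hf; rewrite linearB /=.
by rewrite limg_lfunVK ?memv_img ?memvf // subrr.
Qed.

(** Projection along a complement kills the image of [g]; the hypothesis
    says that [f] still factors through [h] followed by this projection. *)
Lemma lfun_extend V V' W L (h : 'Hom(V, W)) (g : 'Hom(V', W)) (f : 'Hom(V, L)) :
  (forall v v', h v = g v' -> f v = 0) ->
  exists F : 'Hom(W, L), (forall v, F (h v) = f v) /\ (forall v', F (g v') = 0).
Proof.
move=> hf; pose r : 'End(W) := \1%VF - projv (limg g).
have rg v' : r (g v') = 0.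
  by rewrite !lfunE /= !lfunE /= projv_id ?memv_img ?memvf // subrr.
have [F FE] : exists F : 'Hom(W, L), forall v, F ((r \o h)%VF v) = f v.
  apply: lfun_factor => v; rewrite !lfunE /= !lfunE /= !lfunE /= => /eqP.
  rewrite subr_eq0 => /eqP e.
  have : h v \in limg g by rewrite e memv_proj.
  by case/memv_imgP => v' _ e'; apply: hf e'.
exists (F \o r)%VF; split=> v; first by rewrite -FE !comp_lfunE.
by rewrite lfunE /= rg linear0.
Qed.

End LinearAlgebra.

Section Graded.
Variables (k : fieldType) (p : nat).
Implicit Types M N : grmod k p.

(** A grading only gives subspaces in direct sum; these are the projections
    onto them. Outside the finite list of degrees the subspace is zero, and
    so is the projection. *)
Lemma gproj_exists (M : grmod k p) : exists P : int -> 'End(gsp M),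
  [/\ forall n v, P n v \in gdeg M n,
      forall n v, v \in gdeg M n -> P n v = v,
      forall n n' v, n != n' -> v \in gdeg M n' -> P n v = 0
    & exists D, forall v, v = \sum_(n <- D) P n v].
Proof.
have [D uD [sD dD oD]] := gdegP M.
pose W n := (\sum_(n' <- D | n' != n) gdeg M n')%VS.
have cap0 n : n \in D -> (gdeg M n :&: W n = 0)%VS.
  move=> nD; apply/eqP; rewrite -dimv_eq0.
  have := dimv_sum_cap (gdeg M n) (W n).
  have -> : (gdeg M n + W n)%VS = fullv by rewrite -sD (bigD1_seq n).
  move: dD; rewrite directvE /= sD => /eqP dD.
  have leW : (\dim (W n) <= \sum_(n' <- D | n' != n) \dim (gdeg M n'))%N.
    exact: dimv_leq_sum.
  by move: dD leW; rewrite (bigD1_seq n) //=; set a := \dim fullv; lia.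
pose P n : 'End(gsp M) := if n \in D then daddv_pi (gdeg M n) (W n) else 0.
have Pin n v : P n v \in gdeg M n.
  by rewrite /P; case: ifP => _; rewrite ?memv_pi // lfunE /= mem0v.
have Pid n v : v \in gdeg M n -> P n v = v.
  rewrite /P; case: ifP => [nD|/negbT nD] vM; first exact: daddv_pi_id (cap0 n nD) vM.
  by move: vM; rewrite (oD _ nD) memv0 => /eqP ->; rewrite linear0.
have P0 n n' v : n != n' -> v \in gdeg M n' -> P n v = 0.
  move=> nn' vM; rewrite /P; case: ifP => [nD|_]; last by rewrite lfunE.
  have vW : v \in W n.
    case: (boolP (n' \in D)) => [n'D|/oD e]; last by move: vM;
      rewrite e memv0 => /eqP ->; rewrite mem0v.
    rewrite /W -big_filter (bigD1_seq n') ?filter_uniq ?mem_filter ?n'D ?(eq_sym n')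
      ?nn' //=.
    by rewrite (subvP (addvSl _ _)).
  have := daddv_pi_add (cap0 n nD) (subvP (addvSr (gdeg M n) (W n)) _ vW).
  rewrite [X in _ + X]daddv_pi_id ?(capvC (W n)) ?(cap0 n nD) //.
  by move/(congr1 (fun w => w - v)); rewrite addrK subrr.
exists P; split=> //; exists D => v.
have : v \in (\sum_(n <- D) gdeg M n)%VS by rewrite sD memvf.
have sub : (\sum_(n <- D) gdeg M n <= lker (\sum_(n <- D) P n - \1%VF))%VS.
  apply: (big_ind (fun U => U <= lker (\sum_(n <- D) P n - \1%VF))%VS).
  - by rewrite sub0v.
  - by move=> A B hA hB; rewrite subv_add hA.
  move=> n _; apply/subvP => w wM;
    rewrite memv_ker add_lfunE opp_lfunE id_lfunE sum_lfunE subr_eq0; apply/eqP.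
  case: (boolP (n \in D)) => [nD|/oD e]; last first.
    by move: wM; rewrite e memv0 => /eqP ->; rewrite big1 // => i _; rewrite linear0.
  rewrite (bigD1_seq n) //= Pid // big1_seq ?addr0 //.
  by move=> i /andP[inn _]; apply: P0 wM.
move=> /(subvP sub);
  rewrite memv_ker add_lfunE opp_lfunE id_lfunE sum_lfunE subr_eq0 eq_sym.
by move/eqP.
Qed.

Definition gproj M (n : int) : 'End(gsp M) := projT1 (cid (gproj_exists M)) n.

Lemma gproj_mem M n v : gproj M n v \in gdeg M n.
Proof. by rewrite /gproj; case: cid => P []. Qed.
Lemma gproj_id M n v : v \in gdeg M n -> gproj M n v = v.
Proof. by rewrite /gproj; case: cid => P /= [_ h _ _]; apply: h. Qed.
Lemma gproj_0 M n n' v : n != n' -> v \in gdeg M n' -> gproj M n v = 0.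
Proof. by rewrite /gproj; case: cid => P /= [_ _ h _]; apply: h. Qed.
Lemma gproj_sum M : exists D, forall v, v = \sum_(n <- D) gproj M n v.
Proof. by rewrite /gproj; case: cid => P /= []. Qed.

Lemma deg_ind M (P : M -> Prop) : P 0 -> (forall v w, P v -> P w -> P (v + w)) ->
  (forall n v, v \in gdeg M n -> P v) -> forall v, P v.
Proof.
move=> P0 PD Ph v; have [D e] := gproj_sum M; rewrite (e v).
by apply: (big_ind P) => // n _; exact: Ph (gproj_mem n v).
Qed.

Lemma gproj_hom M N (f : 'Hom(M, N)) n v : grhom f -> f (gproj M n v) = gproj N n (f v).
Proof.
case=> fd _; move: v;
  apply: (@deg_ind M (fun v => f (gproj M n v) = gproj N n (f v))) =>
  [|v w hv hw|n' v vM]; rewrite ?linear0 //.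
  by rewrite [gproj M n _]linearD [f (v + w)]linearD ![X in X = _]linearD
    ![X in _ = X]linearD; rewrite /= hv hw.
have fv : f v \in gdeg N n' by rewrite (subvP (fd n')) ?memv_img.
case: (eqVneq n n') vM fv => [<-|ne] vM fv; first by rewrite !gproj_id.
by rewrite !(gproj_0 ne) // linear0.
Qed.

Lemma hom_deg M N (f : 'Hom(M, N)) n v : grhom f -> v \in gdeg M n -> f v \in gdeg N n.
Proof. by case=> fd _ vM; rewrite (subvP (fd n)) ?memv_img. Qed.

Lemma grhomP M N (f : 'Hom(M, N)) :
  (forall n v, v \in gdeg M n -> f v \in gdeg N n) ->
    (forall v, f (gx M v) = gx N (f v)) ->
  grhom f.
Proof. by move=> h hx; split=> // n; apply/subvP => _ /memv_imgP[v /h + ->]. Qed.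

Lemma deg_gx M n v : v \in gdeg M n -> gx M v \in gdeg M (n + 1).
Proof. by move=> vM; rewrite (subvP (gx_deg M n)) ?memv_img. Qed.

Lemma hom_iter M N (f : 'Hom(M, N)) i v : grhom f ->
  f (iter i (gx M) v) = iter i (gx N) (f v).
Proof. by case=> _ fx; elim: i => //= i <-; rewrite fx. Qed.

Lemma deg_iter M n v i : v \in gdeg M n -> iter i (gx M) v \in gdeg M (n + i%:Z).
Proof.
move=> vM; elim: i => [|i IH] /=; first by rewrite addr0.
by rewrite -addn1 PoszD addrA deg_gx.
Qed.

Definition xpow M i : 'End(gsp M) := iter i (comp_lfun (gx M)) \1%VF.
Lemma xpowE M i v : xpow M i v = iter i (gx M) v.
Proof. by elim: i => [|i IH]; rewrite /= lfunE //= IH. Qed.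

Lemma iter_ge M i v : (p <= i)%N -> iter i (gx M) v = 0.
Proof.
move=> pi; rewrite -(subnK pi) iterD gx_nil -xpowE; exact: linear0.
Qed.

Lemma inj_deg M N (f : 'Hom(M, N)) n v : grhom f -> injective f -> f v \in gdeg N n ->
  v \in gdeg M n.
Proof.
by move=> gf fi fv;
  rewrite -[v](fi _ _ (_ : f (gproj M n v) = _)) ?gproj_mem // (gproj_hom _ _ gf)
  gproj_id.
Qed.

Lemma surj_deg M N (f : 'Hom(M, N)) n w : grhom f -> (forall w, exists v, f v = w) ->
  w \in gdeg N n -> exists2 v, v \in gdeg M n & f v = w.
Proof.
move=> gf fs wN; have [v fv] := fs w; exists (gproj M n v); first exact: gproj_mem.
by rewrite (gproj_hom _ _ gf) fv gproj_id.
Qed.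

End Graded.

(** * The cyclic graded modules k[x]/(x^b) *)

Section Rows.
Variable k : fieldType.

(** Entries are indexed by all natural numbers, with value 0 out of range,
    so that modules of different lengths are compared without casts between
    ordinals. *)
Definition entry n (v : 'rV[k]_n) (i : nat) : k :=
  if insub i is Some j then v 0 j else 0.
Definition row_of n (F : nat -> k) : 'rV[k]_n := \row_(i < n) F i.

Lemma entry_ord n (v : 'rV[k]_n) (i : 'I_n) : entry v i = v 0 i.
Proof. by rewrite /entry valK. Qed.
Lemma entry_out n (v : 'rV[k]_n) i : (n <= i)%N -> entry v i = 0.
Proof. by move=> h; rewrite /entry insubF // ltnNge h. Qed.
Lemma entry_row_of n F i : entry (row_of n F) i = if (i < n)%N then F i else 0.
Proof. by rewrite /entry; case: insubP => [j -> /= <-|/negbTE ->//]; rewrite mxE. Qed.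
Lemma entryP n (v w : 'rV[k]_n) : (forall i, (i < n)%N -> entry v i = entry w i) ->
  v = w.
Proof. by move=> h; apply/rowP => i; rewrite -!entry_ord h. Qed.
Lemma entryD n (v w : 'rV[k]_n) i : entry (v + w) i = entry v i + entry w i.
Proof. by rewrite /entry; case: insub => [j|]; rewrite ?mxE ?addr0. Qed.
Lemma entryN n (v : 'rV[k]_n) i : entry (- v) i = - entry v i.
Proof. by rewrite /entry; case: insub => [j|]; rewrite ?mxE ?oppr0. Qed.
Lemma entryZ n a (v : 'rV[k]_n) i : entry (a *: v) i = a * entry v i.
Proof. by rewrite /entry; case: insub => [j|]; rewrite ?mxE ?mulr0. Qed.
Lemma entry0 n i : entry (0 : 'rV[k]_n) i = 0.
Proof. by rewrite /entry; case: insub => [j|]; rewrite ?mxE. Qed.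
Lemma entry_sum n (I : Type) (r : seq I) (F : I -> 'rV[k]_n) i :
  entry (\sum_(j <- r) F j) i = \sum_(j <- r) entry (F j) i.
Proof. by apply: (big_morph (fun v : 'rV[k]_n => entry v i)) => [v w|];
  rewrite ?entryD ?entry0. Qed.

Lemma slide_linear b1 b2 n : linear (fun v : 'rV[k]_b1 =>
  row_of b2 (fun i => if (n <= i)%N then entry v (i - n)%N else 0)).
Proof.
move=> a v w; apply: entryP => i hi; rewrite entryD entryZ !entry_row_of hi;
  case: ifP => _.
  by rewrite entryD entryZ.
by rewrite mulr0 addr0.
Qed.
(** Multiplication by x, the inclusions of the submodules x^n N and the
    truncations onto quotients are all of this form: entries pushed past the
    end are lost. *)
Definition slide b1 b2 n : 'Hom('rV[k]_b1, 'rV[k]_b2) :=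
  mk_lfun (@slide_linear b1 b2 n).
Lemma entry_slide b1 b2 n v i :
  entry (@slide b1 b2 n v) i = if (n <= i < b2)%N then entry v (i - n)%N else 0.
Proof. by rewrite mk_lfunE entry_row_of; case: (i < b2)%N; rewrite ?andbT ?andbF. Qed.

Lemma iter_slide b i v j :
  entry (iter i (@slide b b 1) v) j = if (i <= j < b)%N then entry v (j - i)%N else 0.
Proof.
elim: i j => [|i IH] j /=.
  by rewrite subn0; case: ltnP => // h; rewrite entry_out.
rewrite entry_slide IH; case: ifP => h1; last by case: ifP => // h2; exfalso; lia.
by case: ifP; case: ifP => // h2 h3; first (congr entry; lia); exfalso; lia.
Qed.

Definition gen b : 'rV[k]_b := row_of b (fun i => (i == 0)%N%:R).
Lemma entry_gen b i : entry (gen b) i = ((i == 0) && (0 < b))%N%:R.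
Proof. by rewrite entry_row_of; case: i => [|i]; case: b => // b; case: ifP. Qed.

End Rows.
Arguments gen {k b}.
Arguments slide {k b1 b2} n.

Section Intervals.
Variables (k : fieldType) (p : nat).

Section CyclicModule.
Variables (b : nat) (g : int).

Lemma other_degrees_linear (n : int) : linear (fun v : 'rV[k]_b =>
  row_of b (fun i => if g + i%:Z == n then 0 else entry v i)).
Proof.
by move=> a v w; apply: entryP => i hi; rewrite entryD entryZ !entry_row_of hi;
  case: ifP => _;
  rewrite ?entryD ?entryZ ?mulr0 ?addr0.
Qed.

(** Given as a kernel, so that membership is the vanishing of the entries in
    all other degrees. *)
Definition cycdeg (n : int) : {vspace 'rV[k]_b} :=
  lker (mk_lfun (other_degrees_linear n)).

Lemma cycdegP n v : reflect (forall i, g + i%:Z != n -> entry v i = 0) (v \in cycdeg n).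
Proof.
rewrite memv_ker mk_lfunE; apply: (iffP eqP) => [e i ne|h].
  case: (ltnP i b) => [hi|/entry_out-> //].
  by move/(congr1 (fun w => entry w i)): e; rewrite entry_row_of hi (negbTE ne) entry0.
by apply: entryP => i hi; rewrite entry_row_of hi entry0; case: eqP => // /eqP /h.
Qed.

Lemma iter_gen i : (i < b)%N -> iter i (slide 1) gen \in cycdeg (g + i%:Z).
Proof.
move=> hi; apply/cycdegP => j ne; rewrite iter_slide entry_gen.
by case: ifP => // h; case: eqP => //= e; exfalso; case/negP: ne; apply/eqP;
  congr (_ + _%:Z); lia.
Qed.

Lemma entry_iter_gen i j :
  entry (iter i (slide 1) (gen : 'rV[k]_b)) j = ((i == j) && (j < b))%N%:R.
Proof.
rewrite iter_slide entry_gen; case: ifP => [/andP[h1 h2]|]; last first.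
  by case: eqP => [->|] //; rewrite leqnn /= => ->.
by rewrite h2 andbT subn_eq0 (leq_ltn_trans _ h2) // andbT eqn_leq h1.
Qed.

Lemma row_gen (v : 'rV[k]_b) : v = \sum_(i < b) entry v i *: iter i (slide 1) gen.
Proof.
apply: entryP => j hj; rewrite entry_sum (bigD1 (Ordinal hj)) //= big1 => [|i ne].
  by rewrite addr0 entryZ entry_iter_gen eqxx hj mulr1.
by rewrite entryZ entry_iter_gen -val_eqE /= in ne *; rewrite (negbTE ne) mulr0.
Qed.

Let iota_index : iota 0 b = index_iota 0 b.
Proof. by rewrite /index_iota subn0. Qed.

Lemma cycdeg_grading : is_grading cycdeg.
Proof.
have full : (\sum_(n <- [seq (g + i%:Z)%R | i <- iota 0 b]) cycdeg n)%VS = fullv.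
  apply/eqP; rewrite eqEsubv subvf /=; apply/subvP => v _; rewrite [v]row_gen.
  rewrite big_map iota_index big_mkord.
  by apply: memv_sumr => i _; rewrite memvZ // iter_gen.
exists [seq (g + i%:Z)%R | i <- iota 0 b].
  by rewrite map_inj_uniq ?iota_uniq // => i j /addrI [].
split=> //.
  rewrite directvEgeq /= full dimvf /dim /= mul1n.
  rewrite big_map iota_index big_mkord.
  rewrite -[X in (_ <= X)%N](card_ord b) -sum1_card; apply: leq_sum => i _.
  have /dimvS : (cycdeg (g + (i : nat)%:Z)%R <= <[iter i (slide 1) gen]>)%VS.
    apply/subvP => v /cycdegP h; apply/vlineP; exists (entry v i);
      apply: entryP => j hj.
    rewrite entryZ entry_iter_gen hj andbT; case: eqP => [->|ne];
      first by rewrite mulr1.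
    rewrite mulr0 h //; apply/eqP => /addrI [e]; exact: ne.
  by move/leq_trans; apply; rewrite dim_vline; case: eqP.
move=> n nD; apply/eqP; rewrite -subv0; apply/subvP => v /cycdegP h; rewrite memv0.
apply/eqP/entryP => i hi; rewrite entry0 h //; apply: contra nD => /eqP <-.
by apply/mapP; exists i => //; rewrite mem_iota.
Qed.

Lemma cycdeg_x n : (slide 1 @: cycdeg n <= cycdeg (n + 1)%R)%VS.
Proof.
apply/subvP => _ /memv_imgP[v /cycdegP h ->]; apply/cycdegP => -[|i] ne;
  rewrite entry_slide //=.
by case: ifP => // _; rewrite subn1 /= h //; apply: contra ne => /eqP <-;
  rewrite -addrA -PoszD addn1.
Qed.

Lemma cyc_nil (hb : (b <= p)%N) (v : 'rV[k]_b) : iter p (slide 1) v = 0.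
Proof. by apply: entryP => i hi; rewrite iter_slide entry0; case: ifP => // h; exfalso;
  lia. Qed.

Definition cycmod (hb : (b <= p)%N) : grmod k p :=
  GrMod cycdeg_grading cycdeg_x (cyc_nil hb).

End CyclicModule.

Section MapOut.
Variables (M : grmod k p) (b : nat).

Lemma cyc_out_linear (m : M) :
  linear (fun v : 'rV[k]_b => \sum_(i < b) entry v i *: iter i (gx M) m).
Proof.
move=> a v w; rewrite scaler_sumr -big_split /=; apply: eq_bigr => i _.
by rewrite entryD entryZ scalerDl scalerA.
Qed.
(** The map sending the generator to [m]; it is a module map as soon as x^b
    m = 0. *)
Definition cyc_out m : 'Hom('rV[k]_b, M) := mk_lfun (cyc_out_linear m).
Lemma cyc_outE m v : cyc_out m v = \sum_(i < b) entry v i *: iter i (gx M) m.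
Proof. exact: mk_lfunE. Qed.

Lemma cyc_out_gen m : iter b (gx M) m = 0 -> cyc_out m gen = m.
Proof.
rewrite cyc_outE; case: b => [|c] => [/= ->|_]; first by rewrite big_ord0.
rewrite big_ord_recl /= entry_gen /= scale1r big1 ?addr0 // => i _.
by rewrite entry_gen /= scale0r.
Qed.

Lemma cyc_out_x m v : iter b (gx M) m = 0 -> cyc_out m (slide 1 v) = gx M (cyc_out m v).
Proof.
rewrite !cyc_outE linear_sum /=; case: b v => [|c] v h; first by rewrite !big_ord0 .
rewrite big_ord_recl [RHS]big_ord_recr /= entry_slide /= scale0r add0r.
rewrite [gx M (_ *: iter c _ _)]linearZ /= -iterS h scaler0 addr0;
  apply: eq_bigr => i _.
by rewrite linearZ /= entry_slide /= ltnS ltn_ord subn1.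
Qed.

Lemma cyc_out_iter m v i : iter b (gx M) m = 0 ->
  cyc_out m (iter i (slide 1) v) = iter i (gx M) (cyc_out m v).
Proof. by move=> h; elim: i => //= i <-; rewrite cyc_out_x. Qed.

Lemma cyc_out_hom (hb : (b <= p)%N) g m : m \in gdeg M g -> iter b (gx M) m = 0 ->
  @grhom k p (cycmod g hb) M (cyc_out m).
Proof.
move=> mM h; apply: grhomP => [n v /cycdegP vn|v]; last exact: cyc_out_x.
rewrite cyc_outE; apply: memv_suml => i _;
  case: (eqVneq (g + (i : nat)%:Z) n) => [<-|ne].
  by rewrite memvZ // deg_iter.
by rewrite vn // scale0r mem0v.
Qed.
End MapOut.

Lemma cyc_out_nat (M N : grmod k p) (f : 'Hom(M, N)) b m v :
  grhom f -> f (cyc_out b m v) = cyc_out b (f m) v.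
Proof.
move=> gf; rewrite !cyc_outE linear_sum /=; apply: eq_bigr => i _.
by rewrite linearZ /= (hom_iter _ _ gf).
Qed.

Lemma cycmod_hom b g (hb : (b <= p)%N) (M : grmod k p) (f : 'Hom('rV[k]_b, M)) v :
  @grhom k p (cycmod g hb) M f -> f v = cyc_out b (f gen) v.
Proof.
move=> gf; rewrite {1}[v]row_gen cyc_outE linear_sum /=; apply: eq_bigr => i _.
by rewrite linearZ /= (hom_iter _ _ gf).
Qed.

Lemma gen_deg b g : gen \in cycdeg b g g.
Proof. by apply/cycdegP => i ne; rewrite entry_gen; case: i ne => //;
  rewrite addr0 eqxx. Qed.

Lemma iter_cycdeg b g n v i : v \in cycdeg b g n ->
  iter i (slide 1) v \in cycdeg b g (n + i%:Z).
Proof.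
elim: i => [|i IH] h; first by rewrite addr0.
have -> : n + i.+1%:Z = n + i%:Z + 1 by lia.
by rewrite (subvP (cycdeg_x b g _)) // memv_img // IH.
Qed.

Lemma iter_b b (v : 'rV[k]_b) : iter b (slide 1) v = 0.
Proof. by apply: entryP => i hi; rewrite iter_slide leqNgt hi entry0. Qed.

Lemma slide_hom b1 b2 n g1 g2 (h1 : (b1 <= p)%N) (h2 : (b2 <= p)%N) :
  (b2 <= b1 + n)%N -> g1 = g2 + n%:Z ->
  @grhom k p (cycmod g1 h1) (cycmod g2 h2) (slide n).
Proof.
move=> le e; apply: grhomP => [m v /cycdegP vm|v] /=.
  apply/cycdegP => i ne; rewrite entry_slide; case: ifP => // h; apply: vm.
  by rewrite e; apply: contra ne => /eqP <-; apply/eqP; lia.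
apply: entryP => i hi; rewrite !entry_slide; case: (ltnP n i) => ni.
  have [-> ->] : (n <= i < b2)%N /\ (0 < i - n < b1)%N by lia.
  have [-> ->] : (0 < i < b2)%N /\ (n <= i - 1 < b2)%N by lia.
  by congr entry; lia.
have -> : (0 < i - n < b1)%N = false by lia.
have -> : (n <= i - 1 < b2)%N = (i == 0)%N && (n == 0)%N by lia.
by do !case: ifP => //; lia.
Qed.

Section MapIn.
Variables (M : grmod k p) (c : nat).

Lemma cyc_in_linear (P : 'Hom(M, k^o)) :
  linear (fun m : M => row_of c (fun i => P (iter (c.-1 - i) (gx M) m))).
Proof.
move=> a v w; apply: entryP => i hi;
  rewrite entryD entryZ !entry_row_of hi -!xpowE linearD linearZ /=.
by rewrite linearD linearZ.
Qed.
(** The socle of k[x]/(x^c) is simple, so a module map into it is recovered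
    from its last entry [P]: the entry i of the image of m is P (x^(c - 1 -
    i) m). *)
Definition cyc_in P : 'Hom(M, 'rV[k]_c) := mk_lfun (cyc_in_linear P).
Lemma entry_cyc_in P m i :
  entry (cyc_in P m) i = if (i < c)%N then P (iter (c.-1 - i) (gx M) m) else 0.
Proof. by rewrite mk_lfunE entry_row_of. Qed.

Definition form_deg (P : 'Hom(M, k^o)) h := forall n m, n != h -> m \in gdeg M n ->
  P m = 0.

Lemma cyc_in_hom (hc : (c <= p)%N) g P : form_deg P (g + c%:Z - 1) ->
  (forall m, P (iter c (gx M) m) = 0) -> @grhom k p M (cycmod g hc) (cyc_in P).
Proof.
move=> Pd Pc; apply: grhomP => [n m mM|m] /=.
  apply/cycdegP => i ne; rewrite entry_cyc_in; case: ifP => // hi;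
    apply: (Pd (n + (c.-1 - i)%N%:Z)); last exact: deg_iter.
  by apply: contra ne => /eqP e; apply/eqP; lia.
apply: entryP => i hi; rewrite entry_slide !entry_cyc_in hi andbT;
  case: i hi => [|i] hi /=.
  by rewrite subn0 -iterSr prednK ?Pc //; lia.
rewrite subn1 /= (ltnW hi) -iterSr.
by have -> : (c.-1 - i = (c.-1 - i.+1).+1)%N by lia.
Qed.
End MapIn.
End Intervals.

(** * Ladder morphisms and intervals *)

Section Ladders.
Variables (k : fieldType) (p : nat).
Local Notation ladder := (ladder k p).
Local Notation sobj := (sobj k p).
Implicit Types X Y Z W : ladder.

Lemma lcomp1E X Y Z (g : lhom Y Z) (f : lhom X Y) u : (lhom_comp g f).1 u = g.1 (f.1 u).
Proof. by rewrite /= lfunE. Qed.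
Lemma lcomp2E X Y Z (g : lhom Y Z) (f : lhom X Y) u : (lhom_comp g f).2 u = g.2 (f.2 u).
Proof. by rewrite /= lfunE. Qed.
Lemma ladd2E X Y (g f : lhom X Y) u : (f + g).2 u = f.2 u + g.2 u.
Proof. by rewrite /= lfunE. Qed.
Lemma lscale2E X Y a (f : lhom X Y) u : (a *: f).2 u = a *: f.2 u.
Proof. by rewrite /= lfunE. Qed.
Lemma lzero1E X Y u : (0 : lhom X Y).1 u = 0.
Proof. by rewrite /= lfunE. Qed.
Lemma lzero2E X Y u : (0 : lhom X Y).2 u = 0.
Proof. by rewrite /= lfunE. Qed.
Lemma lid1E X u : (lhom_id X).1 u = u.
Proof. by rewrite /= lfunE. Qed.
Lemma lid2E X u : (lhom_id X).2 u = u.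
Proof. by rewrite /= lfunE. Qed.

Lemma lhom_gr1 X Y (f : lhom X Y) : grhom f.1. Proof. by case: (lhomP f). Qed.
Lemma lhom_gr2 X Y (f : lhom X Y) : grhom f.2. Proof. by case: (lhomP f). Qed.
Lemma lhom_sq X Y (f : lhom X Y) u : f.2 (lmap X u) = lmap Y (f.1 u).
Proof. by case: (lhomP f). Qed.

Lemma lhomE2 X (Y : sobj) (f g : lhom X Y) : f.2 =1 g.2 -> f = g.
Proof.
move=> e; apply: lhomE => // u; apply: (@sobj_mono _ _ Y).
by rewrite -!lhom_sq e.
Qed.

(** An injective graded map reflects degrees and the action of x, so the
    linear preimage of [g] is automatically a morphism. *)
Lemma lift_ker X Y W (i : lhom X Y) (g : lhom W Y) : inj_lhom i ->
  (forall w, exists x, i.1 x = g.1 w) -> (forall w, exists x, i.2 x = g.2 w) ->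
  exists h : lhom W X, lhom_comp i h = g.
Proof.
move=> [i1 i2] e1 e2.
have inv (V V' : vectType k) (f : 'Hom(V, V')) y : (exists x, f x = y) ->
  f (f^-1%VF y) = y.
  by case=> x <-; rewrite limg_lfunVK // memv_img // memvf.
have h1 w : i.1 ((i.1^-1)%VF (g.1 w)) = g.1 w by apply: inv.
have h2 w : i.2 ((i.2^-1)%VF (g.2 w)) = g.2 w by apply: inv.
have hP : @is_lhom _ _ W X ((i.1^-1 \o g.1)%VF, (i.2^-1 \o g.2)%VF).
  split=> /=.
  - apply: grhomP => [n v vW|v]; rewrite !lfunE /=.
      by apply: (inj_deg (lhom_gr1 i) i1); rewrite h1; apply: hom_deg (lhom_gr1 g) vW.
    by apply: i1; rewrite h1 (lhom_gr1 i).2 h1 (lhom_gr1 g).2.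
  - apply: grhomP => [n v vW|v]; rewrite !lfunE /=.
      by apply: (inj_deg (lhom_gr2 i) i2); rewrite h2; apply: hom_deg (lhom_gr2 g) vW.
    by apply: i2; rewrite h2 (lhom_gr2 i).2 h2 (lhom_gr2 g).2.
  by move=> u; rewrite !lfunE /=; apply: i2; rewrite h2 !lhom_sq h1.
exists (mkHom hP); apply: lhomE => w; rewrite ?lcomp1E ?lcomp2E /= lfunE;
  [exact: h1 | exact: h2].
Qed.

(** Homogeneous elements have homogeneous preimages under a surjective
    graded map, so the induced linear maps are automatically morphisms. *)
Lemma factor_coker Y Z W (q : lhom Y Z) (h : lhom Y W) : surj_lhom q ->
  (forall y, q.1 y = 0 -> h.1 y = 0) -> (forall y, q.2 y = 0 -> h.2 y = 0) ->
  exists h' : lhom Z W, lhom_comp h' q = h.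
Proof.
move=> [q1 q2] /lfun_factor[F FE] /lfun_factor[G GE].
have hP : @is_lhom _ _ Z W (F, G).
  split=> /=.
  - apply: grhomP => [n v vZ|v].
      have [y yY <-] := surj_deg (lhom_gr1 q) q1 vZ.
      by rewrite FE (hom_deg (lhom_gr1 h)).
    by have [y <-] := q1 v; rewrite -(lhom_gr1 q).2 !FE (lhom_gr1 h).2.
  - apply: grhomP => [n v vZ|v].
      have [y yY <-] := surj_deg (lhom_gr2 q) q2 vZ.
      by rewrite GE (hom_deg (lhom_gr2 h)).
    by have [y <-] := q2 v; rewrite -(lhom_gr2 q).2 !GE (lhom_gr2 h).2.
  by move=> u; have [y <-] := q1 u; rewrite -lhom_sq GE FE lhom_sq.
exists (mkHom hP); apply: lhomE => w; rewrite ?lcomp1E ?lcomp2E /=;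
  [exact: FE | exact: GE].
Qed.

Definition liso X Y := exists (f : lhom X Y) (g : lhom Y X),
  lhom_comp g f = lhom_id X /\ lhom_comp f g = lhom_id Y.

Lemma liso_of_bij X Y (f : lhom X Y) : inj_lhom f -> surj_lhom f -> liso X Y.
Proof.
move=> fi fs; have [g fg] := @lift_ker _ _ _ f (lhom_id Y) fi
  (fun w => let: ex_intro x e := fs.1 w in ex_intro _ x (etrans e (esym (lid1E w))))
  (fun w => let: ex_intro x e := fs.2 w in ex_intro _ x (etrans e (esym (lid2E w)))).
exists f, g; split=> //; apply: lhomE => v.
  by apply: fi.1; rewrite -lcomp1E lcompA fg lcomp1c lid1E.
by apply: fi.2; rewrite -lcomp2E lcompA fg lcomp1c lid2E.
Qed.

Lemma pair_map X Y Z (f : lhom X Z) (g : lhom Y Z) : exists h : lhom (lsum X Y) Z,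
  lhom_comp h (linl X Y) = f /\ lhom_comp h (linr X Y) = g.
Proof.
exists (lhom_comp f (lfst X Y) + lhom_comp g (lsnd X Y)).
rewrite !lcompDl -!lcompA lfst_linl lfst_linr lsnd_linl lsnd_linr.
by rewrite !lcompc1 !lcomp0r addr0 add0r.
Qed.

Lemma prod_map X Y Z (f : lhom Z X) (g : lhom Z Y) : exists h : lhom Z (lsum X Y),
  lhom_comp (lfst X Y) h = f /\ lhom_comp (lsnd X Y) h = g.
Proof.
exists (lhom_comp (linl X Y) f + lhom_comp (linr X Y) g).
rewrite !lcompDr !lcompA lfst_linl lfst_linr lsnd_linl lsnd_linr.
by rewrite !lcomp1c !lcomp0l addr0 add0r.
Qed.

Lemma prod_ext X Y Z (f g : lhom Z (lsum X Y)) :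
  lhom_comp (lfst X Y) f = lhom_comp (lfst X Y) g ->
  lhom_comp (lsnd X Y) f = lhom_comp (lsnd X Y) g -> f = g.
Proof.
by move=> e1 e2; rewrite -[f]lcomp1c -[g]lcomp1c -lsumE !lcompDl -!lcompA e1 e2.
Qed.

Section Interval.
Variables (a b : nat) (g : int) (h : (a <= b <= p)%N).

Lemma ivl_a : (a <= p)%N. Proof. lia. Qed.
Lemma ivl_b : (b <= p)%N. Proof. lia. Qed.

Lemma ivl_map : @grhom k p (cycmod k (g + (b - a)%N%:Z) ivl_a) (cycmod k g ivl_b)
  (slide (b - a)).
Proof. by apply: slide_hom => //; lia. Qed.
(** The submodule of length a of the cyclic module N_b on a generator of
    degree g. It is generated by x^(b - a) times that generator, whence its
    degree. *)
Definition livl : ladder := Ladder ivl_map.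

Lemma livl_mono : injective (lmap livl).
Proof.
move=> v w /= e; apply: entryP => i hi.
move/(congr1 (fun v => entry v (i + (b - a))%N)): e; rewrite !entry_slide addnK.
by have -> : (b - a <= i + (b - a) < b)%N by lia.
Qed.
Definition ivl : sobj := SObj livl_mono.

Lemma ivl_gen : slide (b - a) (gen : 'rV[k]_a) = iter (b - a) (slide 1)
  (gen : 'rV[k]_b).
Proof.
apply: entryP => i hi; rewrite entry_slide iter_slide !entry_gen; case: ifP => // h'.
by case: eqP => //= e; congr (nat_of_bool _)%:R; lia.
Qed.

Lemma ivl_out Z (m : lM Z) (u : lU Z) : m \in gdeg (lM Z) g ->
  u \in gdeg (lU Z) (g + (b - a)%N%:Z) ->
  iter b (gx _) m = 0 -> iter a (gx _) u = 0 -> lmap Z u = iter (b - a) (gx _) m ->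
  exists f : lhom ivl Z, f.1 = cyc_out a u /\ f.2 = cyc_out b m.
Proof.
move=> mM uU mb ua mu; have hP : @is_lhom _ _ ivl Z (cyc_out a u, cyc_out b m).
  split=> /=; [exact: cyc_out_hom | exact: cyc_out_hom |].
  move=> v; rewrite (cyc_out_nat _ _ (lmapP Z)) mu.
  rewrite (cycmod_hom v ivl_map) (cyc_out_nat _ _ (cyc_out_hom ivl_b mM mb)) ivl_gen.
  by rewrite cyc_out_iter // cyc_out_gen.
by exists (mkHom hP).
Qed.

Lemma ivl_ext Z (f f' : lhom ivl Z) : f.1 gen = f'.1 gen -> f.2 gen = f'.2 gen ->
  f = f'.
Proof.
move=> e1 e2; apply: lhomE => v.
  by rewrite (cycmod_hom v (lhom_gr1 f)) (cycmod_hom v (lhom_gr1 f')) e1.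
by rewrite (cycmod_hom v (lhom_gr2 f)) (cycmod_hom v (lhom_gr2 f')) e2.
Qed.

Lemma ivl_ext2 (Z : sobj) (f f' : lhom ivl Z) : f.2 gen = f'.2 gen -> f = f'.
Proof.
move=> e2; apply: lhomE2 => v.
by rewrite (cycmod_hom v (lhom_gr2 f)) (cycmod_hom v (lhom_gr2 f')) e2.
Qed.

Lemma ivl_gen_mem Z (f : lhom ivl Z) : [/\ f.2 gen \in gdeg (lM Z) g,
  iter b (gx _) (f.2 gen) = 0 & iter (b - a) (gx _) (f.2 gen) = lmap Z (f.1 gen)].
Proof.
split.
- by apply: (hom_deg (lhom_gr2 f)); apply: gen_deg.
- by rewrite -(hom_iter _ _ (lhom_gr2 f)) /= iter_b linear0.
by rewrite -(hom_iter _ _ (lhom_gr2 f)) /= -ivl_gen; exact: (lhom_sq f).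
Qed.

(** Since the second component determines the first one over a monomorphism
    U -> M, a map from (N_a in N_b) is just an element m of M with x^b m = 0
    and x^(b - a) m in U. *)
Lemma ivl_out2 (Z : sobj) (m : lM Z) (u : lU Z) : m \in gdeg (lM Z) g ->
  iter b (gx _) m = 0 -> lmap Z u = iter (b - a) (gx _) m ->
  exists f : lhom ivl Z, f.2 gen = m.
Proof.
move=> mM mb mu; have uU : u \in gdeg (lU Z) (g + (b - a)%N%:Z).
  by apply: (inj_deg (lmapP Z) (@sobj_mono _ _ Z)); rewrite mu deg_iter.
have ua : iter a (gx _) u = 0.
  apply: (@sobj_mono _ _ Z); rewrite (hom_iter _ _ (lmapP Z)) mu linear0 -iterD.
  by have -> : (a + (b - a) = b)%N by lia.
have [f [_ e]] := ivl_out mM uU mb ua mu; exists f.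
by rewrite e cyc_out_gen.
Qed.

(** Dually, maps to (N_a in N_b) are the forms on M, homogeneous in the
    degree of the socle, that kill x^b M and x^a U. *)
Lemma ivl_in Z (P : 'Hom(lM Z, k^o)) : form_deg P (g + b%:Z - 1) ->
  (forall m, P (iter b (gx _) m) = 0) -> (forall u, P (lmap Z (iter a (gx _) u)) = 0) ->
  exists f : lhom Z ivl, f.2 = cyc_in b P.
Proof.
move=> Pd Pb Pa; have hP : @is_lhom _ _ Z ivl (cyc_in a (P \o lmap Z)%VF, cyc_in b P).
  split=> /=.
  - apply: cyc_in_hom => [n u ne uU|u]; rewrite lfunE /= ?Pa //.
    by apply: Pd (hom_deg (lmapP Z) uU); move: ne; apply: contra => /eqP ->; apply/eqP;
      lia.
  - exact: cyc_in_hom.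
  move=> u; apply: entryP => i hi;
    rewrite entry_slide !entry_cyc_in hi andbT /= lfunE /=.
  have E j : P (iter j (gx (lM Z)) (lmap Z u)) = P (lmap Z (iter j (gx _) u)).
    by rewrite -(hom_iter _ _ (lmapP Z)).
  case: ifP => h1; rewrite E.
    have -> : (i - (b - a) < a)%N by lia.
    by have -> : (a.-1 - (i - (b - a)) = b.-1 - i)%N by lia.
  have -> : (b.-1 - i = a + (b.-1 - i - a))%N by lia.
  by rewrite iterD Pa.
by exists (mkHom hP).
Qed.

Lemma ivl_in_form Z (f : lhom Z ivl) : exists P : 'Hom(lM Z, k^o),
  [/\ form_deg P (g + b%:Z - 1),
    (forall m, P m = entry (f.2 m) b.-1) & f.2 = cyc_in b P].
Proof.
have lin : linear (fun m => entry (f.2 m) b.-1 : k^o).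
  by move=> c v w; rewrite linearD linearZ entryD entryZ.
exists (mk_lfun lin); split=> [n m ne mM|m|]; rewrite ?mk_lfunE //.
  have /cycdegP h' := hom_deg (lhom_gr2 f) mM.
  case: (ltnP b.-1 b) => hb; last by rewrite entry_out.
  by rewrite h' //; apply: contra ne => /eqP e; apply/eqP; lia.
apply/lfunP => m; apply: entryP => i hi; rewrite entry_cyc_in hi mk_lfunE.
rewrite (hom_iter _ _ (lhom_gr2 f)) iter_slide.
have -> : (b.-1 - i <= b.-1 < b)%N by lia.
by congr entry; lia.
Qed.

End Interval.
End Ladders.

(** * Projective objects are injective *)

Section Frobenius.
Variables (k : fieldType) (p : nat).
Local Notation ladder := (ladder k p).
Local Notation sobj := (sobj k p).
Local Notation "g '\oh' f" := (lhom_comp g f) (at level 40, left associativity).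

Lemma le_pp : (p <= p <= p)%N. Proof. by rewrite leqnn. Qed.
Lemma le_0p : (0 <= p <= p)%N. Proof. by rewrite leqnn. Qed.
Definition projU g : sobj := ivl k g le_pp.
Definition projM g : sobj := ivl k g le_0p.

(** An inductive class, so that lifting and extension of maps need only be
    checked on the two kinds of indecomposable projectives. *)
Inductive standard : sobj -> Prop :=
| standard0 : standard (szero k p)
| standardU g : standard (projU g)
| standardM g : standard (projM g)
| standardD Q R : standard Q -> standard R -> standard (ssum Q R).

Lemma projU_out (Z : ladder) g (u : lU Z) : u \in gdeg (lU Z) g ->
  exists f : lhom (projU g) Z, f.1 gen = u /\ f.2 gen = lmap Z u.
Proof.
move=> uZ; have [f [f1 f2]] : exists f : lhom (projU g) Z, f.1 = cyc_out p u /\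
  f.2 = cyc_out p (lmap Z u).
  apply: ivl_out; rewrite ?subnn ?addr0 ?gx_nil //.
  exact: hom_deg (lmapP Z) uZ.
by exists f; rewrite f1 f2 !cyc_out_gen ?gx_nil.
Qed.

Lemma projM_out (Z : ladder) g (m : lM Z) : m \in gdeg (lM Z) g ->
  exists f : lhom (projM g) Z, f.2 gen = m.
Proof.
move=> mZ; have [f [f1 f2]] : exists f : lhom (projM g) Z, f.1 = cyc_out 0 (0 : lU Z) /\
  f.2 = cyc_out p m.
  by apply: ivl_out; rewrite ?subn0 ?mem0v ?gx_nil ?linear0.
by exists f; rewrite f2 cyc_out_gen ?gx_nil.
Qed.

Lemma projU_gen2 g (Z : ladder) (f : lhom (projU g) Z) : f.2 gen = lmap Z (f.1 gen).
Proof.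
have := lhom_sq f gen; rewrite /= => <-; congr (f.2 _); apply: entryP => i hi.
by rewrite entry_slide subnn subn0 /= hi.
Qed.

Lemma projM_gen1 g (Z : ladder) (f : lhom (projM g) Z) : f.1 gen = 0.
Proof. by rewrite (_ : gen = 0) ?linear0 //; apply: entryP => i. Qed.

(** Maps out of [projU] and [projM] are elements of U and of M, and these
    lift along a surjection degree by degree. *)
Lemma standard_projective Q : standard Q -> projective Q.
Proof.
elim=> {Q} [|g|g|Q R _ pQ _ pR]; [exact: projective_zero | | | exact: projective_sum].
- move=> Y Z q f [q1 q2].
  have fU : f.1 gen \in gdeg (lU Z) g.
    by apply: (hom_deg (lhom_gr1 f)); rewrite /= subnn addr0; exact: gen_deg.
  have [u uY e] := surj_deg (lhom_gr1 q) q1 fU.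
  have [l [l1 l2]] := projU_out uY; exists l; apply: ivl_ext; rewrite ?lcomp1E ?lcomp2E.
    by rewrite l1.
  by rewrite !projU_gen2 l1 lhom_sq e.
move=> Y Z q f [q1 q2]; have [fM _ _] := ivl_gen_mem f.
have [m mY e] := surj_deg (lhom_gr2 q) q2 fM.
have [l l2] := projM_out mY; exists l; apply: ivl_ext; last by rewrite lcomp2E l2.
by rewrite !projM_gen1.
Qed.

Lemma coverU (Z : ladder) (s : seq (int * lU Z)) : exists (Q : sobj) (q : lhom Q Z),
  standard Q /\ forall w, w \in s -> exists x, q.1 x = gproj _ w.1 w.2.
Proof.
elim: s => [|[n v] s [Q [q [sQ IH]]]]; first by exists (szero k p), 0; split=> //;
  exact: standard0.
have [f [f1 _]] := projU_out (gproj_mem n v).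
have [h [hl hr]] := pair_map f q; exists (ssum (projU n) Q), h; split.
  by apply: standardD => //; exact: standardU.
move=> w; rewrite inE => /predU1P[-> /=|/IH[x e]].
  by exists ((linl (projU n) Q).1 gen); rewrite -(lcomp1E h) hl.
by exists ((linr (projU n) Q).1 x); rewrite -(lcomp1E h) hr.
Qed.

Lemma coverM (Z : ladder) (s : seq (int * lM Z)) : exists (Q : sobj) (q : lhom Q Z),
  standard Q /\ forall w, w \in s -> exists x, q.2 x = gproj _ w.1 w.2.
Proof.
elim: s => [|[n v] s [Q [q [sQ IH]]]]; first by exists (szero k p), 0; split=> //;
  exact: standard0.
have [f f2] := projM_out (gproj_mem n v).
have [h [hl hr]] := pair_map f q; exists (ssum (projM n) Q), h; split.
  by apply: standardD => //; exact: standardM.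
move=> w; rewrite inE => /predU1P[-> /=|/IH[x e]].
  by exists ((linl (projM n) Q).2 gen); rewrite -(lcomp2E h) hl.
by exists ((linr (projM n) Q).2 x); rewrite -(lcomp2E h) hr.
Qed.

(** The homogeneous components of a basis of U and of a basis of M are hit
    by one indecomposable projective each. *)
Lemma cover (Z : ladder) : exists (Q : sobj) (q : lhom Q Z), standard Q /\ surj_lhom q.
Proof.
have aux (V : vectType k) (N : grmod k p) (f : 'Hom(V, N)) D :
  (forall v : N, v = \sum_(n <- D) gproj _ n v) ->
  (forall w, w \in [seq (n, v) | n <- D, v <- vbasis (fullv : {vspace N})] ->
     exists x, f x = gproj _ w.1 w.2) -> forall v, exists x, f x = v.
  move=> e h v; suff /memv_imgP[x _ ->] : v \in limg f by exists x.
  rewrite (coord_vbasis (memvf v)); apply: memv_suml => i _; apply: memvZ.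
  rewrite (e _`_i) big_seq; apply: memv_suml => n nD.
  have [|x <-] := h (n, (vbasis fullv)`_i); last by rewrite memv_img ?memvf.
  by apply: allpairs_f => //; rewrite mem_nth // size_tuple.
have [D1 e1] := gproj_sum (lU Z); have [D2 e2] := gproj_sum (lM Z).
have [Q [q [sQ hq]]] :=
  coverU [seq (n, v) | n <- D1, v <- vbasis (fullv : {vspace lU Z})].
have [R [r [sR hr]]] :=
  coverM [seq (n, v) | n <- D2, v <- vbasis (fullv : {vspace lM Z})].
have [h [hl hr']] := pair_map q r; exists (ssum Q R), h; split; first exact: standardD.
split=> v.
  have [x <-] := aux _ _ q.1 _ e1 hq v.
  by exists ((linl Q R).1 x); rewrite -(lcomp1E h) hl.
have [x <-] := aux _ _ r.2 _ e2 hr v.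
by exists ((linr Q R).2 x); rewrite -(lcomp2E h) hr'.
Qed.

Lemma proj_retract (Q : sobj) : projective Q ->
  exists (R : sobj) (q : lhom R Q) (s : lhom Q R),
  standard R /\ q \oh s = lhom_id Q.
Proof.
move=> pQ; have [R [q [sR qs]]] := cover Q; have [s e] := pQ _ _ q (lhom_id Q) qs.
by exists R, q, s.
Qed.

Section Injective.
Variables (X Y Z : sobj) (i : lhom X Y) (q : lhom Y Z).
Hypothesis iq : conflation i q.

Lemma confl0 : q \oh i = 0.
Proof.
case: iq => _ _ h1 h2; apply: lhomE => v; rewrite ?lcomp1E ?lcomp2E ?lzero1E ?lzero2E.
  by apply/h1; exists v.
by apply/h2; exists v.
Qed.

Lemma confl_lift (W : ladder) (g : lhom W Y) : q \oh g = 0 -> exists h, i \oh h = g.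
Proof.
case: iq => ii _ h1 h2 qg; apply: lift_ker => // w; [apply/h1|apply/h2].
  by rewrite -lcomp1E qg lzero1E.
by rewrite -lcomp2E qg lzero2E.
Qed.

Lemma confl_mono (W : ladder) (g g' : lhom W X) : i \oh g = i \oh g' -> g = g'.
Proof.
case: iq => [[i1 i2] _ _ _] e; apply: lhomE => w.
  by apply: i1; rewrite -!lcomp1E e.
by apply: i2; rewrite -!lcomp2E e.
Qed.

Lemma confl_epi (W : ladder) (g g' : lhom Z W) : g \oh q = g' \oh q -> g = g'.
Proof.
case: iq => [_ [q1 q2] _ _] e; apply: lhomE => w.
  by have [y <-] := q1 w; rewrite -!lcomp1E e.
by have [y <-] := q2 w; rewrite -!lcomp2E e.
Qed.

Lemma confl_factor (W : ladder) (g : lhom Y W) : g \oh i = 0 -> exists h, h \oh q = g.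
Proof.
case: iq => _ qs h1 h2 gi; apply: factor_coker => // y.
  by move/h1 => [x <-]; rewrite -lcomp1E gi lzero1E.
by move/h2 => [x <-]; rewrite -lcomp2E gi lzero2E.
Qed.

(** A map into an interval whose big module has full length p is a form on
    M, so it extends as soon as this form does; the projection to the degree
    of the socle makes the extended form homogeneous. *)
Lemma ivl_extend a g (h : (a <= p <= p)%N) (f : lhom X (ivl k g h)) (P' : 'Hom(lM Y,
  k^o)) :
  (forall m, P' (i.2 m) = entry (f.2 m) p.-1) ->
    a = p \/ (forall u, P' (lmap Y u) = 0) ->
  exists f' : lhom Y (ivl k g h), f' \oh i = f.
Proof.
move=> P'i P'U; have [P [Pd PE fP]] := ivl_in_form f.
pose P2 := (P' \o gproj (lM Y) (g + p%:Z - 1))%VF.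
have [n m ne mY|m|u|f' f'E] := @ivl_in k p a p g h Y P2.
- by rewrite lfunE /= (gproj_0 _ mY) ?linear0 // eq_sym.
- by rewrite gx_nil linear0.
- rewrite lfunE /=; case: P'U => [ap|P'U]; first by rewrite ap gx_nil !linear0.
  by rewrite -(gproj_hom _ _ (lmapP Y)) P'U.
exists f'; apply: lhomE2 => m; rewrite lcomp2E f'E fP; apply: entryP => j hj.
rewrite !entry_cyc_in hj -(hom_iter _ _ (lhom_gr2 i)) lfunE /=.
rewrite -(gproj_hom _ _ (lhom_gr2 i)) P'i -PE.
set v := iter _ _ m; elim/(@deg_ind k p (lM X)): v => [|v w|n v vM];
  rewrite ?linear0 //.
  by rewrite !linearD /= => -> ->.
case: (eqVneq n (g + p%:Z - 1)) vM => [->|ne] vM; first by rewrite gproj_id.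
by rewrite (Pd _ _ ne vM) (gproj_0 _ vM) ?linear0 // eq_sym.
Qed.

(** For the target [projU] any linear extension of the form from M_X to M_Y
    will do. For [projM] the form kills U_X, and the extension has to kill
    U_Y: this is possible because M_X and U_Y meet in U_X only, by
    injectivity of U_Z -> M_Z. *)
Lemma standard_injective Q : standard Q ->
  forall f : lhom X Q, exists f' : lhom Y Q, f' \oh i = f.
Proof.
case: (iq) => -[_ i2] _ h1 h2; elim=> {Q} [|g|g|Q R _ IHQ _ IHR] f.
- by exists 0; apply: lhomE => v; rewrite [LHS]rV0_eq0 [RHS]rV0_eq0.
- have [P [Pd PE fP]] := ivl_in_form f.
  have [v /(congr1 (fun v => (i.2^-1)%VF v))|P' P'E] := lfun_factor (h := i.2) (f := P).
    by rewrite lker0_lfunK ?linear0 => [->|]; [rewrite linear0 | apply/lker0P].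
  by apply: (@ivl_extend p g le_pp f P') => [m|]; [rewrite P'E PE | left].
- have [P [Pd PE fP]] := ivl_in_form f.
  have [v u e|P' [P'E P'U]] := lfun_extend (h := i.2) (g := lmap Y) (f := P).
    have qu : q.1 u = 0.
      apply: (@sobj_mono _ _ Z); rewrite linear0 -lhom_sq -e; apply/h2; by exists v.
    have [u' eu] := (h1 u).1 qu.
    have -> : v = lmap X u' by apply: i2; rewrite e -eu lhom_sq.
    by rewrite PE lhom_sq (_ : f.1 u' = 0) ?linear0 ?entry0 //; apply: entryP.
  by apply: (@ivl_extend 0 g le_0p f P') => [m|]; [rewrite P'E PE | right].
have [f1 e1] := IHQ (lfst Q R \oh f); have [f2 e2] := IHR (lsnd Q R \oh f).
have [h [hf hs]] := prod_map f1 f2; exists h.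
by apply: prod_ext; rewrite lcompA ?hf ?hs.
Qed.

Lemma proj_injective (Q : sobj) (f : lhom X Q) : projective Q ->
  exists f' : lhom Y Q, f' \oh i = f.
Proof.
move=> /proj_retract[R [r [s [sR rs]]]]; have [f' e] := standard_injective sR (s \oh f).
by exists (r \oh f'); rewrite -lcompA e lcompA rs lcomp1c.
Qed.

End Injective.

Lemma confl_surj (X Y Z : sobj) (i : lhom X Y) (q : lhom Y Z) : conflation i q ->
  surj_lhom q.
Proof. by case. Qed.

End Frobenius.

(** * Linear categories, and suspension of stable morphisms *)

Section LinCat.
Variables (k : fieldType) (C : lincat k).
Implicit Types X Y Z W : C.

Lemma ccompDl X Y Z (g g' : hom Y Z) (f : hom X Y) :
  ccomp (g + g') f = ccomp g f + ccomp g' f.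
Proof. by have := ccomp_linl f 1 g g'; rewrite !scale1r. Qed.
Lemma ccompDr X Y Z (g : hom Y Z) (f f' : hom X Y) :
  ccomp g (f + f') = ccomp g f + ccomp g f'.
Proof. by have := ccomp_linr g 1 f f'; rewrite !scale1r. Qed.
Lemma ccomp0l X Y Z (f : hom X Y) : ccomp (0 : hom Y Z) f = 0.
Proof. by apply: (addIr (ccomp 0 f)); rewrite -ccompDl !add0r. Qed.
Lemma ccomp0r X Y Z (g : hom Y Z) : ccomp g (0 : hom X Y) = 0.
Proof. by apply: (addIr (ccomp g 0)); rewrite -ccompDr !add0r. Qed.
Lemma ccompZl X Y Z a (g : hom Y Z) (f : hom X Y) : ccomp (a *: g) f = a *: ccomp g f.
Proof. by have := ccomp_linl f a g 0; rewrite !addr0 ccomp0l addr0. Qed.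
Lemma ccompZr X Y Z a (g : hom Y Z) (f : hom X Y) : ccomp g (a *: f) = a *: ccomp g f.
Proof. by have := ccomp_linr g a f 0; rewrite !addr0 ccomp0r addr0. Qed.

Lemma iso_refl X : isomorphic X X.
Proof. by exists (idc X), (idc X); rewrite ccomp1c. Qed.
Lemma iso_sym X Y : isomorphic X Y -> isomorphic Y X.
Proof. by case=> f [g [e1 e2]]; exists g, f. Qed.
Lemma iso_trans X Y Z : isomorphic X Y -> isomorphic Y Z -> isomorphic X Z.
Proof.
case=> f [g [e1 e2]] [f' [g' [e1' e2']]]; exists (ccomp f' f), (ccomp g g').
by rewrite -!ccompA [ccomp g' (ccomp _ _)]ccompA e1' ccomp1c e1
  [ccomp f (ccomp _ _)]ccompA e2 ccomp1c.
Qed.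

Definition nohom X Y := forall f : hom X Y, f = 0.

Lemma nohom_iso X X' Y Y' : isomorphic X X' -> isomorphic Y Y' -> nohom X Y ->
  nohom X' Y'.
Proof.
move=> [a [a' [aa1 aa2]]] [b [b' [bb1 bb2]]] h f.
have : ccomp b (ccomp (ccomp b' (ccomp f a)) a') = 0.
  by rewrite (h (ccomp b' (ccomp f a))) ccomp0l ccomp0r.
by rewrite -!ccompA aa2 ccompc1 ccompA bb2 ccomp1c.
Qed.

End LinCat.

Section Functors.
Variables (k : fieldType) (C D : lincat k) (F : functor C D).

Lemma functor_iso (X Y : C) : isomorphic X Y -> isomorphic (F X) (F Y).
Proof.
case=> f [g [e1 e2]]; exists (fhom F X Y f), (fhom F Y X g).
by rewrite -!fhomM e1 e2 !fhom1.
Qed.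

End Functors.

Section Stable.
Variables (k : fieldType) (p : nat).
Local Notation ladder := (ladder k p).
Local Notation sobj := (sobj k p).
Local Notation "g '\oh' f" := (lhom_comp g f) (at level 40, left associativity).
Implicit Types X Y Z W : sobj.

Lemma spiD X Y (f g : lhom X Y) : spi (f + g) = spi f + spi g.
Proof. by have := spi_linear 1 f g; rewrite !scale1r. Qed.
Lemma spi_0 X Y : spi (0 : lhom X Y) = 0.
Proof. by apply: (addIr (spi 0)); rewrite -spiD !add0r. Qed.
Lemma spiZ X Y a (f : lhom X Y) : spi (a *: f) = a *: spi f.
Proof. by have := spi_linear a f 0; rewrite !addr0 spi_0 addr0. Qed.
Lemma spi_eq0 X Y (f : lhom X Y) : spi f = 0 <-> stably_zero f.
Proof. by rewrite -(spi_0 X Y); split=> [/spiP|h]; rewrite ?subr0 //; apply/spiP;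
  rewrite subr0. Qed.
Lemma scompE X Y Z (g : lhom Y Z) (f : lhom X Y) :
  @ccomp k (stab k p) X Y Z (spi g) (spi f) = spi (g \oh f).
Proof. exact: scomp_spi. Qed.
Lemma spi_surj X Y (f : @hom k (stab k p) X Y) : exists f', f = spi f'.
Proof. by exists (srepr f); rewrite sreprK. Qed.

Lemma st0_factor X (Q : sobj) Y (a : lhom X Q) (b : lhom Q Y) : projective Q ->
  stably_zero (b \oh a).
Proof. by move=> pQ; exists Q; split=> //; exists a, b. Qed.

Definition sisom X Y := isomorphic (X : stab k p) Y.
Definition svanish X Y := nohom (X : stab k p) Y.

Lemma svanishP X Y : svanish X Y <-> forall f : lhom X Y, stably_zero f.
Proof.
split=> [h f|h f]; first by apply/spi_eq0; apply: h.
by have [f' ->] := spi_surj f; apply/spi_eq0.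
Qed.

Lemma liso_sisom X Y : liso X Y -> sisom X Y.
Proof.
by case=> f [g [e1 e2]]; exists (spi f), (spi g); rewrite !scompE e1 e2.
Qed.

Section Heller.
Variables (X I X' Y J Y' : sobj) (i : lhom X I) (q : lhom I X') (j : lhom Y J)
  (r : lhom J Y').
Hypotheses (iq : conflation i q) (jr : conflation j r) (pI : projective I)
  (pJ : projective J).

Lemma st0_ext (f : lhom X Y) : stably_zero f -> exists h, f = h \oh i.
Proof.
case=> Q [pQ [a [b ->]]]; have [a' <-] := proj_injective iq a pQ.
by exists (b \oh a'); rewrite lcompA.
Qed.

Lemma st0_lift (f : lhom X' Y') : stably_zero f -> exists h, f = r \oh h.
Proof.
case=> Q [pQ [a [b ->]]]; have [b' <-] := pQ _ _ r b (confl_surj jr).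
by exists (b' \oh a); rewrite lcompA.
Qed.

(** The effect of suspension on morphisms. As suspensions are only chosen on
    objects, it is a correspondence, single-valued up to stably zero maps. *)
Definition heller (f : lhom X Y) (f' : lhom X' Y') :=
  exists g : lhom I J, g \oh i = j \oh f /\ f' \oh q = r \oh g.

Lemma heller_fwd f : exists f', heller f f'.
Proof.
have [g eg] := proj_injective iq (j \oh f) pJ.
have [|f' e] := confl_factor iq (g := r \oh g); last by exists f', g.
by rewrite -lcompA eg lcompA (confl0 jr) lcomp0l.
Qed.

Lemma heller_bwd f' : exists f, heller f f'.
Proof.
have [g eg] := pI (f' \oh q) (confl_surj jr).
have [|f e] := confl_lift jr (g := g \oh i); last by exists f, g.
by rewrite lcompA eg -lcompA (confl0 iq) lcomp0r.
Qed.

(** If [f] extends to I, subtracting the extension from the map of the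
    middle terms leaves a map that vanishes on X, hence descends to X' and
    factors [f'] through J. The other direction is dual. *)
Lemma heller_st0 f f' : heller f f' -> stably_zero f <-> stably_zero f'.
Proof.
case=> g [e1 e2]; split.
  move=> /st0_ext[h eh].
  have [|t et] := confl_factor iq (g := g - j \oh h).
    by rewrite lcompBl e1 eh lcompA subrr.
  have -> : f' = r \oh t.
    apply: (confl_epi iq); rewrite -lcompA et lcompBr lcompA (confl0 jr) lcomp0l subr0.
    exact: e2.
  exact: st0_factor.
move=> /st0_lift[t et].
have [|h eh] := confl_lift jr (g := g - t \oh q).
  by rewrite lcompBr lcompA -et e2 subrr.
have -> : f = h \oh i.
  apply: (confl_mono jr); rewrite lcompA eh lcompBl -lcompA (confl0 iq) lcomp0r subr0.
  by rewrite e1.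
exact: st0_factor.
Qed.

Lemma hellerB f f' g g' : heller f f' -> heller g g' -> heller (f - g) (f' - g').
Proof.
by move=> [a [a1 a2]] [b [b1 b2]]; exists (a - b);
  rewrite !lcompBl !lcompBr a1 a2 b1 b2.
Qed.

End Heller.

Definition susp_of X X' := exists (I : sobj) (i : lhom X I) (q : lhom I X'),
  projective I /\ conflation i q.

Lemma susp_vanish X X' Y Y' : susp_of X X' -> susp_of Y Y' ->
  svanish X Y <-> svanish X' Y'.
Proof.
move=> [I [i [q [pI iq]]]] [J [j [r [pJ jr]]]]; rewrite !svanishP; split=> h f.
  by have [g] := heller_bwd iq jr pI f; move/(heller_st0 iq jr pI pJ) => <-.
by have [g] := heller_fwd iq jr pJ f; move/(heller_st0 iq jr pI pJ) => ->.
Qed.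

Lemma heller_comp (X I X' Y J Y' Z K Z' : sobj) (i : lhom X I) (q : lhom I X')
  (j : lhom Y J) (r : lhom J Y')
   (l : lhom Z K) (s : lhom K Z') f f' g g' :
  heller i q j r f f' -> heller j r l s g g' -> heller i q l s (g \oh f) (g' \oh f').
Proof.
move=> [a [a1 a2]] [b [b1 b2]]; exists (b \oh a).
by rewrite -!lcompA a1 a2 lcompA b1 !lcompA b2.
Qed.

Lemma heller_id (X I X' : sobj) (i : lhom X I) (q : lhom I X') :
  heller i q i q (lhom_id X) (lhom_id X').
Proof. by exists (lhom_id I); rewrite !lcomp1c !lcompc1. Qed.

Lemma sisomP X Y : sisom X Y <-> exists (f : lhom X Y) (g : lhom Y X),
  stably_zero (g \oh f - lhom_id X) /\ stably_zero (f \oh g - lhom_id Y).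
Proof.
split=> [[f [g]]|[f [g [e1 e2]]]]; last first.
  by exists (spi f), (spi g); rewrite !scompE; split; apply/spiP.
have [f' ->] := spi_surj f; have [g' ->] := spi_surj g.
by rewrite !scompE => -[e1 e2]; exists f', g'; split; apply/spiP.
Qed.

Lemma susp_isom X X' Y Y' : susp_of X X' -> susp_of Y Y' -> sisom X Y <-> sisom X' Y'.
Proof.
move=> [I [i [q [pI iq]]]] [J [j [r [pJ jr]]]]; rewrite !sisomP;
  split=> -[f [g [e1 e2]]].
  have [f' hf] := heller_fwd iq jr pJ f; have [g' hg] := heller_fwd jr iq pI g.
  exists f', g'; split.
    by apply/(heller_st0 iq iq pI pI (hellerB (heller_comp hf hg) (heller_id i q))).
  by apply/(heller_st0 jr jr pJ pJ (hellerB (heller_comp hg hf) (heller_id j r))).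
have [f' hf] := heller_bwd iq jr pI f; have [g' hg] := heller_bwd jr iq pJ g.
exists f', g'; split.
  by apply/(heller_st0 iq iq pI pI (hellerB (heller_comp hf hg) (heller_id i q))).
by apply/(heller_st0 jr jr pJ pJ (hellerB (heller_comp hg hf) (heller_id j r))).
Qed.

Lemma shift_susp (Sg : suspension k p) n (X : stab k p) :
  susp_of (shift Sg n X : sobj) (shift Sg (n + 1) X : sobj).
Proof.
case: n => [n|[|n]].
- by have := suspP Sg (shift Sg n X); rewrite -PoszD addn1.
- exact: desuspP Sg X.
have -> : Negz n.+1 + 1 = Negz n by lia.
exact: desuspP Sg (shift Sg (Negz n) X).
Qed.

Section Orthogonal.
Variables (Sg : suspension k p) (W : sobj).

Definition orth X := forall n, svanish X (shift Sg n W : sobj).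

Lemma orth_iso X Y : sisom X Y -> orth X -> orth Y.
Proof. by move=> xy h n; apply: nohom_iso (h n) => //; exact: iso_refl. Qed.

Lemma orth_susp X X' : susp_of X X' -> orth X <-> orth X'.
Proof.
move=> xx; split=> h n.
  by have [/(_ (h _)) + _] := susp_vanish xx (shift_susp Sg (n - 1) W); rewrite subrK.
by have [_ /(_ (h _))] := susp_vanish xx (shift_susp Sg n W).
Qed.

End Orthogonal.
End Stable.

(** * Uniqueness of the Serre functor, and stably zero maps out of intervals *)

Section SerreUnique.
Variables (k : fieldType) (C : lincat k) (Se : serre_functor C).

Definition brick (X : C) := forall e : hom X X, exists c, e = c *: idc X.

(** The pairing of f and g only depends on the composite of g with f, see
    [serre_pairE]; this form is its value on the composite. *)
Definition strace (X : C) (f : hom X (Se X)) : k := serre_pair Se (idc X) f.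

Lemma serre_pairE (X Y : C) (f : hom X Y) (g : hom Y (Se X)) :
  serre_pair Se f g = strace (ccomp g f).
Proof. by rewrite -{1}[f]ccompc1 serre_natr. Qed.

Lemma serre_nondeg (X Y : C) (f : hom X Y) :
  f != 0 -> exists g : hom Y (Se X), strace (ccomp g f) != 0.
Proof.
move=> f0; case: (pselect (exists g : hom Y (Se X), strace (ccomp g f) != 0)) => // no.
have z g : serre_pair Se f g = 0.
  by rewrite serre_pairE; apply/eqP; apply: contra_notT no => h; exists g.
have [f' [_ u]] := serre_bij (serre_pair Se f).
have e0 g : serre_pair Se (0 : hom X Y) g = 0.
  have := serre_linear (-1) (0 : hom X Y) 0 g.
  by rewrite scaler0 addr0 mulN1r addNr.
case/negP: f0; apply/eqP; transitivity f'; first by symmetry; apply: u.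
by apply: u => g; rewrite z e0.
Qed.

Lemma brick_serre X : brick X -> brick (Se X).
Proof.
move=> bX e; have [/(_ X X)[F' _ F'K] _] := serre_equiv Se.
have [c ec] := bX (F' e); exists c.
by rewrite -[e]F'K ec linearZ /= fhom1.
Qed.

(** The hypothesis says that Y represents the dual of Hom(X, -) with
    universal element [f0]. Applied to the trace form it gives g : S X -> Y,
    and nondegeneracy of the Serre pairing gives h : Y -> S X with trace 1
    on [f0]. Both composites are scalars, as the objects are bricks, and the
    scalars can only be 1. *)
Lemma serre_unique (X Y : C) (f0 : hom X Y) : f0 != 0 -> brick X -> brick Y ->
  (forall Z (phi : {scalar (hom X Z)}), exists g : hom Z Y, forall f,
    ccomp g f = phi f *: f0) ->
  isomorphic (Se X) Y.
Proof.
move=> f00 bX bY rep; have [g gE] := rep (Se X) (serre_pair Se (idc X)).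
have [h0 th0] := serre_nondeg f00.
(* normalised so that its trace against f0 is 1 *)
pose h := (strace (ccomp h0 f0))^-1 *: h0.
have gh : ccomp g h = idc Y.
  have [c ec] := bY (ccomp g h); rewrite ec; suff -> : c = 1 by rewrite scale1r.
  have : ccomp (ccomp g h) f0 = f0.
    rewrite -ccompA gE ccompZl linearZ /= -/(strace _).
    by rewrite mulVf // scale1r.
  rewrite ec ccompZl ccomp1c => /eqP;
    rewrite -subr_eq0 -{2}[f0]scale1r -scalerBl scaler_eq0.
  by rewrite (negbTE f00) orbF subr_eq0 => /eqP.
exists g, h; split=> //; have [c ec] := brick_serre bX (ccomp h g).
rewrite ec; suff -> : c = 1 by rewrite scale1r.
have : ccomp g (ccomp h g) = g by rewrite ccompA gh ccomp1c.
rewrite ec ccompZr ccompc1 => /eqP;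
  rewrite -subr_eq0 -{2}[g]scale1r -scalerBl scaler_eq0.
case/orP => [|/eqP g0]; first by rewrite subr_eq0 => /eqP.
case/negP: f00; rewrite -[f0]ccomp1c -gh g0 ccomp0l ccomp0l; exact/eqP.
Qed.

End SerreUnique.

Section IntervalStable.
Variables (k : fieldType) (p : nat).
Local Notation ladder := (ladder k p).
Local Notation sobj := (sobj k p).
Local Notation "g '\oh' f" := (lhom_comp g f) (at level 40, left associativity).

Lemma row_div n (y : 'rV[k]_p) : (n <= p)%N -> iter n (slide 1) y = 0 ->
  exists u, y = iter (p - n) (slide 1) u.
Proof.
move=> np h; exists (row_of p (fun i => entry y (i + (p - n))%N));
  apply: entryP => i hi.
rewrite iter_slide hi andbT entry_row_of; case: ifP => h1.
  by rewrite ifT ?subnK //; lia.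
move/(congr1 (fun v => entry v (i + n)%N)): h; rewrite iter_slide entry0 addnK.
by rewrite ifT //; lia.
Qed.

(** The elements y are the maps from (N_a in N_b) to Q. The conclusion is
    that such a map extends along the embedding of the interval into the sum
    of a [projU] and a [projM]. *)
Definition divisible (Q : ladder) a b := forall y : lM Q, iter b (gx _) y = 0 ->
  (exists u, iter (b - a) (gx _) y = lmap Q u) ->
  exists u m, y = lmap Q (iter (p - b) (gx _) u) + iter (p - b + a) (gx _) m.

Lemma standard_divisible (Q : sobj) a b : (a <= b <= p)%N -> standard Q ->
  divisible Q a b.
Proof.
move=> h; elim=> {Q} [|g|g|Q R _ IHQ _ IHR] y yb [u yu].
- by exists 0, 0; apply: etrans (rV0_eq0 y) _; symmetry; apply: rV0_eq0.
- have hb : (b <= p)%N by lia.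
  have [v ->] := row_div hb yb; exists v, 0;
    rewrite -[iter (p - b + a) _ 0]xpowE linear0 addr0 /=.
  by apply: entryP => i hi; rewrite entry_slide subnn subn0 hi.
- have hb : (b - a <= p)%N by lia.
  have [|v ev] := row_div hb (_ : iter (b - a) (slide 1) y = 0).
    by rewrite [LHS]yu (_ : u = 0) ?linear0 //; apply: entryP.
  exists 0, v; rewrite -[iter (p - b) _ 0]xpowE !linear0 add0r /= ev.
  by congr (iter _ _ _); lia.
have [lQ lR] : (forall i (w : lM (lsum Q R)),
  iter i (gx _) w = (iter i (gx (lM Q)) w.1, iter i (gx (lM R)) w.2))
  /\ (forall i (w : lU (lsum Q R)),
    iter i (gx _) w = (iter i (gx (lU Q)) w.1, iter i (gx (lU R)) w.2)).
  by split=> i w; elim: i => [|i IH]; rewrite ?iterS ?IH /= ?pair_lfunE //; case: w.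
move: yb yu; rewrite !lQ /= pair_lfunE => -[y1 y2] [u1 u2].
have [v1 [m1 e1]] := IHQ _ y1 (ex_intro _ _ u1).
have [v2 [m2 e2]] := IHR _ y2 (ex_intro _ _ u2).
exists (v1, v2), (m1, m2); rewrite lQ lR /= pair_lfunE /=.
by rewrite {1}[y]surjective_pairing {1}e1 {1}e2.
Qed.

Lemma proj_divisible (Q : sobj) a b : (a <= b <= p)%N -> projective Q ->
  divisible Q a b.
Proof.
move=> h /proj_retract[R [r [s [sR rs]]]] y yb [u yu].
have [|| v [m e]] := standard_divisible h sR (y := s.2 y).
- by rewrite -(hom_iter _ _ (lhom_gr2 s)) yb linear0.
- by exists (s.1 u); rewrite -(hom_iter _ _ (lhom_gr2 s)) yu lhom_sq.
exists (r.1 v), (r.2 m); rewrite -[y]lid2E -rs lcomp2E e linearD /= lhom_sq.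
by rewrite (hom_iter _ _ (lhom_gr1 r)) (hom_iter _ _ (lhom_gr2 r)).
Qed.

Section Crit.
Variables (a b : nat) (g : int) (h : (a <= b <= p)%N) (Z : sobj).
Let X : sobj := ivl k g h.

(** A stably zero map factors through a projective object, where all
    elements of this kind are divisible. *)
Lemma ivl_st0 (f : lhom X Z) : stably_zero f ->
  exists u m, f.2 gen = lmap Z (iter (p - b) (gx _) u) + iter (p - b + a) (gx _) m.
Proof.
case=> Q [pQ [al [be ->]]]; have [_ ab aa] := ivl_gen_mem al.
have [u [m e]] := proj_divisible h pQ ab (ex_intro _ _ aa).
exists (be.1 u), (be.2 m); rewrite lcomp2E e linearD /= lhom_sq.
by rewrite (hom_iter _ _ (lhom_gr1 be)) (hom_iter _ _ (lhom_gr2 be)).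
Qed.

Lemma iter_slide_ge n (v : 'rV[k]_p) : (p <= n)%N -> iter n (slide 1) v = 0.
Proof. by move=> pn; apply: entryP => i hi;
  rewrite iter_slide entry0 leqNgt (leq_trans hi pn). Qed.

(** The converse of [ivl_st0] for the second term, by factoring through
    [projM]. *)
Lemma ivl_st0M (f : lhom X Z) (m : lM Z) : f.2 gen = iter (p - b + a) (gx _) m ->
  m \in gdeg (lM Z) (g - (p - b + a)%N%:Z) -> stably_zero f.
Proof.
move=> fm mZ; have [be be2] := projM_out mZ.
have [|||al al2] := @ivl_out2 k p a b g h (projM k p (g - (p - b + a)%N%:Z))
    (iter (p - b + a) (slide 1) gen) 0.
- by have := iter_cycdeg (p - b + a) (gen_deg k p (g - (p - b + a)%N%:Z));
    rewrite subrK.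
- by rewrite /= -iterD iter_slide_ge //; lia.
- by rewrite linear0 /= -iterD iter_slide_ge //; lia.
rewrite (_ : f = be \oh al); first by apply: st0_factor; apply: standard_projective;
  exact: standardM.
apply: ivl_ext2; rewrite lcomp2E al2 fm -be2.
by rewrite -(hom_iter _ _ (lhom_gr2 be)).
Qed.

(** The converse of [ivl_st0] for the first term, by factoring through
    [projU]. *)
Lemma ivl_st0U (f : lhom X Z) (u : lU Z) : f.2 gen = lmap Z (iter (p - b) (gx _) u) ->
  u \in gdeg (lU Z) (g - (p - b)%N%:Z) -> stably_zero f.
Proof.
move=> fm uZ; have [be [be1 be2]] := projU_out uZ.
have [|||al al2] := @ivl_out2 k p a b g h (projU k p (g - (p - b)%N%:Z))
    (iter (p - b) (slide 1) gen) (iter (b - a) (slide 1) (iter (p - b) (slide 1) gen)).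
- by have := iter_cycdeg (p - b) (gen_deg k p (g - (p - b)%N%:Z)); rewrite subrK.
- by rewrite /= -iterD iter_slide_ge //; lia.
- by apply: entryP => i hi; rewrite entry_slide subnn subn0 hi.
rewrite (_ : f = be \oh al); first by apply: st0_factor; apply: standard_projective;
  exact: standardU.
apply: ivl_ext2; rewrite lcomp2E al2 fm (hom_iter _ _ (lmapP Z)) -be2.
by rewrite -(hom_iter _ _ (lhom_gr2 be)).
Qed.

End Crit.

End IntervalStable.

(** * Serre duality for intervals *)

Section SerreInterval.
Variables (k : fieldType) (p : nat).
Local Notation ladder := (ladder k p).
Local Notation sobj := (sobj k p).
Local Notation "g '\oh' f" := (lhom_comp g f) (at level 40, left associativity).

Lemma deg_gen b g (v : 'rV[k]_b) : v \in cycdeg k b g g -> v = entry v 0 *: gen.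
Proof.
move=> /cycdegP h; apply: entryP => i hi; rewrite entryZ entry_gen.
case: (i =P 0%N) => [->|ne]; first by rewrite (leq_ltn_trans _ hi) // mulr1.
by rewrite mulr0 h //; apply/eqP => e; apply: ne; lia.
Qed.

Lemma ivl_brick a b g (h : (a <= b <= p)%N) : brick (ivl k g h : stab k p).
Proof.
move=> e; have [f ->] := spi_surj e; have [fm _ _] := ivl_gen_mem f.
exists (entry (f.2 gen) 0); rewrite -[idc _]/(spi (lhom_id _)) -spiZ; congr spi.
by apply: ivl_ext2; rewrite lscale2E lid2E; apply: deg_gen fm.
Qed.

(** Both terms of [ivl_st0] vanish when the target is this short. *)
Lemma ivl_stable_neq0 a b g (h : (a <= b <= p)%N) c d g' (h' : (c <= d <= p)%N)
    (f : lhom (ivl k g h) (ivl k g' h')) :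
  (c <= p - b)%N -> (d <= p - b + a)%N -> f.2 gen != 0 -> spi f != 0.
Proof.
move=> hc hd; apply: contra => /eqP/spi_eq0/ivl_st0[u [m ->]].
have z n l (v : 'rV[k]_n) : (n <= l)%N -> iter l (slide 1) v = 0.
  by move=> nl; apply: entryP => i hi;
    rewrite iter_slide entry0 leqNgt (leq_trans hi nl).
by rewrite /= !z // linear0 addr0.
Qed.

(** The dual of Hom(X, -) for X = (N_a in N_b) is represented by (N_c in
    N_d), with c = p - b and d = p - b + a. Maps from X to Z form a subspace
    K of M_Z. By the description of stably zero maps, a linear form on
    stable maps is a form on K that vanishes on x^d M and on x^c U; any
    homogeneous extension of it to M_Z is then a map from Z to (N_c in N_d). *)
Lemma ivl_rep a b g (h : (a <= b <= p)%N) g' (h' : (p - b <= p - b + a <= p)%N)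
    (f0 : lhom (ivl k g h) (ivl k g' h')) :
  g = g' + (p - b + a)%N%:Z - 1 -> f0.2 gen = iter (p - b + a).-1 (slide 1) gen ->
  forall (Z : sobj) (phi : {scalar (@hom k (stab k p) (ivl k g h) Z)}),
  exists G : lhom Z (ivl k g' h'), forall f, spi (G \oh f) = phi (spi f) *: spi f0.
Proof.
set c := (p - b)%N; set d := (c + a)%N => gE f0E Z phi.
(* the values on the generator of the maps from the interval to Z *)
pose K := (gdeg (lM Z) g :&:
  (lker (xpow _ b) :&: (xpow _ (b - a) @^-1: limg (lmap Z))))%VS.
have KP m : reflect [/\ m \in gdeg (lM Z) g, iter b (gx _) m = 0 &
    exists u, lmap Z u = iter (b - a) (gx _) m] (m \in K).
  rewrite !memv_cap memv_ker -memv_preim !xpowE.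
  apply: (iffP and3P) => [[m1 /eqP m2 /memv_imgP[u _ ->]]|[m1 m2 [u <-]]];
    first by split=> //; exists u.
  by split; rewrite ?m2 // memv_img ?memvf.
have ex m : exists f : lhom (ivl k g h) Z, m \in K -> f.2 gen = m.
  case: (boolP (m \in K)) => [/KP[m1 m2 [u mu]]|_]; last by exists 0.
  by have [f fE] := ivl_out2 h m1 m2 mu; exists f.
have [F FE] := choice ex.
pose pr m := projv K (gproj _ g m).
have prK m : pr m \in K by exact: memv_proj.
have Plin : linear (fun m => phi (spi (F (pr m))) : k^o).
  move=> x v w; rewrite -[RHS]linearP -spi_linear; congr (phi (spi _)).
  apply: ivl_ext2; rewrite FE // ladd2E lscale2E !FE // /pr linearP /=.
  by rewrite linearP.
pose P := mk_lfun Plin.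
have PK m (f : lhom (ivl k g h) Z) : m \in K -> f.2 gen = m -> P m = phi (spi f).
  move=> mK fm; rewrite mk_lfunE; congr (phi (spi _)); apply: ivl_ext2.
  by rewrite FE // /pr gproj_id ?projv_id ?fm //; case/KP: mK.
have Pdeg : form_deg P g.
  move=> n m ne mn; rewrite mk_lfunE (_ : F _ = 0) ?spi_0 ?linear0 //.
  by apply: ivl_ext2; rewrite FE // /pr (gproj_0 _ mn) 1?eq_sym // linear0 lzero2E.
have PM m : P (iter d (gx _) m) = 0.
  rewrite -xpowE; move: m; apply: deg_ind => [|v w hv hw|n m mn].
  - by rewrite !linear0.
  - by rewrite !lfun_addE hv hw addr0.
  rewrite xpowE; case: (eqVneq (n + d%:Z) g) => [e|ne]; last by apply: (Pdeg _ _ ne);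
    apply: deg_iter.
  have xK : iter d (gx _) m \in K.
    apply/KP; split; first by rewrite -e deg_iter.
      by rewrite -iterD iter_ge //; rewrite /d /c; lia.
    by exists 0; rewrite linear0 -iterD iter_ge //; rewrite /d /c; lia.
  rewrite (PK _ _ xK (FE _ xK)) (_ : spi _ = 0) ?linear0 //; apply/spi_eq0.
  by apply: (ivl_st0M (FE _ xK)); rewrite -/c -/d -e addrK.
have PU u : P (lmap Z (iter c (gx _) u)) = 0.
  rewrite -xpowE; move: u; apply: deg_ind => [|v w hv hw|n u un].
  - by rewrite !linear0.
  - by rewrite !lfun_addE hv hw addr0.
  rewrite xpowE; case: (eqVneq (n + c%:Z) g) => [e|ne]; last first.
    by apply: (Pdeg _ _ ne); apply: (hom_deg (lmapP Z)); apply: deg_iter.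
  have xK : lmap Z (iter c (gx _) u) \in K.
    apply/KP; rewrite -!(hom_iter _ _ (lmapP Z)) -!iterD; split;
      first by rewrite -e (hom_deg (lmapP Z)) ?deg_iter.
      by rewrite iter_ge ?linear0 //; rewrite /c; lia.
    by exists (iter (b - a + c) (gx _) u).
  rewrite (PK _ _ xK (FE _ xK)) (_ : spi _ = 0) ?linear0 //; apply/spi_eq0.
  by apply: (ivl_st0U (FE _ xK)); rewrite -/c -e addrK.
have [|G GE] := @ivl_in k p c d g' h' Z P _ PM PU; first by rewrite -gE.
exists G => f; rewrite -spiZ; congr spi; apply: ivl_ext2.
have [f1 f2 f3] := ivl_gen_mem f.
have fK : f.2 gen \in K by apply/KP; split=> //; exists (f.1 gen).
rewrite lcomp2E lscale2E f0E GE; apply: entryP => i hi;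
  rewrite entryZ entry_cyc_in hi entry_iter_gen hi andbT.
case: eqP => [<-|ne]; first by rewrite subnn /= (PK _ f) // mulr1.
rewrite mulr0; apply: (Pdeg (g + (d.-1 - i)%N%:Z)); last exact: deg_iter.
by apply/eqP => e; apply: ne; lia.
Qed.

(** The universal map [f0] sends the generator of the interval to the socle
    of its image under S. The numerical conditions exclude the zero and the
    projective intervals. *)
Lemma serre_ivl (Se : serre_functor (stab k p)) a b g (h : (a <= b <= p)%N) c d g'
  (h' : (c <= d <= p)%N) :
  c = (p - b)%N -> d = (p - b + a)%N -> g = g' + d%:Z - 1 ->
  (0 < b)%N -> (0 < d)%N -> (a < b)%N || (b < p)%N ->
  sisom (Se (ivl k g h) : sobj) (ivl k g' h').
Proof.
move=> cE dE; subst c d; move=> gE b0 d0 ab.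
set d := (p - b + a)%N in h' gE d0 *.
have [|||f0 f0E] := @ivl_out2 k p a b g h (ivl k g' h') (iter d.-1 (slide 1) gen)
   (if (a < b)%N then 0 else iter (p - b).-1 (slide 1) gen).
- have -> : g = g' + d.-1%:Z by lia.
  by apply: iter_gen; lia.
- apply: entryP => i hi; rewrite -iterD iter_slide entry0; case: ifP => //; lia.
- case: ifP ab => [lt _|ge /= bp].
    rewrite linear0; apply: entryP => i hi; rewrite entry0 /= -iterD iter_slide;
      case: ifP => //; lia.
  have ab : a = b by lia.
  rewrite /= ab subnn /=; apply: entryP => i hi; rewrite entry_slide !entry_iter_gen;
    case: ifP => h1.
    by congr (nat_of_bool _)%:R; lia.
  by case: eqP => //= e; exfalso; lia.
apply: (@serre_unique k (stab k p) Se (ivl k g h) (ivl k g' h') (spi f0)).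
- apply: ivl_stable_neq0 => //; rewrite f0E;
    apply/eqP => /(congr1 (fun v => entry v d.-1)).
  by rewrite entry_iter_gen eqxx entry0 ltn_predL d0 /= => /eqP; rewrite oner_eq0.
- exact: ivl_brick.
- exact: ivl_brick.
move=> Z phi; have [G GE] := ivl_rep gE f0E phi.
exists (spi G) => f; have [f' ->] := spi_surj f.
by rewrite -GE; apply: scomp_spi.
Qed.

End SerreInterval.

(** * Short exact sequences of intervals *)

Section IntervalSequences.
Variables (k : fieldType) (p : nat).
Local Notation ladder := (ladder k p).
Local Notation sobj := (sobj k p).
Local Notation "g '\oh' f" := (lhom_comp g f) (at level 40, left associativity).

Lemma lhom_of X Y (f1 : 'Hom(lU X, lU Y)) (f2 : 'Hom(lM X, lM Y)) : grhom f1 ->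
  grhom f2 ->
  (forall u, f2 (lmap X u) = lmap Y (f1 u)) ->
  exists f : @lhom k p X Y, f.1 = f1 /\ f.2 = f2.
Proof. by move=> g1 g2 s; have hP : is_lhom (f1, f2); [split | exists (mkHom hP)]. Qed.

Lemma cycmod_hom0 b g (hb : (b <= p)%N) g' (h0 : (0 <= p)%N) (f : 'Hom('rV[k]_b,
  'rV[k]_0)) :
  @grhom k p (cycmod k g hb) (cycmod k g' h0) f.
Proof.
apply: grhomP => [n v _|v]; last by apply: entryP.
by rewrite (_ : f v = 0) ?mem0v //; apply: entryP.
Qed.

Lemma slide_inj b1 b2 n : b2 = (b1 + n)%N ->
  injective (slide n : 'Hom('rV[k]_b1, 'rV[k]_b2)).
Proof.
move=> e v w /(congr1 (fun v (i : nat) => entry v (i + n)%N)) h; apply: entryP => i hi.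
have /(congr1 (fun F => F i)) := h; rewrite !entry_slide addnK.
by have -> : (n <= i + n < b2)%N by lia.
Qed.

Lemma slide_surj b1 b2 : (b2 <= b1)%N ->
  forall w, exists v, (slide 0 : 'Hom('rV[k]_b1, 'rV[k]_b2)) v = w.
Proof.
move=> le w; exists (row_of b1 (entry w)); apply: entryP => i hi;
  rewrite entry_slide subn0 hi entry_row_of.
by rewrite (leq_trans hi le).
Qed.

Lemma slide_exact b1 b2 b (y : 'rV[k]_b) : b = (b1 + b2)%N ->
  (slide 0 : 'Hom('rV[k]_b, 'rV[k]_b2)) y = 0 <-> exists x,
    (slide b2 : 'Hom('rV[k]_b1, 'rV[k]_b)) x = y.
Proof.
move=> bE; split=> [h|[x <-]]; last first.
  by apply: entryP => i hi; rewrite !entry_slide entry0 subn0 hi /= ifF //; lia.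
exists (row_of b1 (fun i => entry y (i + b2)%N)); apply: entryP => i hi;
  rewrite entry_slide hi andbT entry_row_of.
case: ifP => h1; first by rewrite ifT ?subnK //; lia.
have {}h1 : (i < b2)%N by lia.
by move/(congr1 (fun v => entry v i)): h; rewrite entry_slide subn0 h1 entry0.
Qed.

(** Sliding embeds the first interval, truncation gives the quotient. The
    last condition is what makes truncation compatible with the inclusions
    of the submodules. *)
Lemma confl_ivl a1 b1 a2 b2 a b (g g1 : int) (h1 : (a1 <= b1 <= p)%N)
  (h : (a <= b <= p)%N)
    (h2 : (a2 <= b2 <= p)%N) :
  a = (a1 + a2)%N -> b = (b1 + b2)%N -> g1 = g + b2%:Z -> (a1 == b1) || (a2 == 0%N) ->
  exists (i : lhom (ivl k g1 h1) (ivl k g h)) (q : lhom (ivl k g h) (ivl k g h2)),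
    conflation i q.
Proof.
move=> aE bE gE cond.
have [|||i [i1 i2]] := @lhom_of (ivl k g1 h1) (ivl k g h) (slide a2) (slide b2).
- by apply: slide_hom; lia.
- by apply: slide_hom; lia.
- move=> u; apply: entryP => j hj; rewrite !entry_slide hj !andbT.
  case: (leqP (b2 + (b1 - a1)) j) => h3.
    have [-> ->] : (b2 <= j)%N /\ (b1 - a1 <= j - b2 < b1)%N by lia.
    have [-> ->] : (b - a <= j)%N /\ (a2 <= j - (b - a) < a)%N by lia.
    by congr entry; lia.
  rewrite !(fun_if (fun x : k => x)); do !case: ifP => //; lia.
have [|||q [q1 q2]] := @lhom_of (ivl k g h) (ivl k g h2) (slide 0) (slide 0).
- have [ab|a20] : (b1 = a1) \/ (a2 = 0%N) by lia.
    by apply: slide_hom; lia.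
  by subst a2; apply: cycmod_hom0.
- by apply: slide_hom; lia.
- move=> u; apply: entryP => j hj; rewrite !entry_slide subn0 hj /= subn0.
  have -> : (j < b)%N by lia. rewrite andbT.
  have [ab|a20] : (b1 = a1) \/ (a2 = 0%N) by lia.
    have -> : (b - a = b2 - a2)%N by lia.
    by case: ifP => // h3; rewrite ifT //; lia.
  subst a2; rewrite ifF; last lia.
  by case: ifP => // h3.
exists i, q; split.
- by rewrite /inj_lhom i1 i2; split; apply: slide_inj; lia.
- by rewrite /surj_lhom q1 q2; split; apply: slide_surj; lia.
- by move=> y; rewrite i1 q1; apply: slide_exact.
by move=> y; rewrite i2 q2; apply: slide_exact.
Qed.

Lemma projM_proj g : projective (projM k p g).
Proof. by apply: standard_projective; exact: standardM. Qed.
Lemma projU_proj g : projective (projU k p g).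
Proof. by apply: standard_projective; exact: standardU. Qed.

Lemma suspA a (g g1 : int) (h1 : (0 <= a <= p)%N) (h2 : (0 <= p - a <= p)%N) :
  g1 = g + (p - a)%N%:Z -> susp_of (ivl k g1 h1) (ivl k g h2).
Proof.
move=> gE; have [||||i [q iq]] := @confl_ivl 0 a 0 (p - a) 0 p g g1 h1 (le_0p p) h2;
  rewrite ?eqxx ?orbT //; try lia.
by exists (projM k p g), i, q; split=> //; exact: projM_proj.
Qed.

Lemma suspB a (g g1 : int) (h1 : (a <= a <= p)%N) (h2 : (p - a <= p - a <= p)%N) :
  g1 = g + (p - a)%N%:Z -> susp_of (ivl k g1 h1) (ivl k g h2).
Proof.
move=> gE; have [||||i [q iq]] :=
  @confl_ivl a a (p - a) (p - a) p p g g1 h1 (le_pp p) h2; rewrite ?eqxx //; try lia.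
by exists (projU k p g), i, q; split=> //; exact: projU_proj.
Qed.

(** The injective object has two summands here: the generator of N_p goes to
    the generator of [projU] plus x^a times that of [projM]. The second
    generator spans the quotient, which is therefore an interval again, with
    submodule N_p / N_a. *)
Lemma suspC a (g g1 : int) (h1 : (a <= p <= p)%N) (h2 : (p - a <= p <= p)%N) :
  g1 = g + a%:Z -> susp_of (ivl k g1 h1) (ivl k g h2).
Proof.
move=> gE; pose P := projU k p g1; pose Q := projM k p g.
pose X := ivl k g1 h1; pose Y := ivl k g h2.
have [|||i' [i1 i2]] := @lhom_of X P (slide (p - a)) (slide 0).
- by apply: slide_hom; lia.
- by apply: slide_hom; lia.
- by move=> u; apply: entryP => j hj;
    rewrite !entry_slide !subn0 !subnn hj /= !subn0 hj.
have [|||i'' [j1 j2]] := @lhom_of X Q 0 (slide a).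
- exact: cycmod_hom0.
- by apply: slide_hom; lia.
- move=> u; rewrite zero_lfunE linear0; apply: entryP => j hj;
    rewrite !entry_slide entry0 hj !andbT.
  by do !case: ifP => //; lia.
have [|||q' [q1 q2]] := @lhom_of P Y (- slide 0) (- slide a).
- suff : @grhom k p (cycmod k (g1 + (p - p)%N%:Z) (ivl_a (le_pp p)))
    (cycmod k (g + (p - (p - a))%N%:Z) (ivl_a h2)) (slide 0).
    move=> gs; have := grhom_linear (-1) gs (grhom0 _ _); rewrite scaleN1r addr0; exact.
  by apply: slide_hom; lia.
- suff : @grhom k p (cycmod k g1 (ivl_b (le_pp p))) (cycmod k g (ivl_b h2)) (slide a).
    move=> gs; have := grhom_linear (-1) gs (grhom0 _ _); rewrite scaleN1r addr0; exact.
  by apply: slide_hom; lia.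
- move=> u; rewrite !opp_lfunE linearN; congr (- _).
  apply: entryP => j hj; rewrite !entry_slide !subn0 subnn hj !andbT subn0 /=.
  have -> : (p - (p - a) = a)%N by lia.
  case: ifP => // h3; have -> : (j - a < p)%N by lia.
  by rewrite ifT //; lia.
have [|||q'' [r1 r2]] := @lhom_of Q Y 0 (slide 0).
- exact: grhom0.
- by apply: slide_hom; lia.
- by move=> u; rewrite (_ : u = 0) ?linear0 //; apply: entryP.
have [i [ei1 ei2]] := prod_map i' i''.
have [q [eq1 eq2]] := pair_map q' q''.
have iE1 x : i.1 x = (i'.1 x, 0).
  rewrite [LHS]surjective_pairing; congr (_, _).
    by rewrite -ei1 lcomp1E /= lin_fstE.
  by apply: entryP.
have iE2 x : i.2 x = (i'.2 x, i''.2 x).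
  by rewrite [LHS]surjective_pairing -ei1 -ei2 !lcomp2E /= lin_fstE lin_sndE.
have yE (V W : vectType k) (y : (V * W)%type) : y = lin_inl V W y.1 + lin_inr V W y.2.
  by rewrite lin_inlE lin_inrE; case: y => y1 y2; congr (_, _);
    rewrite /= ?addr0 ?add0r.
have qE1 y : q.1 y = q'.1 y.1.
  rewrite {1}[y]yE linearD /= -[X in _ + X](lcomp1E q (linr P Q))
    -[X in X + _](lcomp1E q (linl P Q)).
  by rewrite eq1 eq2 [q''.1 _](_ : _ = 0) ?addr0 // r1 zero_lfunE.
have qE2 y : q.2 y = q'.2 y.1 + q''.2 y.2.
  rewrite {1}[y]yE linearD /= -[X in _ + X](lcomp2E q (linr P Q))
    -[X in X + _](lcomp2E q (linl P Q)).
  by rewrite eq1 eq2.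
exists (ssum P Q), i, q; split.
  by apply: projective_sum; [exact: projU_proj | exact: projM_proj].
have ap : (a <= p)%N by lia.
have qy y : q.2 y = slide 0 y.2 - slide a y.1.
  by rewrite qE2 q2 r2 opp_lfunE addrC.
split.
- split=> x x'; first by rewrite !iE1 => -[]; rewrite i1; apply: slide_inj; lia.
  by rewrite !iE2 => -[]; rewrite i2 => e _; apply: slide_inj e; lia.
- split=> w.
    have [v e] := slide_surj (b1 := p) (b2 := p - a) (leq_subr _ _) w.
    by exists (- v, 0); rewrite qE1 /= q1 opp_lfunE linearN opprK.
  have [v e] := slide_surj (b1 := p) (b2 := p) (leqnn _) w.
  by exists (0, v); rewrite qy /= linear0 subr0.
- move=> y; rewrite qE1 q1 opp_lfunE; split=> [/eqP|[x <-]].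
    rewrite oppr_eq0 => /eqP; rewrite (slide_exact (b1 := a)); last lia.
    by case=> x e; exists x; rewrite iE1 i1 e; case: y e => y1 y2 /= _; congr (_, _);
      apply: entryP.
  by rewrite iE1 i1 /=; apply/eqP; rewrite oppr_eq0; apply/eqP/(slide_exact (b1 := a));
    [lia | exists x].
move=> y; rewrite qy; split=> [e|[x <-]]; last first.
  rewrite iE2 i2 j2 /=; apply/eqP; rewrite subr_eq0; apply/eqP/entryP => j hj.
  by rewrite !entry_slide hj /= !subn0 hj andbT; case: ifP => // h3; rewrite ifT //;
    lia.
exists y.1; rewrite iE2 i2 j2; case: y e => y1 y2 /= e; congr (_, _).
  by apply: entryP => j hj; rewrite entry_slide subn0 hj.
apply: entryP => j hj; move/(congr1 (fun v => entry v j)): e;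
  rewrite entry0 entryD entryN !entry_slide subn0 hj /=.
by move/eqP; rewrite subr_eq0 => /eqP ->.
Qed.

End IntervalSequences.

(** * The orbit of the simple object under rotation and degree shift *)

Section Lines.
Variables (k : fieldType) (C : lincat k).
Implicit Types X Y : C.

Definition line X Y := exists f0 : hom X Y, f0 != 0 /\ forall f, exists c, f = c *: f0.

Lemma line_iso X X' Y Y' : isomorphic X X' -> isomorphic Y Y' -> line X Y -> line X' Y'.
Proof.
move=> [a [a' [aa1 aa2]]] [b [b' [bb1 bb2]]] [f0 [f00 h]].
have K f : ccomp b' (ccomp (ccomp b (ccomp f a')) a) = f.
  by rewrite -!ccompA aa1 ccompc1 ccompA bb1 ccomp1c.
exists (ccomp b (ccomp f0 a')); split=> [|f].
  by apply: contra f00 => /eqP e; rewrite -[f0]K e ccomp0l ccomp0r.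
have [c e] := h (ccomp b' (ccomp f a)); exists c.
by rewrite -ccompZr -ccompZl -e -!ccompA aa2 ccompc1 ccompA bb2 ccomp1c.
Qed.

Lemma nohom_serre (Se : serre_functor C) X Y : nohom X Y <-> nohom (Se X) (Se Y).
Proof.
have [/(_ X Y)[F' FK F'K] _] := serre_equiv Se; split=> h f.
  by rewrite -[f]F'K (h (F' f)) linear0.
by rewrite -[f]FK (h (fhom Se X Y f)) -(linear0 (fhom Se X Y)) FK.
Qed.

(** The pairing between Hom(Y, S X) and Hom(X, Y) is also nondegenerate in
    its first argument, since S is fully faithful; so Hom(Y, S X) is a line
    when Hom(X, Y) is one. *)
Lemma line_serre (Se : serre_functor C) X Y : line X Y -> line Y (Se X).
Proof.
case=> f0 [f00 h]; have [g0 tg0] := serre_nondeg Se f00; exists g0; split.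
  apply: contra tg0 => /eqP ->; rewrite ccomp0l; apply/eqP.
  by rewrite /strace linear0.
move=> g; exists (strace (ccomp g f0) / strace (ccomp g0 f0)).
set c := _ / _; apply/eqP; rewrite -subr_eq0; case: (eqVneq (g - c *: g0) 0) => // ne.
have tr0 f : strace (ccomp (g - c *: g0) f) = 0.
  have [d ->] := h f;
    rewrite ccompZr ccompDl -scaleNr ccompZl /strace linearZ /= linearD linearZ /=.
  by rewrite -!/(strace _) mulNr /c divfK // subrr mulr0.
have [l tl] := serre_nondeg Se ne; case/negP: tl.
have [/(_ X Y)[F' FK F'K] _] := serre_equiv Se.
rewrite -[l]F'K /strace -(serre_natl (F' l) (idc Y)) ccomp1c serre_pairE tr0.
exact: eqxx.
Qed.

(** By Serre duality, composition Hom(Y, S X) x Hom(X, Y) -> Hom(X, S X)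
    followed by the trace is nondegenerate, and all maps Y -> S X are
    multiples of one. *)
Lemma line_comp (Se : serre_functor C) X Y Z (f : hom X Y) (g : hom Y Z) :
  isomorphic Z (Se X) -> line Y Z -> f != 0 -> g != 0 -> ccomp g f != 0.
Proof.
move=> [u [v [vu uv]]] [g0 [g00 h]] f0 gn0; have [g1 tg1] := serre_nondeg Se f0.
apply: contra tg1 => /eqP gf; apply/eqP.
have [c gE] := h g; have [d g1E] := h (ccomp v g1).
have c0 : c != 0 by apply: contra gn0 => /eqP c0; rewrite gE c0 scale0r.
have g0f : ccomp g0 f = 0.
  by move: gf; rewrite gE ccompZl => /eqP; rewrite scaler_eq0 (negbTE c0) => /eqP.
have -> : ccomp g1 f = 0.
  by rewrite -[g1]ccomp1c -uv -!ccompA [ccomp v _]ccompA g1E ccompZl g0f scaler0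
    ccomp0r.
by rewrite /strace linear0.
Qed.

Lemma brick_iso (X Y : C) : isomorphic X Y -> brick Y -> brick X.
Proof.
move=> [f [g [gf fg]]] bY e; have [c cE] := bY (ccomp f (ccomp e g)); exists c.
have : ccomp (ccomp g (ccomp f (ccomp e g))) f = e.
  by rewrite -!ccompA gf ccompc1 ccompA gf ccomp1c.
by rewrite cE ccompZr ccompc1 ccompZl gf.
Qed.

End Lines.

Lemma int_decomp6 (r : int) : exists q (e : bool) K, (K < 3)%N /\
  r = 6 * q + 3 * e%:Z + K%:Z.
Proof.
exists (r %/ 6)%Z, (2 < absz (r %% 6)%Z)%N, (absz (r %% 6)%Z %% 3)%N.
split; first by rewrite ltn_mod.
by case: (ltnP 2) => /=; lia.
Qed.

Section Orbit.
Variables (k : fieldType) (p : nat) (hp : (1 < p)%N).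
Local Notation ladder := (ladder k p).
Local Notation sobj := (sobj k p).
Local Notation "g '\oh' f" := (lhom_comp g f) (at level 40, left associativity).

Definition kind_len (e : bool) : nat := if e then p.-1 else 1%N.
Lemma kind_len_gt0 e : (0 < kind_len e < p)%N. Proof. by case: e => /=; lia. Qed.
Lemma kind_lenC e : kind_len (~~ e) = (p - kind_len e)%N.
Proof. by case: e => /=; lia. Qed.
Lemma kindA_le e : (0 <= kind_len e <= p)%N. Proof. by have := kind_len_gt0 e; lia. Qed.
Lemma kindB_le e : (kind_len e <= kind_len e <= p)%N. Proof.
  by have := kind_len_gt0 e; lia. Qed.
Lemma kindC_le e : (kind_len e <= p <= p)%N. Proof. by have := kind_len_gt0 e; lia. Qed.

(** The intervals (0 in N_a), (N_a in N_a) and (N_a in N_p), with a = 1 or a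
    = p - 1; [d] is the degree of the socle of the big module. *)
Definition kobj (K : nat) (e : bool) (d : int) : sobj :=
  match K with
  | 0 => ivl k (d - (kind_len e)%:Z + 1) (kindA_le e)
  | 1 => ivl k (d - (kind_len e)%:Z + 1) (kindB_le e)
  | _ => ivl k (d - p%:Z + 1) (kindC_le e)
  end.

Lemma kobj_susp K e d : susp_of (kobj K e d) (kobj K (~~ e) (d - (kind_len e)%:Z)).
Proof.
have ll := kind_len_gt0 e; have lC := kind_lenC e; move: K => [|[|K]] /=.
- move: (kindA_le e) (kindA_le (~~ e)); rewrite {}lC => h1 h2; apply: suspA; lia.
- move: (kindB_le e) (kindB_le (~~ e)); rewrite {}lC => h1 h2; apply: suspB; lia.
- move: (kindC_le e) (kindC_le (~~ e)); rewrite {}lC => h1 h2; apply: suspC; lia.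
Qed.

Lemma kobj_serre (Se : serre_functor (stab k p)) K e d : (K < 3)%N ->
  sisom (Se (kobj K e d) : sobj)
    (if K is 2 then kobj 0 e (d - p%:Z + 1) else kobj K.+1 (~~ e)
      (d - (kind_len e)%:Z + 1)).
Proof.
have ll := kind_len_gt0 e; have lC := kind_lenC e; move: K => [|[|[|//]]] _ /=;
  apply: serre_ivl; rewrite ?lC; lia.
Qed.

Lemma kobj_brick K e d : brick (kobj K e d : stab k p).
Proof. by move: K => [|[|K]] /=; apply: ivl_brick. Qed.

(** R^r s^(-t) applied to the simple object (0 in k) of degree h, where R is
    the rotation (U -> M) to (M -> M/U). Here R^3 = [1] and [2] = s^p, so
    that the residue of r modulo 6 determines the kind and the length, and
    the quotient of r by 6 only moves the degree. *)
Definition robj (h r t : int) : sobj :=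
  let rho := absz (r %% 6)%Z in
  kobj (rho %% 3) (2 < rho)%N (h + t - p%:Z * (r %/ 6)%Z - (2 < rho)%N%:Z).

Lemma robjE h q (e : bool) K t r : (K < 3)%N -> r = 6 * q + 3 * e%:Z + K%:Z ->
  robj h r t = kobj K e (h + t - p%:Z * q - e%:Z).
Proof.
move=> K3 rE; have [e1 e2] : (r %% 6)%Z = (3 * e + K)%N :> int /\ (r %/ 6)%Z = q by lia.
rewrite /robj e1 e2 absz_nat; have -> : (2 < 3 * e + K)%N = e by case: (e); lia.
by congr kobj; case: (e); lia.
Qed.

Lemma robj_susp h r t : susp_of (robj h r t) (robj h (r + 3) t).
Proof.
have [q [e [K [K3 rE]]]] := int_decomp6 r; rewrite (robjE h t K3 rE).
have [q' qE] : exists q', q' = q + e%:Z by eexists.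
rewrite (@robjE h q' (~~ e) K t) //; last by rewrite qE; case: (e) rE => /= rE; lia.
have := kobj_susp K e (h + t - p%:Z * q - e%:Z); congr (susp_of _ (kobj _ _ _)).
by rewrite qE mulrDr; case: (e) => /=; lia.
Qed.

(** This is S = R^4 s^(-1), that is S = tau [1] with tau = R s^(-1). *)
Lemma robj_serre (Se : serre_functor (stab k p)) h r t :
  sisom (Se (robj h r t) : sobj) (robj h (r + 4) (t + 1)).
Proof.
have [q [e [K [K3 rE]]]] := int_decomp6 r; rewrite (robjE h t K3 rE).
have := kobj_serre Se e (h + t - p%:Z * q - e%:Z) K3; move: K K3 rE => [|[|[|//]]] _ rE.
- rewrite (@robjE h (q + e%:Z) (~~ e) 1) //; last by case: (e) rE => /= rE; lia.
  by congr (sisom _ (kobj _ _ _)); rewrite mulrDr; case: (e) => /=; lia.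
- rewrite (@robjE h (q + e%:Z) (~~ e) 2) //; last by case: (e) rE => /= rE; lia.
  by congr (sisom _ (kobj _ _ _)); rewrite mulrDr; case: (e) => /=; lia.
rewrite (@robjE h (q + 1) e 0) //; last by lia.
by congr (sisom _ (kobj _ _ _)); rewrite mulrDr; lia.
Qed.

(** Applying S and removing one suspension is tau = R s^(-1), an
    autoequivalence. *)
Lemma robj_step (Se : serre_functor (stab k p)) h r t r' t' :
  svanish (robj h r t) (robj h r' t') <-> svanish (robj h (r + 1) (t + 1))
    (robj h (r' + 1) (t' + 1)).
Proof.
have e4 x : x + 4 = (x + 1 + 3 :> int) by lia.
rewrite (susp_vanish (robj_susp h (r + 1) (t + 1)) (robj_susp h (r' + 1) (t' + 1)))
  -!e4.
rewrite [X in X <-> _](nohom_serre Se); split; apply: nohom_iso; try exact: robj_serre;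
  by apply: iso_sym; exact: robj_serre.
Qed.

Lemma robj_transl (Se : serre_functor (stab k p)) h r t r' t' n :
  svanish (robj h r t) (robj h r' t') <-> svanish (robj h (r + n) (t + n))
    (robj h (r' + n) (t' + n)).
Proof.
have nat_case (m : nat) a b a' b' : svanish (robj h a b) (robj h a' b') <->
    svanish (robj h (a + m%:Z) (b + m%:Z)) (robj h (a' + m%:Z) (b' + m%:Z)).
  elim: m => [|m IH]; first by rewrite !addr0.
  by rewrite IH (robj_step Se) -addn1 PoszD !addrA.
case: n => n; first exact: nat_case.
by rewrite (nat_case n.+1 (r + Negz n)) NegzE !subrK.
Qed.

(** A map out of the simple object is an element of the socle; when the
    target has full length p, this element is divisible by x^(p - 1) and the
    map factors through [projM]. *)
Lemma simple_src_vanish a b g (h : (a <= b <= p)%N) d (h1 : (0 <= 1 <= p)%N) :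
  (b == p) || (g + b%:Z - 1 != d) -> svanish (ivl k d h1) (ivl k g h).
Proof.
move=> cond; apply/svanishP => f; have [/cycdegP fd f1 _] := ivl_gen_mem f.
have co0' i : i != b.-1 -> entry (f.2 gen) i = 0.
  move=> ne; have := congr1 (fun v => entry v i.+1) f1;
    rewrite /= entry_slide entry0 /= subn1 /=.
  by case: ltnP => // hi _; rewrite entry_out //; lia.
have fE : f.2 gen = entry (f.2 gen) b.-1 *: iter b.-1 (slide 1) gen.
  apply: entryP => i hi; rewrite entryZ entry_iter_gen hi andbT;
    case: eqP => [<-|/eqP ne]; first by rewrite mulr1.
  by rewrite mulr0 co0' // eq_sym.
case: (posnP b) => [b0|b_gt0].
  have -> : f = 0 by apply: ivl_ext2; rewrite lzero2E; apply: entryP => i hi; lia.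
  by apply/spi_eq0; exact: spi_0.
case: (eqVneq (g + b%:Z - 1) d) cond => [dE|ne _]; last first.
  have -> : f = 0.
    apply: ivl_ext2; rewrite lzero2E fE fd ?scale0r //; apply: contra ne => /eqP <-;
      apply/eqP; lia.
  by apply/spi_eq0; exact: spi_0.
rewrite orbF => /eqP bp;
  apply: (@ivl_st0M k p 0 1 d h1 (ivl k g h) f (entry (f.2 gen) b.-1 *: gen)).
  rewrite {1}fE -[iter _ _ (_ *: _)]xpowE lfun_scaleE xpowE; congr (_ *: iter _ _ _);
    lia.
rewrite memvZ // /=; have -> : d - (p - 1 + 0)%N%:Z = g by lia.
exact: gen_deg.
Qed.

Lemma robj0 h t : robj h 0 t = kobj 0 false (h + t).
Proof. by rewrite (@robjE h 0 false 0) // mulr0 !subr0. Qed.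

(** By translation, the source may be taken to be the simple object. *)
Lemma robj_vanish (Se : serre_functor (stab k p)) h r t r' t' :
  (forall q (e : bool) K, (K < 2)%N -> r' - r = 6 * q + 3 * e%:Z + K%:Z ->
    t' - t <> p%:Z * q + e%:Z) ->
  svanish (robj h r t) (robj h r' t').
Proof.
move=> H; apply/(robj_transl Se h r t r' t' (- r)); rewrite subrr robj0.
have [q [e [K [K3 rE]]]] := int_decomp6 (r' - r); rewrite (robjE h (t' - r) K3 rE).
have ll := kind_len_gt0 e.
have hK : (K < 2)%N -> t' - t <> p%:Z * q + e%:Z by move=> K2; apply: H rE.
by move: K K3 hK {rE} => [|[|[|//]]] _ /= hK; apply: simple_src_vanish;
  rewrite ?eqxx //;
  apply/orP; right; apply/eqP => e'; apply: hK => //; lia.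
Qed.

End Orbit.

(** * Generation by the simple objects *)

Section Generation.
Variables (k : fieldType) (p : nat).
Local Notation ladder := (ladder k p).
Local Notation sobj := (sobj k p).
Local Notation "g '\oh' f" := (lhom_comp g f) (at level 40, left associativity).

Lemma st0D (X Y : sobj) (f g : lhom X Y) : stably_zero f -> stably_zero g ->
  stably_zero (f + g).
Proof. by move=> /spi_eq0 hf /spi_eq0 hg; apply/spi_eq0; rewrite spiD hf hg addr0. Qed.
Lemma st0_compl (X Y Z : sobj) (f : lhom X Y) (g : lhom Y Z) : stably_zero g ->
  stably_zero (g \oh f).
Proof. by case=> Q [pQ [a [b ->]]]; rewrite -lcompA; apply: st0_factor. Qed.
Lemma st0_extend (X Y Z V : sobj) (i : lhom X Y) (q : lhom Y Z) (f : lhom X V) :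
  conflation i q -> stably_zero f -> exists2 e : lhom Y V, stably_zero e & e \oh i = f.
Proof.
move=> iq [Q [pQ [a [b ->]]]]; have [a' <-] := proj_injective iq a pQ.
by exists (b \oh a'); [apply: st0_factor | rewrite lcompA].
Qed.

Section TwoOfThree.
Variables (Sg : suspension k p) (W : sobj) (X Y Z : sobj) (i : lhom X Y) (q : lhom Y Z).
Hypothesis iq : conflation i q.

(** Exactness in the middle of Hom(-, V) on a conflation; [orth_right] and
    [orth_left] rotate it along the sequences that define the suspensions of
    V. *)
Lemma orth_mid : orth Sg W X -> orth Sg W Z -> orth Sg W Y.
Proof.
move=> oX oZ n; apply/svanishP => f.
have /svanishP/(_ (f \oh i)) /(st0_extend iq)[e e0 ei] := oX n.
have [|g gq] := confl_factor iq (g := f - e); first by rewrite lcompBl ei subrr.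
rewrite -(subrK e f) -gq; apply: st0D => //; apply: st0_compl.
by have /svanishP := oZ n; apply.
Qed.

Lemma orth_right : orth Sg W X -> orth Sg W Y -> orth Sg W Z.
Proof.
move=> oX oY n; apply/svanishP => f.
have [J [j [r [pJ jr]]]] := shift_susp Sg (n - 1) W; rewrite subrK in r jr.
have /svanishP/(_ (f \oh q)) /(st0_lift jr)[h hE] := oY n.
have [|l lE] := confl_lift jr (g := h \oh i).
  by rewrite lcompA -hE -lcompA (confl0 iq) lcomp0r.
have /svanishP/(_ l) /(st0_extend iq)[e _ ei] := oX (n - 1).
have [|m mE] := confl_factor iq (g := h - j \oh e).
  by rewrite lcompBl -lcompA ei lE subrr.
rewrite (_ : f = r \oh m); first exact: st0_factor.
apply: (confl_epi iq); rewrite -lcompA mE lcompBr lcompA (confl0 jr) lcomp0l subr0.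
exact: hE.
Qed.

Lemma orth_left : orth Sg W Y -> orth Sg W Z -> orth Sg W X.
Proof.
move=> oY oZ n; apply/svanishP => f.
have [J [j [r [pJ jr]]]] := shift_susp Sg n W.
have [g gE] := proj_injective iq (j \oh f) pJ.
have [|f' f'E] := confl_factor iq (g := r \oh g).
  by rewrite -lcompA gE lcompA (confl0 jr) lcomp0l.
have /svanishP/(_ f') /(st0_lift jr)[t tE] := oZ (n + 1).
have [|e eE] := confl_lift jr (g := g - t \oh q).
  by rewrite lcompBr lcompA -tE f'E subrr.
have <- : e \oh i = f.
  apply: (confl_mono jr); rewrite lcompA eE lcompBl -lcompA (confl0 iq) lcomp0r subr0.
  exact: gE.
by apply: st0_compl; have /svanishP := oY n; apply.
Qed.

End TwoOfThree.

Section Family.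
Variable top : bool.
Definition lowlen n := if top then n else 0%N.
Lemma fam_le n : (n <= p)%N -> (lowlen n <= n <= p)%N. Proof.
  by rewrite /lowlen; case: top; lia. Qed.
Definition fam n (g : int) (hn : (n <= p)%N) : sobj := ivl k g (fam_le hn).

Lemma fam_susp n n' (g g1 : int) (h : (n <= p)%N) (h' : (n' <= p)%N) : n' = (p - n)%N ->
  g1 = g + n'%:Z ->
  susp_of (fam g1 h) (fam g h').
Proof.
move=> nE; subst n' => gE; rewrite /fam; move: (fam_le h) (fam_le h'); rewrite /lowlen.
by case: top => h1 h2; [apply: suspB | apply: suspA].
Qed.

Lemma fam_confl n (g : int) (h : (n <= p)%N) (h' : (n.+1 <= p)%N) (h1 : (1 <= p)%N) :
  exists (i : lhom (fam (g + 1) h) (fam g h')) (q : lhom (fam g h') (fam g h1)),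
    conflation i q.
Proof.
by rewrite /fam; move: (fam_le h) (fam_le h') (fam_le h1); rewrite /lowlen;
  case: top => *;
  apply: confl_ivl; lia.
Qed.

(** A module of length p - 1 is an iterated extension of p - 1 simple ones
    in consecutive degrees, and its suspension and desuspension are the
    simple ones in the two adjacent degrees. So orthogonality spreads from
    any p - 1 consecutive degrees to all. *)
Lemma fam_orth (hp : (1 < p)%N) Sg W : let S d := forall h1 : (1 <= p)%N,
  orth Sg W (fam d h1) in
  forall h, (forall c : nat, (c < p.-1)%N -> S (h + c%:Z)) -> forall d, S d.
Proof.
move=> S.
have win n d (hn : (n.+1 <= p)%N) : (forall c : nat, (c < n.+1)%N -> S (d + c%:Z)) ->
  orth Sg W (fam d hn).
  elim: n d hn => [|n IH] d hn H; first by have := H 0%N isT hn; rewrite addr0.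
  have hn' : (n.+1 <= p)%N by lia. have h1 : (1 <= p)%N by lia.
  have [i [q iq]] := fam_confl d hn' hn h1.
  apply: (orth_mid iq); last by have := H 0%N isT h1; rewrite addr0.
  by apply: IH => c hc; have := H c.+1 hc; congr (S _); lia.
have hp1 : (p.-2.+1 <= p)%N by lia.
have ext d : (forall c : nat, (c < p.-1)%N -> S (d + c%:Z)) ->
  S (d + p.-1%:Z) /\ S (d - 1).
  move=> H; have oN : orth Sg W (fam d hp1) by apply: win => c hc; apply: H; lia.
  split=> h1.
    by apply: (proj2 (orth_susp Sg W (fam_susp _ _ _ _))) oN; lia.
  by apply: (proj1 (orth_susp Sg W (fam_susp _ _ _ _))) oN; lia.
move=> h H.
have up (m : nat) : forall c : nat, (c < p.-1)%N -> S (h + m%:Z + c%:Z).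
  elim: m => [|m IH] c hc; first by rewrite addr0; apply: H.
  case: (ltnP c.+1 p.-1) => hc'; first by have := IH c.+1 hc'; congr (S _); lia.
  by have [+ _] := ext _ IH; congr (S _); lia.
have dn (m : nat) : forall c : nat, (c < p.-1)%N -> S (h - m%:Z + c%:Z).
  elim: m => [|m IH] c hc; first by rewrite subr0; apply: H.
  case: c hc => [|c] hc; last by have := IH c (ltnW hc); congr (S _); lia.
  by have [_] := ext _ IH; congr (S _); lia.
move=> d; have p1 : (0 < p.-1)%N by lia.
have [hd|hd] := lerP h d.
  by have := up (absz (d - h)) 0%N p1; congr (S _); lia.
by have := dn (absz (h - d)) 0%N p1; congr (S _); lia.
Qed.

End Family.

Lemma ivl_fam top a b (g g' : int) (h : (a <= b <= p)%N) n (hn : (n <= p)%N) :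
  a = lowlen top n -> b = n -> g = g' -> ivl k g h = fam top g' hn.
Proof.
move=> aE bE gE; subst; rewrite /fam; move: (fam_le top hn) => h'.
by rewrite (bool_irrelevance h h').
Qed.

Section Idempotents.
Variable W : sobj.

Definition idem_rank (e : lhom W W) := (\dim (limg e.1) + \dim (limg e.2))%N.

Lemma limg_sub_of (V : vectType k) (e e' : 'End(V)) : (forall v, e (e' v) = e' v) ->
  (limg e' <= limg e)%VS.
Proof. by move=> h; apply/subvP => _ /memv_imgP[v _ ->]; rewrite -h memv_img ?memvf.
Qed.

(** Removing from an idempotent [e] a direct summand Q of its image leaves
    an idempotent of smaller rank. *)
Lemma split_idem (e : lhom W W) (Q : sobj) (al : lhom Q W) (be : lhom W Q) :
  e \oh e = e -> e \oh al = al -> be \oh al = lhom_id Q ->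
  (exists v, al.1 v != 0) \/ (exists v, al.2 v != 0) ->
  let e' := e - al \oh (be \oh e) in e' \oh e' = e' /\ (idem_rank e' < idem_rank e)%N.
Proof.
move=> ee ea ba nz e'.
have ee' : e \oh e' = e' by rewrite lcompBr ee lcompA ea.
have e'e : e' \oh e = e' by rewrite lcompBl -!lcompA ee.
have e'a : e' \oh al = 0 by rewrite lcompBl -!lcompA ea ba lcompc1 subrr.
have e'e' : e' \oh e' = e'.
  by rewrite {2}/e' lcompBr e'e lcompA e'a lcomp0l subr0.
split=> //.
have s1 : (limg e'.1 <= limg e.1)%VS by apply: limg_sub_of => v; rewrite -lcomp1E ee'.
have s2 : (limg e'.2 <= limg e.2)%VS by apply: limg_sub_of => v; rewrite -lcomp2E ee'.
have d1 := dimvS s1; have d2 := dimvS s2; rewrite /idem_rank.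
case: nz => -[v av].
  suff : (\dim (limg e'.1) < \dim (limg e.1))%N by lia.
  rewrite ltn_neqAle d1 andbT; apply: contra av => /eqP dE.
  have /eqP sE : limg e'.1 == limg e.1 by rewrite eqEdim s1 dE leqnn.
  have : al.1 v \in limg e'.1 by rewrite sE -ea lcomp1E memv_img ?memvf.
  case/memv_imgP => w _ wE; rewrite wE -e'e' lcomp1E -wE -lcomp1E e'a lzero1E;
    exact: eqxx.
suff : (\dim (limg e'.2) < \dim (limg e.2))%N by lia.
rewrite ltn_neqAle d2 andbT; apply: contra av => /eqP dE.
have /eqP sE : limg e'.2 == limg e.2 by rewrite eqEdim s2 dE leqnn.
have : al.2 v \in limg e'.2 by rewrite sE -ea lcomp2E memv_img ?memvf.
case/memv_imgP => w _ wE; rewrite wE -e'e' lcomp2E -wE -lcomp2E e'a lzero2E;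
  exact: eqxx.
Qed.

End Idempotents.

Lemma socle_elt (N M : grmod k p) (f : 'Hom(N, M)) : grhom f -> (exists v, f v != 0) ->
  exists d v, [/\ v \in gdeg N d, f v != 0 & gx M (f v) = 0].
Proof.
move=> gf nz; have [n [v [vN fv]]] : exists n v, v \in gdeg N n /\ f v != 0.
  case: (pselect (exists n v, v \in gdeg N n /\ f v != 0)) => // no;
    case: nz => v /eqP [].
  move: v; apply: deg_ind => [|v w hv hw|n v vN]; first exact: linear0.
    by rewrite lfun_addE hv hw addr0.
  by apply/eqP; apply: contra_notT no => h; exists n, v.
have [i [h1 h2]] : exists i, iter i (gx M) (f v) != 0 /\ gx M (iter i (gx M) (f v)) = 0.
  have [j] : exists j, iter j (gx M) (f v) = 0 by exists p; rewrite gx_nil.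
  elim: j => [/= e|j IH /= e]; first by rewrite e eqxx in fv.
  by case: (eqVneq (iter j (gx M) (f v)) 0) => [/IH//|ne]; exists j.
exists (n + i%:Z), (iter i (gx N) v); rewrite deg_iter // (hom_iter _ _ gf).
by split.
Qed.

Section SocleDivisible.
Hypothesis p_gt0 : (0 < p)%N.
Variable W : sobj.
Hypothesis socM : forall d m, m \in gdeg (lM W) d -> gx _ m = 0 ->
  exists m', m = iter p.-1 (gx _) m'.
Hypothesis socU : forall d u, u \in gdeg (lU W) d -> gx _ u = 0 ->
  exists u', u = iter p.-1 (gx _) u'.

Lemma gproj_iter (M : grmod k p) n i (v : M) :
  iter i (gx M) (gproj M n v) = gproj M (n + i%:Z) (iter i (gx M) v).
Proof.
rewrite -!xpowE; move: v; apply: deg_ind => [|v w hv hw|n' v vM];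
  first by rewrite !linear0.
  by rewrite !lfun_addE hv hw.
rewrite !xpowE; case: (eqVneq n n') vM => [<-|ne] vM;
  first by rewrite !gproj_id ?deg_iter.
rewrite (gproj_0 ne vM) (gproj_0 _ (deg_iter i vM)); first by rewrite -xpowE linear0.
by apply: contra ne => /eqP e; apply/eqP; lia.
Qed.

(** The hypothesis on the image of [l] holds for graded maps; it allows
    making the form homogeneous without losing that it kills this image. *)
Lemma dual_form (M : grmod k p) (V : vectType k) (l : 'Hom(V, M)) d (m : M) :
  m \in gdeg M d ->
  (forall v, m <> l v) -> (forall v, exists w, gproj M d (l v) = l w) ->
  exists P : 'Hom(M, k^o), [/\ form_deg P d, P m = 1 & forall v, P (l v) = 0].
Proof.
move=> mM nl cl.
have lin : linear (fun c : k^o => c *: m) by move=> a c c'; rewrite scalerDl scalerA.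
have [c v e|P [P1 P2]] :=
  lfun_extend (h := mk_lfun lin) (g := l) (f := (\1%VF : 'End(k^o))).
  rewrite lfunE /=; move: e; rewrite mk_lfunE; case: (eqVneq c 0) => // c0 e.
  by case: (nl (c^-1 *: v)); rewrite lfun_scaleE -e scalerA mulVf // scale1r.
exists (P \o gproj M d)%VF; split=> [n v ne vM||v]; rewrite lfunE /=.
- by rewrite (gproj_0 _ vM) ?linear0 // eq_sym.
- by rewrite gproj_id // -[m]scale1r -(mk_lfunE lin) P1 lfunE.
by have [w ->] := cl v; rewrite P2.
Qed.

(** A socle element in the image of [e] is x^(p - 1) u with u in this image
    as well. The element u spans a copy of [projU], and a form with value 1
    on x^(p - 1) u gives the retraction. *)
Lemma splitU (e : lhom W W) : e \oh e = e -> (exists v, e.1 v != 0) ->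
  exists (Q : sobj) (al : lhom Q W) (be : lhom W Q), [/\ projective Q, e \oh al = al,
    be \oh al = lhom_id Q & (exists v, al.1 v != 0) \/ (exists v, al.2 v != 0)].
Proof.
move=> ee /(socle_elt (lhom_gr1 e)) [d [v [vd ev xev]]].
have eU : e.1 v \in gdeg (lU W) d by apply: hom_deg (lhom_gr1 e) vd.
have [w wE] := socU eU xev; pose g := d - p.-1%:Z; pose u := e.1 (gproj _ g w).
have uE : iter p.-1 (gx _) u = e.1 v.
  rewrite /u -(hom_iter _ _ (lhom_gr1 e)) gproj_iter subrK -wE gproj_id //.
  by rewrite -lcomp1E ee.
have uU : u \in gdeg (lU W) g by apply: hom_deg (lhom_gr1 e) (gproj_mem _ _).
have [al [al1 al2]] := projU_out uU.
have [||| P [Pd P1 _]] := @dual_form (lM W) k^o 0 d (lmap W (e.1 v)).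
- exact: hom_deg (lmapP W) eU.
- move=> c; rewrite zero_lfunE => e0; case/eqP: ev; apply: (@sobj_mono _ _ W).
  by rewrite e0 linear0.
- by move=> c; exists 0; rewrite !zero_lfunE linear0.
have [|||be beE] := @ivl_in k p p p g (le_pp p) W P.
- by have -> : g + p%:Z - 1 = d by rewrite /g; lia.
- by move=> m; rewrite gx_nil linear0.
- by move=> m; rewrite gx_nil !linear0.
exists (projU k p g), al, be; split; [exact: projU_proj | | | ].
- apply: ivl_ext; rewrite ?lcomp1E ?lcomp2E ?al1 ?al2.
    by rewrite /u -lcomp1E ee.
  by rewrite lhom_sq /u -lcomp1E ee.
- apply: ivl_ext2; rewrite lcomp2E lid2E beE al2; apply: entryP => i hi;
    rewrite entry_cyc_in hi entry_gen.
  rewrite (leq_ltn_trans _ hi) // andbT; case: eqP => [->|ne].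
    by rewrite subn0 -(hom_iter _ _ (lmapP W)) uE P1.
  apply: (Pd (g + (p.-1 - i)%N%:Z)); last by apply: deg_iter;
    apply: hom_deg (lmapP W) uU.
  by apply/eqP => e0; rewrite /g in e0; lia.
left; exists gen; rewrite al1; apply: contra ev => /eqP u0.
by rewrite -uE u0 -xpowE linear0.
Qed.

(** When [e] vanishes on U, its image in M meets U trivially. So the form
    with value 1 on a socle element can be chosen to kill U, which is what a
    retraction to [projM] requires. *)
Lemma splitM (e : lhom W W) : e \oh e = e -> (forall v, e.1 v = 0) ->
  (exists v, e.2 v != 0) ->
  exists (Q : sobj) (al : lhom Q W) (be : lhom W Q), [/\ projective Q, e \oh al = al,
    be \oh al = lhom_id Q & (exists v, al.1 v != 0) \/ (exists v, al.2 v != 0)].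
Proof.
move=> ee e10 /(socle_elt (lhom_gr2 e)) [d [v [vd ev xev]]].
have eM : e.2 v \in gdeg (lM W) d by apply: hom_deg (lhom_gr2 e) vd.
have [w wE] := socM eM xev; pose g := d - p.-1%:Z; pose u := e.2 (gproj _ g w).
have uE : iter p.-1 (gx _) u = e.2 v.
  rewrite /u -(hom_iter _ _ (lhom_gr2 e)) gproj_iter subrK -wE gproj_id //.
  by rewrite -lcomp2E ee.
have uM : u \in gdeg (lM W) g by apply: hom_deg (lhom_gr2 e) (gproj_mem _ _).
have [al al2] := projM_out uM.
have [||P [Pd P1 Pl]] := @dual_form (lM W) _ (lmap W) d (e.2 v) eM.
- move=> c e0; case/eqP: ev; rewrite -ee lcomp2E e0 lhom_sq e10; exact: linear0.
- by move=> c; exists (gproj _ d c); rewrite (gproj_hom _ _ (lmapP W)).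
have [|||be beE] := @ivl_in k p 0 p g (le_0p p) W P.
- by have -> : g + p%:Z - 1 = d by rewrite /g; lia.
- by move=> m; rewrite gx_nil linear0.
- by move=> m; rewrite Pl.
exists (projM k p g), al, be; split; [exact: projM_proj | | | ].
- by apply: ivl_ext2; rewrite ?lcomp2E ?al2 /u -lcomp2E ee.
- apply: ivl_ext2; rewrite lcomp2E lid2E beE al2; apply: entryP => i hi;
    rewrite entry_cyc_in hi entry_gen.
  rewrite (leq_ltn_trans _ hi) // andbT; case: eqP => [->|ne].
    by rewrite subn0 uE P1.
  apply: (Pd (g + (p.-1 - i)%N%:Z)); last by apply: deg_iter.
  by apply/eqP => e0; rewrite /g in e0; lia.
right; exists gen; rewrite al2; apply: contra ev => /eqP u0.
by rewrite -uE u0 -xpowE linear0.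
Qed.

(** Divisible socles allow splitting off projective summands from the image
    of an idempotent until nothing is left. *)
Lemma idem_st0 (e : lhom W W) : e \oh e = e -> stably_zero e.
Proof.
have [n] := ubnP (idem_rank e); elim: n e => // n IH e rn ee.
have step : (exists (Q : sobj) (al : lhom Q W) (be : lhom W Q),
  [/\ projective Q, e \oh al = al,
    be \oh al = lhom_id Q & (exists v, al.1 v != 0) \/ (exists v, al.2 v != 0)]) ->
      stably_zero e.
  case=> Q [al [be [pQ ea ba nz]]]; have [e'e' rk'] := split_idem ee ea ba nz.
  rewrite -(subrK (al \oh (be \oh e)) e); apply: st0D; last exact: st0_factor.
  by apply: IH e'e'; apply: leq_trans rk' _.
case: (pselect (exists v, e.1 v != 0)) => [e1|e1]; first by apply: step; apply: splitU.
have e10 v : e.1 v = 0 by apply/eqP; apply: contra_notT e1 => h; exists v.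
case: (pselect (exists v, e.2 v != 0)) => [e2|e2]; first by apply: step; apply: splitM.
have e20 v : e.2 v = 0 by apply/eqP; apply: contra_notT e2 => h; exists v.
have -> : e = 0 by apply: lhomE => v; rewrite ?lzero1E ?lzero2E ?e10 ?e20.
by apply/spi_eq0; apply: spi_0.
Qed.

End SocleDivisible.

(** Maps from the simple objects are the socle elements of M and of U, and
    such a map is stably zero exactly when the element is divisible by x^(p
    - 1). *)
Lemma zero_of_orth (hp : (1 < p)%N) (W : sobj) :
  (forall d (h1 : (0 <= 1 <= p)%N), svanish (ivl k d h1) W) ->
  (forall d (h1 : (1 <= 1 <= p)%N), svanish (ivl k d h1) W) -> is_zero (W : stab k p).
Proof.
move=> hA hB; apply/spi_eq0/idem_st0; last exact: lcomp1c.
- exact: ltnW.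
- move=> d m mM xm; have h1 : (0 <= 1 <= p)%N by lia.
  have [|f fE] := @ivl_out2 k p 0 1 d h1 W m 0 mM xm; first by rewrite linear0 subn0.
  have /svanishP/(_ f)/ivl_st0 [u [m']] := hA d h1.
  rewrite fE addn0 subn1 => mE; exists (lmap W u + m').
  by rewrite mE -!xpowE lfun_addE !xpowE (hom_iter _ _ (lmapP W)).
move=> d u uU xu; have h1 : (1 <= 1 <= p)%N by lia.
have [||f fE] := @ivl_out2 k p 1 1 d h1 W (lmap W u) u (hom_deg (lmapP W) uU).
- by rewrite /= -(lmapP W).2 xu linear0.
- by rewrite subnn.
have /svanishP/(_ f)/ivl_st0 [u' [m']] := hB d h1.
rewrite fE [iter (_ + _) _ m']iter_ge ?addr0 => [e|]; last lia.
by exists u'; apply: (@sobj_mono _ _ W); rewrite e subn1.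
Qed.

End Generation.

(** * Endomorphism rings with matrix units *)

Section MatrixUnits.
Variables (k : fieldType) (C : lincat k) (T : C) (m r : nat).
Variable E : 'I_m -> 'I_m -> End T.
Hypothesis E1 : \sum_i E i i = 1.
Hypothesis EM : forall i j l : 'I_m, (i <= j)%N -> (j <= l)%N -> E i j * E j l = E i l.
Hypothesis EM0 : forall i j j' l : 'I_m, (i <= j)%N -> (j' <= l)%N -> j != j' ->
  E i j * E j' l = 0.
Hypothesis E0 : forall i j : 'I_m, (i + r <= j)%N -> E i j = 0.
Hypothesis En0 : forall i j : 'I_m, (i <= j < i + r)%N -> E i j != 0.
Hypothesis Espan : forall (x : End T) (i j : 'I_m), (i <= j)%N ->
  exists c : k, E i i * x * E j j = c *: E i j.
Hypothesis Espan0 : forall (x : End T) (i j : 'I_m), (j < i)%N -> E i i * x * E j j = 0.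

Lemma endZl a (x y : End T) : (a *: x) * y = a *: (x * y).
Proof. exact: ccompZl. Qed.
Lemma endZr a (x y : End T) : x * (a *: y) = a *: (x * y).
Proof. exact: ccompZr. Qed.

Local Notation A := (path_alg k m).

Lemma pmx_linear a (f g : A) : pmx (a *: f + g) = a *: pmx f + pmx g.
Proof.
rewrite pmxD; congr (_ + _); apply/matrixP => i j; rewrite !mxE.
by case: insub => [w|]; rewrite ?ffunE ?mulr0.
Qed.

(** A path i -> j corresponds to the matrix unit in position (i, j), via the
    upper triangular matrices [pmx]. *)
Definition unit_map (f : A) : End T := \sum_i \sum_j pmx f i j *: E i j.

Lemma unit_map_linear : linear unit_map.
Proof.
move=> a f g; rewrite /unit_map scaler_sumr -big_split; apply: eq_bigr => i _ /=.
rewrite scaler_sumr -big_split; apply: eq_bigr => j _ /=.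
by rewrite pmx_linear !mxE scalerDl scalerA.
Qed.

Lemma unit_map1 : unit_map 1 = 1.
Proof.
rewrite -E1; apply: eq_bigr => i _; rewrite (bigD1 i) //= big1 => [|j ne].
  by rewrite -[1]/(pa_one k m) pmx1 mxE eqxx scale1r addr0.
by rewrite -[1]/(pa_one k m) pmx1 mxE eq_sym (negbTE ne) scale0r.
Qed.

Lemma unit_mapM f g : unit_map (f * g) = unit_map f * unit_map g.
Proof.
rewrite /unit_map mulr_suml; apply: eq_bigr => i _; rewrite mulr_suml.
rewrite -[f * g]/(pa_mul f g) pmxM.
transitivity (\sum_l \sum_j (pmx f i j * pmx g j l) *: E i l).
  by apply: eq_bigr => l _; rewrite mxE scaler_suml.
rewrite exchange_big; apply: eq_bigr => j _ /=; rewrite mulr_sumr.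
rewrite [RHS](bigD1 j) //= [X in _ + X]big1 ?addr0 => [|j' ne]; last first.
  rewrite mulr_sumr big1 // => l _; rewrite endZl endZr.
  case: (leqP i j) => ij; last by rewrite pmx0 ?scale0r.
  case: (leqP j' l) => jl; last by rewrite [pmx g _ _]pmx0 ?scale0r ?scaler0.
  by rewrite EM0 ?scaler0 // eq_sym.
rewrite mulr_sumr; apply: eq_bigr => l _; rewrite endZl endZr scalerA.
case: (leqP i j) => ij; last by rewrite pmx0 ?mul0r ?scale0r.
case: (leqP j l) => jl; last by rewrite [pmx g _ _]pmx0 ?mulr0 ?scale0r.
by rewrite EM.
Qed.

Lemma pmx_base (w : path_ m) : pmx (pbase k w) = delta_mx (psrc w) (ptgt w).
Proof.
apply: pmxP => [i j ji|v]; rewrite ?mxE ?ffunE.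
  case: eqP => //= ei; case: eqP => //= ej; move: ji; rewrite ei ej ltnNge.
  by rewrite (valP w).
by congr (nat_of_bool _)%:R;
  rewrite -val_eqE -[val v]surjective_pairing -[val w]surjective_pairing xpair_eqE.
Qed.

Lemma unit_map_base w : unit_map (pbase k w) = E (psrc w) (ptgt w).
Proof.
rewrite /unit_map pmx_base (bigD1 (psrc w)) //= [X in _ + X]big1 ?addr0 => [|i ne];
  last first.
  by rewrite big1 // => j _; rewrite mxE (negbTE ne) scale0r.
rewrite (bigD1 (ptgt w)) //= big1 ?addr0 => [|j ne].
  by rewrite mxE !eqxx scale1r.
by rewrite mxE (negbTE ne) andbF scale0r.
Qed.

Lemma unit_map_ideal a : nak_ideal r a -> unit_map a = 0.
Proof.
have lin := unit_map_linear.
have z : unit_map 0 = 0 by have := lin (-1) 0 0; rewrite scaler0 addr0 scaleN1r addNr.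
move=> ha; apply: (ha (fun a => unit_map a = 0)); first split; first split => //.
- by move=> c x y hx hy; rewrite lin hx hy scaler0 addr0.
- by move=> b x hx; rewrite !unit_mapM hx mulr0 mul0r.
move=> w wr; rewrite unit_map_base E0 //; have wP : (psrc w <= ptgt w)%N := valP w.
by rewrite /plength in wr; lia.
Qed.

Lemma unit_map_coord a (i j : 'I_m) : (i <= j)%N ->
  E i i * unit_map a * E j j = pmx a i j *: E i j.
Proof.
move=> ij; rewrite /unit_map mulr_sumr mulr_suml (bigD1 i) //= [X in _ + X]big1
  ?addr0 => [|i' ne]; last first.
  rewrite mulr_sumr mulr_suml big1 // => j' _; rewrite endZr endZl.
  case: (leqP i' j') => ij'; last by rewrite pmx0 ?scale0r.
  by rewrite EM0 ?mul0r ?scaler0 // eq_sym.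
rewrite mulr_sumr mulr_suml (bigD1 j) //= [X in _ + X]big1 ?addr0 => [|j' ne];
  last first.
  rewrite endZr endZl; case: (leqP i j') => ij'; last by rewrite pmx0 ?scale0r.
  by rewrite EM // EM0 ?scaler0.
by rewrite endZr endZl !EM.
Qed.

(** Such a path starts with a path of length r. *)
Lemma base_ideal (w : path_ m) : (r <= plength w)%N -> nak_ideal r (pbase k w).
Proof.
move=> le J idJ gJ; have wP : (psrc w <= ptgt w)%N := valP w.
have lt : (psrc w + r < m)%N by apply: leq_ltn_trans (ltn_ord (ptgt w));
  rewrite /plength in le; lia.
pose t := Ordinal lt.
have su : (psrc w <= t)%N by rewrite /= leq_addr.
have sv : (t <= ptgt w)%N by rewrite /=; rewrite /plength in le; lia.
pose u : path_ m := Sub (psrc w, t) su; pose v : path_ m := Sub (t, ptgt w) sv.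
have -> : pbase k w = pbase k u * pbase k v.
  apply: pmx_inj; rewrite -[_ * _]/(pa_mul _ _) pmxM !pmx_base.
  have [-> ->] : ptgt u = t /\ psrc v = t by rewrite /ptgt /psrc !SubK.
  have [-> ->] : psrc u = psrc w /\ ptgt v = ptgt w by rewrite /ptgt /psrc !SubK.
  by rewrite mul_delta_mx.
have [_ hJ] := idJ; apply: (proj2 (hJ _ _ _)).
by apply: gJ; rewrite /plength /psrc /ptgt !SubK /= addKn.
Qed.

Lemma unit_map_ker a : unit_map a = 0 -> nak_ideal r a.
Proof.
move=> a0; have aE : a = \sum_w a w *: pbase k w.
  apply/ffunP => v; rewrite sum_ffunE (bigD1 v) //= big1 ?addr0 => [|w ne].
    by rewrite !ffunE eqxx; rewrite /GRing.scale /= mulr1.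
  by rewrite !ffunE eq_sym (negbTE ne) scaler0.
rewrite aE => J idJ gJ; have [[J0 JD] _] := idJ.
apply: (big_ind J) => // [x y Jx Jy|w _]; first by rewrite -[x]scale1r; apply: JD.
have wP : (psrc w <= ptgt w)%N := valP w.
case: (leqP r (plength w)) => [le|lt].
  by rewrite -[_ *: _]addr0; apply: JD => //; apply: base_ideal.
have := unit_map_coord a wP; rewrite a0 mulr0 mul0r pmxE => /esym/eqP.
rewrite scaler_eq0 (negbTE (En0 _)) ?orbF => [/eqP ->|]; first by rewrite scale0r.
by rewrite wP /=; rewrite /plength in lt; lia.
Qed.

Lemma unit_map_surj x : exists a, unit_map a = x.
Proof.
have ex (w : path_ m) : exists c : k,
  E (psrc w) (psrc w) * x * E (ptgt w) (ptgt w) = c *: E (psrc w) (ptgt w).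
  by apply: Espan; exact: valP w.
have [c cE] := choice ex; exists [ffun w => c w].
have -> : x = \sum_i \sum_j E i i * x * E j j.
  rewrite -{1}[x]mul1r -{1}[1 * x]mulr1 -{1}E1 -{1}E1 !mulr_suml; apply: eq_bigr => i _.
  by rewrite mulr_sumr.
apply: eq_bigr => i _; apply: eq_bigr => j _.
case: (leqP i j) => ij; last by rewrite pmx0 // scale0r Espan0.
pose w : path_ m := Sub (i, j) ij.
have [<- <-] : psrc w = i /\ ptgt w = j by rewrite /psrc /ptgt !SubK.
by rewrite pmxE ffunE cE.
Qed.

(** The [E i j] multiply like the paths i -> j of the linear quiver; those
    of length at least r vanish, the others are linearly independent, and
    together they span. *)
Lemma nakayama_iso : exists phi : {linear nakayama k m r -> End T},
  monoid_morphism phi /\ bijective phi.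
Proof.
pose f (x : nakayama k m r) : End T := unit_map (nrepr x).
have fpi a : f (npi r a) = unit_map a.
  have /unit_map_ideal : nak_ideal r (nrepr (npi r a) - a) by apply/npiP;
    rewrite nreprK.
  rewrite -scaleN1r addrC unit_map_linear scaleN1r => /eqP.
  by rewrite addrC subr_eq0 => /eqP.
have flin : linear f.
  move=> c x y; rewrite -[x]nreprK -[y]nreprK.
  have -> : c *: npi r (nrepr x) + npi r (nrepr y) = npi r (c *: nrepr x + nrepr y).
    by rewrite /npi lpi_is_linear.
  by rewrite !fpi unit_map_linear.
pose phi : {linear nakayama k m r -> End T} :=
  HB.pack f (GRing.isLinear.Build _ _ _ _ _ flin).
exists phi; split.
  split=> [|x y]; first by rewrite -[RHS]unit_map1; exact: fpi.
  rewrite -[x]nreprK -[y]nreprK -[_ * _]/(nak_mul _ _) nak_mul_pi.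
  by rewrite -[LHS]/(f _) -[RHS]/(f _ * f _) !fpi unit_mapM.
have sur x : exists y, f y = x by have [a <-] := unit_map_surj x; exists (npi r a).
have [g gE] := choice sur.
have finj : injective f.
  move=> x y; rewrite -[x]nreprK -[y]nreprK !fpi => e; apply/npiP; apply: unit_map_ker.
  by rewrite -scaleN1r addrC unit_map_linear e scaleN1r addNr.
by exists g => [x|x]; [apply: finj; rewrite gE | exact: gE].
Qed.

End MatrixUnits.

(** * Direct sums and their endomorphism rings *)

Section Sums.
Variables (k : fieldType) (p : nat).
Local Notation sobj := (sobj k p).
Local Notation "g '\oh' f" := (lhom_comp g f) (at level 40, left associativity).

Definition lbiprod (n : nat) (X : nat -> sobj) (T : sobj) :=
  exists (io : forall i, lhom (X i) T) (pr : forall i, lhom T (X i)),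
  [/\ forall i, (i < n)%N -> pr i \oh io i = lhom_id (X i),
      forall i j, (i < n)%N -> (j < n)%N -> i != j -> pr j \oh io i = 0
    & \sum_(i < n) io i \oh pr i = lhom_id T].

Lemma lcomp_sumr (X Y Z : ladder k p) (n : nat) (g : lhom Y Z) (F : nat -> lhom X Y) :
  g \oh (\sum_(i < n) F i) = \sum_(i < n) g \oh F i.
Proof. by apply: big_morph => [a b|]; rewrite ?lcompDr ?lcomp0r. Qed.
Lemma lcomp_suml (X Y Z : ladder k p) (n : nat) (F : nat -> lhom Y Z) (g : lhom X Y) :
  (\sum_(i < n) F i) \oh g = \sum_(i < n) F i \oh g.
Proof. by apply: (big_morph (fun f => f \oh g)) => [a b|]; rewrite ?lcompDl ?lcomp0l.
Qed.

Lemma lbiprod0 X : lbiprod 0 X (szero k p).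
Proof.
exists (fun=> 0), (fun=> 0); split=> //; rewrite big_ord0.
by apply: lhomE => v; rewrite [LHS]rV0_eq0 [RHS]rV0_eq0.
Qed.

Lemma lbiprodS n X (T : sobj) : lbiprod n (fun i => X i.+1) T ->
  lbiprod n.+1 X (ssum (X 0%N) T).
Proof.
case=> io [pr [h1 h2 h3]].
exists (fun i => match i return lhom (X i) (ssum (X 0%N) T) with
  | 0 => linl (X 0%N) T | j.+1 => linr (X 0%N) T \oh io j end).
exists (fun i => match i return lhom (ssum (X 0%N) T) (X i) with
  | 0 => lfst (X 0%N) T | j.+1 => pr j \oh lsnd (X 0%N) T end).
split=> [[|i] hi|[|i] [|j] hi hj ne|] //.
- exact: lfst_linl.
- by rewrite -lcompA [lsnd _ _ \oh _]lcompA lsnd_linr lcomp1c h1.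
- by rewrite -lcompA lsnd_linl lcomp0r.
- by rewrite lcompA lfst_linr lcomp0l.
- by rewrite -lcompA [lsnd _ _ \oh _]lcompA lsnd_linr lcomp1c h2.
rewrite big_ord_recl /= -lsumE; congr (_ + _).
rewrite -[X in _ = X \oh _]lcompc1 -h3.
rewrite (lcomp_sumr _ (linr _ _) (fun i => io i \oh pr i)) (lcomp_suml _ (fun i =>
  linr _ _ \oh (io i \oh pr i))).
by apply: eq_bigr => i _; rewrite !lcompA.
Qed.

Lemma lbiprod_pair n X (T : sobj) : lbiprod n (fun i => X i.+2) T ->
  lbiprod n.+2 X (ssum (ssum (X 0%N) (ssum (X 1%N) (szero k p))) T).
Proof.
case=> io [pr [h1 h2 h3]];
  have [io2 [pr2 [g1 g2 g3]]] := lbiprodS (lbiprodS (lbiprod0 (fun i => X i.+2))).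
set S := ssum (X 0%N) _ in io2 pr2 g1 g2 g3 *.
exists (fun i => match i return lhom (X i) (ssum S T) with
  | 0 => linl S T \oh io2 0%N | 1 => linl S T \oh io2 1%N | j.+2 =>
    linr S T \oh io j end).
exists (fun i => match i return lhom (ssum S T) (X i) with
  | 0 => pr2 0%N \oh lfst S T | 1 => pr2 1%N \oh lfst S T | j.+2 =>
    pr j \oh lsnd S T end).
have red A B (f : lhom S A) (f' : lhom T A) (g : lhom B S) (g' : lhom B T) :
  [/\ (f \oh lfst S T) \oh (linl S T \oh g) = f \oh g,
    (f \oh lfst S T) \oh (linr S T \oh g') = 0,
   (f' \oh lsnd S T) \oh (linl S T \oh g) = 0 & (f' \oh lsnd S T) \oh (linr S T \oh g')
     = f' \oh g'].
  rewrite -!lcompA ![lfst _ _ \oh (_ \oh _)]lcompA ![lsnd _ _ \oh (_ \oh _)]lcompA.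
  by rewrite lfst_linl lfst_linr lsnd_linl lsnd_linr !lcomp1c !lcomp0l !lcomp0r.
split=> [[|[|i]] hi|[|[|i]] [|[|j]] hi hj ne|] //.
- by have [-> _ _ _] := red _ _ (pr2 0%N) 0 (io2 0%N) 0; apply: g1.
- by have [-> _ _ _] := red _ _ (pr2 1%N) 0 (io2 1%N) 0; apply: g1.
- by have [_ _ _ ->] := red _ _ 0 (pr i) 0 (io i); apply: h1.
- by have [-> _ _ _] := red _ _ (pr2 1%N) 0 (io2 0%N) 0; apply: g2.
- by have [_ _ -> _] := red _ _ 0 (pr j) (io2 0%N) 0.
- by have [-> _ _ _] := red _ _ (pr2 0%N) 0 (io2 1%N) 0; apply: g2.
- by have [_ _ -> _] := red _ _ 0 (pr j) (io2 1%N) 0.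
- by have [_ -> _ _] := red _ _ (pr2 0%N) 0 0 (io i).
- by have [_ -> _ _] := red _ _ (pr2 1%N) 0 0 (io i).
- by have [_ _ _ ->] := red _ _ 0 (pr j) 0 (io i); apply: h2.
rewrite 2!big_ord_recl /= addrA -lsumE; congr (_ + _).
  rewrite -[X in _ = X \oh _]lcompc1 -g3 2!big_ord_recl big_ord0 addr0 lcompDr lcompDl.
  by rewrite /= !lcompA.
rewrite -[X in _ = X \oh _]lcompc1 -h3.
rewrite (lcomp_sumr _ (linr _ _) (fun i => io i \oh pr i)) (lcomp_suml _ (fun i =>
  linr _ _ \oh (io i \oh pr i))).
by apply: eq_bigr => i _; rewrite !lcompA.
Qed.

Lemma lbiprod_big n X : lbiprod n.*2 X
  (\big[@ssum k p/szero k p]_(a < n) \big[@ssum k p/szero k p]_(b < 2) X (a.*2 + b)%N).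
Proof.
elim: n X => [|n IH] X; first by rewrite big_ord0; exact: lbiprod0.
rewrite big_ord_recl [X in ssum X _]big_ord_recl [X in ssum (ssum _ X) _]big_ord_recl
  big_ord0.
exact: lbiprod_pair (IH (fun i => X i.+2)).
Qed.

End Sums.

Section EndomorphismRing.
Variables (k : fieldType) (C : lincat k) (Se : serre_functor C) (m : nat).
Variables (X : nat -> C) (T : C) (io : forall i, hom (X i) T) (pr : forall i, hom T (X i)).
Hypothesis pio : forall i, (i < m)%N -> ccomp (pr i) (io i) = idc (X i).
Hypothesis pio0 : forall i j, (i < m)%N -> (j < m)%N -> i != j ->
  ccomp (pr j) (io i) = 0.
Hypothesis iop : \sum_(i < m) ccomp (io i) (pr i) = idc T.
Hypothesis brickX : forall i, brick (X i).
Hypothesis line1 : forall i, line (X i) (X i.+1).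
Hypothesis serreX : forall i, isomorphic (X i.+2) (Se (X i)).
Hypothesis far : forall i j, (i < m)%N -> (j < m)%N -> ~~ (i <= j <= i + 2)%N ->
  nohom (X i) (X j).

Lemma line_gen (Y Z : C) (f : hom Y Z) : line Y Z -> f != 0 ->
  forall g, exists c, g = c *: f.
Proof.
move=> [f0 [f00 h]] fn0 g; have [c cE] := h f; have [d dE] := h g.
have c0 : c != 0 by apply: contra fn0 => /eqP c0; rewrite cE c0 scale0r.
by exists (d / c); rewrite cE scalerA divfK.
Qed.

Let a i : hom (X i) (X i.+1) := projT1 (cid (line1 i)).
Let a0 i : a i != 0. Proof. by rewrite /a; case: cid => f /= []. Qed.

Let line0 i : line (X i) (X i).
Proof.
exists (idc (X i)); split; last exact: brickX.
by apply: contra (a0 i) => /eqP e; rewrite -[a i]ccompc1 e ccomp0r.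
Qed.
Let line2 i : line (X i) (X i.+2).
Proof. by apply: line_iso (line_serre Se (line0 i)); [exact: iso_refl | exact: iso_sym].
Qed.

Fixpoint chain n s : hom (X s) (X (n + s)%N) :=
  if n is n'.+1 then ccomp (a (n' + s)%N) (chain n' s) else idc (X s).

Let chain_gen n s : (n < 3)%N ->
  chain n s != 0 /\ forall g, exists c, g = c *: chain n s.
Proof.
move=> n3; suff [l nz] : line (X s) (X (n + s)%N) /\ chain n s != 0 by split=> // g;
  apply: line_gen.
have id0 i : idc (X i) != 0 by have [f [f0 _]] := line0 i; apply: contra f0 => /eqP e;
  rewrite -[f]ccompc1 e ccomp0r.
move: n n3 => [|[|[|//]]] _ /=; rewrite ?ccompc1; split;
  [exact: line0 | exact: id0 | exact: line1 | exact: a0 | exact: line2 |].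
by apply: (line_comp (serreX s)) => //; exact: line1.
Qed.

Let e (i : nat) : End T := ccomp (io i) (pr i).
Let al : End T := \sum_(i < m)
  (if (i.+1 < m)%N then ccomp (io i.+1) (ccomp (a i) (pr i)) else 0).

Let eMl i (x : End T) : e i * x = ccomp (io i) (ccomp (pr i) x).
Proof. by rewrite -[LHS]/(ccomp _ _) ccompA. Qed.

Let ee i j : (i < m)%N -> (j < m)%N -> e i * e j = if i == j then e i else 0.
Proof.
move=> im jm; rewrite eMl /e [ccomp (pr i) _]ccompA; case: eqP => [<-|/eqP ne].
  by rewrite pio // ccomp1c.
by rewrite pio0 1?eq_sym // ccomp0l ccomp0r.
Qed.

Let exe i j (x : End T) :
  e j * x * e i = ccomp (io j) (ccomp (ccomp (pr j) (ccomp x (io i))) (pr i)).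
Proof. by rewrite -[LHS]/(ccomp (ccomp _ _) _) /e -!ccompA. Qed.

Let al_io s : (s < m)%N ->
  ccomp al (io s) = if (s.+1 < m)%N then ccomp (io s.+1) (a s) else 0.
Proof.
move=> sm; have -> :
  ccomp al (io s) = \sum_(i < m) ccomp
  (if (i.+1 < m)%N then ccomp (io i.+1) (ccomp (a i) (pr i)) else 0 : hom T T) (io s).
  by apply: (big_morph (fun f : hom T T => ccomp f (io s))) => [f g|];
    rewrite ?ccompDl ?ccomp0l.
rewrite (bigD1 (Ordinal sm)) //= big1 ?addr0 => [|i ne].
  by case: ifP => _; rewrite ?ccomp0l // -!ccompA pio // ccompc1.
case: ifP => _; rewrite ?ccomp0l // -!ccompA pio0 ?ccomp0r //.
by apply: contra ne => /eqP h; apply/eqP/val_inj.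
Qed.

Let al_chain n s : (n + s < m)%N ->
  al ^+ n * e s = ccomp (io (n + s)%N) (ccomp (chain n s) (pr s)).
Proof.
elim: n => [|n IH] nm; first by rewrite expr0 mul1r /= ccomp1c.
rewrite exprS -mulrA IH; last by apply: leq_trans nm; rewrite ltnS ltnW.
rewrite -[LHS]/(ccomp _ _) ccompA al_io; last by apply: leq_trans nm; rewrite ltnS ltnW.
by rewrite -[(n + s).+1]/(n.+1 + s)%N nm -!ccompA.
Qed.

Let e_al n s : (n + s < m)%N -> e (n + s)%N * (al ^+ n * e s) = al ^+ n * e s.
Proof.
move=> nm; rewrite al_chain // eMl; congr (ccomp _ _).
by rewrite ccompA pio // ccomp1c.
Qed.

Let e_far i j (x : End T) : (i < m)%N -> (j < m)%N -> ~~ (i <= j <= i + 2)%N ->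
  e j * x * e i = 0.
Proof. by move=> im jm ij;
  rewrite exe (far im jm ij (ccomp _ (ccomp _ _))) ccomp0l ccomp0r. Qed.

Let e_near n s (x : End T) : (n < 3)%N -> (n + s < m)%N ->
  exists c, e (n + s)%N * x * e s = c *: (al ^+ n * e s).
Proof.
move=> n3 nm; rewrite exe al_chain //; have [_ h] := chain_gen s n3.
have [c ->] := h (ccomp (pr (n + s)%N) (ccomp x (io s))).
by exists c; rewrite -ccompZr -ccompZl.
Qed.

Let al_neq0 n s : (n < 3)%N -> (n + s < m)%N -> al ^+ n * e s != 0.
Proof.
move=> n3 nm; have [h _] := chain_gen s n3; apply: contra h => /eqP;
  rewrite al_chain // => h.
have : ccomp (ccomp (pr (n + s)%N) (0 : hom T T)) (io s) = 0 by rewrite ccomp0r ccomp0l.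
rewrite -h !ccompA pio // ccomp1c -!ccompA pio ?ccompc1;
  last by apply: leq_ltn_trans nm; rewrite leq_addl.
by move=> ->.
Qed.

(** The path i -> j is sent to [al ^+ (j - i)] on the summand with index m -
    1 - j, where [al] is the sum of generators [a i] of the lines Hom(X i, X
    (i + 1)). The numbering is reversed because paths are multiplied in the
    order in which they are run through, while maps compose from right to
    left. The composites of two consecutive generators are nonzero since X
    (i + 2) = S (X i), and they generate because Hom(X i, S (X i)) is dual
    to End(X i). *)
Lemma end_nakayama : exists phi : {linear nakayama k m 3 -> End T},
  monoid_morphism phi /\ bijective phi.
Proof.
have sm (i : 'I_m) : (m.-1 - i < m)%N by have := ltn_ord i; lia.
have sE (i j : 'I_m) : (i <= j)%N -> (m.-1 - i = (j - i) + (m.-1 - j))%N.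
  by have := ltn_ord i; have := ltn_ord j; lia.
apply: (@nakayama_iso k C T m 3 (fun i j : 'I_m => al ^+ (j - i) * e (m.-1 - j))).
- rewrite -[RHS]iop [RHS](reindex_inj rev_ord_inj) /=; apply: eq_bigr => i _.
  rewrite subnn expr0 mul1r /e; have -> // : (m.-1 - i = m - i.+1)%N by lia.
- move=> i j l ij jl; rewrite -mulrA (sE j l jl) e_al; last by rewrite -sE.
  by rewrite mulrA -exprD; congr (_ ^+ _ * _); lia.
- move=> i j j' l ij jl ne; rewrite -mulrA -(e_al (n := l - j')); last by rewrite -sE.
  rewrite -sE // [e _ * (e _ * _)]mulrA ee // ifF ?mul0r ?mulr0 //.
  apply/eqP => h; case/eqP: ne; apply: val_inj => /=; have := ltn_ord j;
    have := ltn_ord j'; lia.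
- move=> i j ij; have ij' : (i <= j)%N by lia.
  rewrite -(e_al (n := j - i)); last by rewrite -sE.
  by rewrite -sE // mulrA e_far //; have := ltn_ord j; lia.
- by move=> i j /andP[ij lt]; apply: al_neq0; [lia | rewrite -sE].
- move=> x i j ij; rewrite !subnn !expr0 !mul1r (sE i j ij).
  case: (ltnP (j - i) 3) => ji; first by apply: e_near; rewrite -?sE.
  by exists 0; rewrite scale0r -sE // e_far //; have := ltn_ord j; lia.
move=> x i j ji; rewrite !subnn !expr0 !mul1r e_far //.
by have := ltn_ord i; have := ltn_ord j; lia.
Qed.

Lemma nohom_sum_src Y : (forall i, (i < m)%N -> nohom (X i) Y) -> nohom T Y.
Proof.
move=> h f; rewrite -[f]ccompc1 -iop.
have -> : ccomp f (\sum_(i < m) ccomp (io i) (pr i)) = \sum_(i < m) ccomp f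
  (ccomp (io i) (pr i)).
  by apply: big_morph => [u v|]; rewrite ?ccompDr ?ccomp0r.
by apply: big1 => i _; rewrite ccompA (h i (ltn_ord i) (ccomp f (io i))) ccomp0l.
Qed.

Lemma nohom_sum_tgt Y : (forall i, (i < m)%N -> nohom Y (X i)) -> nohom Y T.
Proof.
move=> h f; rewrite -[f]ccomp1c -iop.
have -> : ccomp (\sum_(i < m) ccomp (io i) (pr i)) f = \sum_(i < m) ccomp
  (ccomp (io i) (pr i)) f.
  by apply: (big_morph (fun u : hom T T => ccomp u f)) => [u v|];
    rewrite ?ccompDl ?ccomp0l.
by apply: big1 => i _; rewrite -ccompA (h i (ltn_ord i) (ccomp (pr i) f)) ccomp0r.
Qed.

Lemma nohom_summand Y i : (i < m)%N -> nohom T Y -> nohom (X i) Y.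
Proof.
by move=> im h f; rewrite -[f]ccompc1 -(pio im) ccompA (h (ccomp f (pr i))) ccomp0l.
Qed.

End EndomorphismRing.

(** * Simple objects, and the translation on the orbit *)

Section Simple.
Variables (k : fieldType) (p : nat).
Local Notation ladder := (ladder k p).
Local Notation sobj := (sobj k p).
Local Notation "g '\oh' f" := (lhom_comp g f) (at level 40, left associativity).

(** A homogeneous socle element of M spans a subobject (0 in k). *)
Lemma simple_ivl (U : sobj) : simple U ->
  exists d, forall h1 : (0 <= 1 <= p)%N, liso (ivl k d h1) U.
Proof.
case=> Un0 Usub; have [|d [m [mM m0 xm]]] := socle_elt (grhom_id (lM U)).
  case: (pselect (exists v : lM U, (\1%VF : 'End(_)) v != 0)) => // no; case: Un0.
  apply: lhomE2 => v; rewrite lid2E lzero2E; apply/eqP.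
  by apply: contra_notT no => v0; exists v; rewrite lfunE.
rewrite !lfunE /= in m0 xm; exists d => h1.
have [|f fE] := @ivl_out2 k p 0 1 d h1 U m 0 mM xm; first by rewrite linear0 subn0.
have f_inj : inj_lhom f.
  split=> v w; first by move=> _; apply: entryP.
  rewrite (cycmod_hom v (lhom_gr2 f)) (cycmod_hom w (lhom_gr2 f)) fE !cyc_outE
    !big_ord1 /= => /eqP.
  rewrite -subr_eq0 -scalerBl scaler_eq0 (negbTE m0) orbF subr_eq0 => /eqP e.
  by apply: entryP => -[|//] _.
case: (Usub _ f f_inj) => [z|f_surj]; last exact: liso_of_bij f_surj.
have : (lhom_id (ivl k d h1)).2 gen = (0 : lhom (ivl k d h1) (ivl k d h1)).2 gen.
  exact: (congr1 (fun f : lhom (ivl k d h1) (ivl k d h1) => f.2 gen) z).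
rewrite lid2E lzero2E => /(congr1 (fun v => entry v 0));
  rewrite entry_gen entry0 /= => /eqP.
by rewrite oner_eq0.
Qed.

Lemma liso_trans (X Y Z : ladder) : liso X Y -> liso Y Z -> liso X Z.
Proof.
case=> f [g [e1 e2]] [f' [g' [e1' e2']]]; exists (f' \oh f), (g \oh g'); split.
  by rewrite -lcompA [g' \oh _]lcompA e1' lcomp1c.
by rewrite -lcompA [f \oh _]lcompA e2 lcomp1c.
Qed.

Lemma liso_sym (X Y : ladder) : liso X Y -> liso Y X.
Proof. by case=> f [g [e1 e2]]; exists g, f. Qed.

Lemma lshift_hom (X Y : ladder) (f : lhom X Y) : exists f' :
  lhom (Defs.lshift X) (Defs.lshift Y), lhom_val f' = lhom_val f.
Proof.
have hP : @is_lhom k p (Defs.lshift X) (Defs.lshift Y) (lhom_val f).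
  have [[f1 f2] [f3 f4] f5] := lhomP f.
  by split=> //; split=> // n; [apply: f1 | apply: f3].
by exists (mkHom hP).
Qed.

Lemma liso_shift (X Y : ladder) : liso X Y -> liso (Defs.lshift X) (Defs.lshift Y).
Proof.
case=> f [g [e1 e2]]; have [f' fE] := lshift_hom f; have [g' gE] := lshift_hom g.
exists f', g'; split; apply: val_inj; rewrite /= fE gE.
  by have := congr1 (@lhom_val k p _ _) e1.
by have := congr1 (@lhom_val k p _ _) e2.
Qed.

Lemma lshift_ivl a b d (h : (a <= b <= p)%N) :
  liso (Defs.lshift (ivl k d h)) (ivl k (d - 1) h).
Proof.
have gP c g hc : @grhom k p (gshift (cycmod k g hc)) (cycmod k (g - 1) hc)
  (\1%VF : 'End('rV[k]_c)).
  apply: grhomP => [n v|v] /=; rewrite !lfunE //= => /cycdegP vn; apply/cycdegP => i ne;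
    apply: vn.
  by apply: contra ne => /eqP e; apply/eqP; lia.
have [|||f [f1 f2]] :=
  @lhom_of k p (Defs.lshift (ivl k d h)) (ivl k (d - 1) h) \1%VF \1%VF.
- have := @gP a (d + (b - a)%N%:Z) (ivl_a h); rewrite addrAC; exact.
- exact: gP.
- by move=> u; rewrite !lfunE.
apply: (@liso_of_bij _ _ _ _ f); rewrite /inj_lhom /surj_lhom f1 f2.
  by split=> v w; rewrite !id_lfunE.
by split=> v; exists v; rewrite id_lfunE.
Qed.

Lemma simple_shift (U : sobj) d (h1 : (0 <= 1 <= p)%N) n : liso (ivl k d h1) U ->
  liso (iter n (@sshift k p) U) (ivl k (d - n%:Z) h1).
Proof.
move=> dU; elim: n => [|n IH] /=; first by rewrite subr0; apply: liso_sym.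
apply: liso_trans (liso_shift IH) _; have := lshift_ivl (d - n%:Z) h1.
by have -> : d - n%:Z - 1 = d - n.+1%:Z by lia.
Qed.

End Simple.

Section Main.
Variables (k : fieldType) (p : nat) (hp : (1 < p)%N) (Sg : suspension k p)
  (Se : serre_functor (stab k p)).
Local Notation sobj := (sobj k p).
Local Notation O := (@robj k p hp).

(** This is tau = R s^(-1). *)
Lemma tau_robj h r t (X : sobj) : sisom X (O h r t) ->
  sisom (tau Sg Se X : sobj) (O h (r + 1) (t + 1)).
Proof.
move=> iX; have sX : susp_of (desusp Sg X : sobj) X by apply: desuspP.
have sO := robj_susp k hp h (r - 3) t; rewrite subrK in sO.
have iD : sisom (desusp Sg X : sobj) (O h (r - 3) t) by apply/(susp_isom sX sO).
apply: iso_trans (functor_iso Se iD) _.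
by have := robj_serre hp Se h (r - 3) t; congr (sisom _ (O h _ _)); lia.
Qed.

Lemma iter_tau_robj h r t (X : sobj) n : sisom X (O h r t) ->
  sisom (iter n (tau Sg Se) X : sobj) (O h (r + n%:Z) (t + n%:Z)).
Proof.
move=> iX; elim: n => [|n IH] /=; first by rewrite !addr0.
by have := tau_robj IH; congr (sisom _ (O h _ _)); lia.
Qed.

Lemma robj_shift_vanish h r t (Y : sobj) n :
  svanish (O h r t) (shift Sg n Y : sobj) <-> svanish (O h (r - 3 * n) t) Y.
Proof.
have step (m : int) x :
  svanish (O h x t) (shift Sg m Y : sobj) <-> svanish (O h (x + 3) t)
  (shift Sg (m + 1) Y : sobj).
  exact: susp_vanish (robj_susp k hp h x t) (shift_susp Sg m Y).
case: n => n.
  elim: n r => [|n IH] r; first by rewrite mulr0 subr0.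
  have -> : n.+1%:Z = n%:Z + 1 by lia.
  have {1}-> : r = (r - 3) + 3 by lia.
  by rewrite -step IH; have -> : r - 3 - 3 * n%:Z = r - 3 * (n%:Z + 1) by lia.
rewrite NegzE; elim: n r => [|n IH] r.
  by rewrite (step (-1) r) (_ : -1 + 1 = 0).
rewrite (step _ r); have -> : - n.+2%:Z + 1 = - n.+1%:Z by lia.
by rewrite IH; have -> : r + 3 - 3 * - n.+1%:Z = r - 3 * - n.+2%:Z by lia.
Qed.

(** The triangle of three consecutive rotations, realised as (N_a in N_a) ->
    (N_a in N_p) -> (0 in N_(p - a)). *)
Lemma robj_triangle h q (e : bool) t : let r := 6 * q + 3 * e%:Z + 1 in
  exists (i : lhom (O h r t) (O h (r + 1) t))
    (w : lhom (O h (r + 1) t) (O h (r + 2) t)), conflation i w.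
Proof.
move=> r; have ll := kind_len_gt0 hp e; have lC := kind_lenC hp e.
rewrite (@robjE k p hp h q e 1 t r) // (@robjE k p hp h q e 2 t (r + 1)) //;
  last by rewrite /r; lia.
rewrite (@robjE k p hp h (q + e%:Z) (~~ e) 0 t (r + 2)) //; last by rewrite /r;
  case: (e); lia.
have -> : h + t - p%:Z * (q + e%:Z) - (~~ e)%:Z = h + t - p%:Z * q - e%:Z -
  (kind_len p e)%:Z.
  by rewrite mulrDr; case: (e) => /=; lia.
rewrite /kobj; set d := h + t - p%:Z * q - e%:Z.
have -> : d - (kind_len p e)%:Z - (kind_len p (~~ e))%:Z + 1 = d - p%:Z + 1 by lia.
by apply: confl_ivl; rewrite ?eqxx //; lia.
Qed.

Section Orth.
Variables (W : sobj) (h t : int).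
Local Notation G r := (orth Sg W (O h r t)).

Lemma orth_rot3 r : G r <-> G (r + 3).
Proof. exact: orth_susp (robj_susp k hp h r t). Qed.

(** Three consecutive rotations are the three terms of one conflation up to
    suspension; which terms depends on r modulo 3. *)
Lemma orth_rot_step r : G r -> G (r + 1) -> G (r + 2).
Proof.
move=> g0 g1; have [q [e [K [K3 rE]]]] := int_decomp6 r.
move: K K3 rE => [|[|[|//]]] _ rE.
- have [i [w iw]] := robj_triangle h q (~~ e) t.
  have [q' [e' rE']] : exists q' (e' : bool), r - 2 = 6 * q' + 3 * e'%:Z + 1.
    by exists (q - (~~ e)%:Z), (~~ e); rewrite rE; case: (e) => /=; lia.
  have [i' [w' iw']] := robj_triangle h q' e' t; rewrite -rE' in i' w' iw'.
  have gm : G (r - 2 + 1).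
    apply: (orth_mid iw').
      by apply/orth_rot3; have -> : r - 2 + 3 = r + 1 by lia.
    by rewrite subrK.
  by have := (orth_rot3 _).1 gm; have -> : r - 2 + 1 + 3 = r + 2 by lia.
- by have [i [w iw]] := robj_triangle h q e t; rewrite -rE in i w iw;
    apply: (orth_right iw).
have [i [w iw]] := robj_triangle h q e t.
have rE' : 6 * q + 3 * e%:Z + 1 = r - 1 by lia.
rewrite rE' in i w iw; have gl : G (r - 1).
  apply: (orth_left iw); first by rewrite subrK.
  by have -> : r - 1 + 2 = r + 1 by lia.
by have := (orth_rot3 _).1 gl; have -> : r - 1 + 3 = r + 2 by lia.
Qed.

Lemma orth_rot01 r : G r -> G (r + 1) -> G 0 /\ G 1.
Proof.
move=> g0 g1; have st x : G x /\ G (x + 1) -> G (x + 1) /\ G (x + 1 + 1).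
  by case=> a b; split=> //; rewrite -addrA; apply: orth_rot_step.
have st3 x : G x /\ G (x + 1) <-> G (x + 3) /\ G (x + 3 + 1).
  by rewrite (orth_rot3 x) (orth_rot3 (x + 1)); have -> : x + 1 + 3 = x + 3 + 1 by lia.
have st3n (n : nat) x : G x /\ G (x + 1) <-> G (x + 3 * n%:Z) /\ G (x + 3 * n%:Z + 1).
  elim: n x => [|n IH] x; first by rewrite mulr0 addr0.
  by rewrite IH st3; have -> : x + 3 * n%:Z + 3 = x + 3 * n.+1%:Z by lia.
have [n [j [j3 rE]]] : exists (n : int) (j : nat), (j < 3)%N /\ r = 3 * n + j%:Z.
  by exists (r %/ 3)%Z, (absz (r %% 3)%Z); split; lia.
have gj : G j%:Z /\ G (j%:Z + 1).
  case: n rE => n rE.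
    apply/(st3n n); by have -> : j%:Z + 3 * n%:Z = r by lia.
  have := (st3n n.+1 r).1 (conj g0 g1); have -> // : r + 3 * n.+1%:Z = j by lia.
have g3 : G 3 /\ G (3 + 1).
  by move: j j3 gj {rE} => [|[|[|//]]] _ gj;
    repeat first [exact: gj | move/st: gj => gj].
by have := (st3 0).2 g3.
Qed.

End Orth.

End Main.

(** * The tilting object *)

Section Final.
Variables (k : fieldType) (p : nat) (hp : (1 < p)%N) (Sg : suspension k p)
  (Se : serre_functor (stab k p)).
Local Notation sobj := (sobj k p).
Local Notation O := (@robj k p hp).

(** The exponents of R and s^(-1) for the i-th summand: with i = 2a + b and
    tau = R s^(-1), tau^(4a+b) s^(3a+b) = R^(4a+b) s^(-a). *)
Definition rot_ix (i : nat) : int := (4 * i./2 + odd i)%N%:Z.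
Definition twist_ix (i : nat) : int := i./2%:Z.

(** A nonzero map forces the twists to differ by p q + e with e = 0 or 1. As
    the twists lie between 0 and p - 2, this means q = 0, and then n = 0 as
    well. *)
Lemma summand_vanish h i j (n : int) : (i < 2 * (p - 1))%N -> (j < 2 * (p - 1))%N ->
  ~~ [&& n == 0, (i <= j)%N & (j <= i + 2)%N] ->
  svanish (O h (rot_ix i - 3 * n) (twist_ix i)) (O h (rot_ix j) (twist_ix j)).
Proof.
move=> ip jp nij; apply: (robj_vanish Se) => q e K K2;
  rewrite /rot_ix /twist_ix => rE tE.
have i2 := odd_double_half i; have j2 := odd_double_half j.
have p0 : 0 < p%:Z by lia.
have q0 : q = 0.
  have [q1|q1] := lerP 1 q; first by have := ler_pM2l p0 1 q; rewrite q1 => h1;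
    case: (e) tE => tE; lia.
  have [q2|q2] := lerP q (-1); last lia.
  by have := ler_pM2l p0 q (-1); rewrite q2 => h1; case: (e) tE => tE; lia.
rewrite {}q0 mulr0 add0r in rE tE; case/negP: nij.
by case: e rE tE => /= rE tE; apply/and3P; split; lia.
Qed.

(** For each of the p - 1 twists two consecutive rotations of the simple
    object are given, so all rotations are reached; then all degrees. *)
Lemma orth_summands_zero (W : sobj) h :
  (forall c : nat, (c < p.-1)%N ->
    orth Sg W (O h (4 * c%:Z) c%:Z) /\ orth Sg W (O h (4 * c%:Z + 1) c%:Z)) ->
  is_zero (W : stab k p).
Proof.
move=> H.
have H01 (c : nat) : (c < p.-1)%N -> orth Sg W (O h 0 c%:Z) /\ orth Sg W (O h 1 c%:Z).
  by move=> /H[g0 g1]; apply: orth_rot01 g0 g1.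
have h1 : (1 <= p)%N by exact: ltnW.
have oA := @fam_orth k p false hp Sg W h; have oB := @fam_orth k p true hp Sg W h.
apply: zero_of_orth => // d hd.
  rewrite (@ivl_fam k p false 0 1 d d hd 1 h1) //; apply: (oA _ d h1 0) => c hc hc1.
  have [+ _] := H01 c hc; rewrite (@robjE k p hp h 0 false 0 c 0) // mulr0 !subr0 /=.
  by rewrite (@ivl_fam k p false _ _ _ (h + c%:Z) _ 1 hc1) //; lia.
rewrite (@ivl_fam k p true 1 1 d d hd 1 h1) //; apply: (oB _ d h1 0) => c hc hc1.
have [_ +] := H01 c hc; rewrite (@robjE k p hp h 0 false 1 c 1) // mulr0 !subr0 /=.
by rewrite (@ivl_fam k p true _ _ _ (h + c%:Z) _ 1 hc1) //; lia.
Qed.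

Lemma robj_brick h r t : brick (O h r t : stab k p).
Proof. exact: kobj_brick. Qed.

Lemma ivl_line d (h : (0 <= 1 <= p)%N) (h' : (1 <= 1 <= p)%N) :
  line (ivl k d h : stab k p) (ivl k d h').
Proof.
have x0 (v : 'rV[k]_1) : slide 1 v = 0 :> 'rV[k]_1 by apply: entryP => i hi;
  rewrite entry_slide entry0 ifF //; lia.
have [|||f fE] := @ivl_out2 k p 0 1 d h (ivl k d h') gen 0.
- exact: gen_deg.
- exact: x0.
- by rewrite linear0 /= x0.
exists (spi f); split.
  apply: ivl_stable_neq0; rewrite ?fE; try lia.
  apply/eqP => /(congr1 (fun v => entry v 0)); rewrite entry_gen entry0 /= => /eqP.
  by rewrite oner_eq0.
move=> g; have [g' ->] := spi_surj g; have [gm _ _] := ivl_gen_mem g'.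
exists (entry (g'.2 gen) 0); rewrite -spiZ; congr spi.
by apply: ivl_ext2; rewrite lscale2E fE; apply: deg_gen gm.
Qed.

Lemma robj_line h t : line (O h 0 t : stab k p) (O h 1 t).
Proof.
rewrite (@robjE k p hp h 0 false 0 t 0) // (@robjE k p hp h 0 false 1 t 1) //.
exact: ivl_line.
Qed.

End Final.

Theorem proposition5p4 (k : fieldType) (p : nat) (hp : (2 <= p)%N)
    (Sg : suspension k p) (Se : serre_functor (stab k p))
    (U : sobj k p) (simpleU : simple U) :
  let T : stab k p :=
    \big[@ssum k p/szero k p]_(a < (p - 1)%N) \big[@ssum k p/szero k p]_(b < 2)
      iter (4 * a + b)%N (tau Sg Se) (iter (3 * a + b)%N (@sshift k p) U) in
  tilting (shift Sg) T /\
  exists phi : {linear nakayama k (2 * (p - 1))%N 3 -> End T},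
    monoid_morphism phi /\ bijective phi.
Proof.
move=> T; have [h hU] := simple_ivl simpleU.
pose X i : sobj k p :=
  iter (4 * i./2 + odd i)%N (tau Sg Se) (iter (3 * i./2 + odd i)%N (@sshift k p) U).
have XO i : sisom (X i) (@robj k p hp h (rot_ix i) (twist_ix i)).
  have h1 : (0 <= 1 <= p)%N by lia.
  have hX : sisom (iter (3 * i./2 + odd i)%N (@sshift k p) U)
    (@robj k p hp h 0 (- (3 * i./2 + odd i)%N%:Z)).
    have := liso_sisom (simple_shift (3 * i./2 + odd i)%N (hU h1)).
    rewrite (@robjE k p hp h 0 false 0 _ 0) // mulr0 !subr0 /=.
    move: (kindA_le hp false) => /= h1'; rewrite (bool_irrelevance h1' h1).
    by congr (sisom _ (ivl _ _ _)); lia.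
  have := iter_tau_robj Sg Se (4 * i./2 + odd i) hX.
  by congr (sisom _ (@robj k p hp h _ _)); rewrite /rot_ix /twist_ix; lia.
have XS i : isomorphic (X i.+2 : stab k p) (Se (X i)).
  apply: iso_trans (XO i.+2) _; apply: iso_sym;
    apply: iso_trans (functor_iso Se (XO i)) _.
  by have := robj_serre hp Se h (rot_ix i) (twist_ix i);
    congr (sisom _ (@robj k p hp h _ _)); rewrite /rot_ix /twist_ix /=; lia.
have TE : T = \big[@ssum k p/szero k p]_(a < (p - 1)%N)
  \big[@ssum k p/szero k p]_(b < 2) X (a.*2 + b)%N.
  apply: eq_bigr => a _; apply: eq_bigr => b _; rewrite /X.
  have [-> ->] : (a.*2 + b)./2 = a /\ odd (a.*2 + b) = b :> nat.
    by case: b => -[|[|//]] _ /=; split; lia.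
  by [].
have [io [pr [p1 p2 p3]]] := lbiprod_big (p - 1) X;
  rewrite -TE -mul2n in io pr p1 p2 p3.
pose m := (2 * (p - 1))%N.
pose sio i : @hom k (stab k p) (X i) T := spi (io i).
pose spr i : @hom k (stab k p) T (X i) := spi (pr i).
have q1 i : (i < m)%N -> ccomp (spr i) (sio i) = idc (X i : stab k p).
  by move=> im; rewrite scompE p1.
have q2 i j : (i < m)%N -> (j < m)%N -> i != j -> ccomp (spr j) (sio i) = 0.
  by move=> im jm ij; rewrite scompE p2 // spi_0.
have q3 : \sum_(i < m) ccomp (sio i) (spr i) = idc T.
  rewrite -[idc T]/(spi (lhom_id (T : sobj k p))) -p3.
  rewrite (big_morph (@spi k p T T) (@spiD k p T T) (@spi_0 k p T T)).
  by apply: eq_bigr => i _; rewrite scompE.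
have brickX i : brick (X i : stab k p) by apply: brick_iso (XO i) _; exact: robj_brick.
have line1 i : line (X i : stab k p) (X i.+1).
  elim: i => [|i IH].
    exact: line_iso (iso_sym (XO 0%N)) (iso_sym (XO 1%N)) (robj_line k hp h 0).
  exact: line_iso (iso_refl _) (iso_sym (XS i)) (line_serre Se IH).
have far i j (n : int) : (i < m)%N -> (j < m)%N ->
  ~~ [&& n == 0, (i <= j)%N & (j <= i + 2)%N] ->
  svanish (@robj k p hp h (rot_ix i - 3 * n) (twist_ix i)) (X j).
  move=> im jm nij; exact:
    nohom_iso (iso_refl _) (iso_sym (XO j)) (summand_vanish Se im jm nij).
split; last first.
  apply: (end_nakayama q1 q2 q3 brickX line1 XS) => i j im jm nij.
  have nij' : ~~ [&& (0 : int) == 0, (i <= j)%N & (j <= i + 2)%N] by rewrite eqxx.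
  have f0 := far i j 0 im jm nij'; rewrite mulr0 subr0 in f0.
  exact: nohom_iso (iso_sym (XO i)) (iso_refl _) f0.
split=> [n n0|W oW].
  apply: (nohom_sum_src q3) => i im; apply: nohom_iso (iso_sym (XO i)) (iso_refl _) _.
  apply/robj_shift_vanish; apply: (nohom_sum_tgt q3) => j jm; apply: far => //.
  by rewrite (negbTE n0).
apply: (orth_summands_zero (Sg := Sg) (hp := hp) (h := h)) => c hc.
have oX i : (i < m)%N ->
  orth Sg (W : sobj k p) (@robj k p hp h (rot_ix i) (twist_ix i)).
  by move=> im; apply: orth_iso (XO i) _ => n; apply: (nohom_summand q1 im); exact: oW.
split.
  have := oX c.*2; rewrite /rot_ix /twist_ix;
    have [-> ->] : c.*2./2 = c /\ odd c.*2 = false by lia.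
  by rewrite addn0 PoszM; apply; rewrite /m; lia.
have := oX c.*2.+1; rewrite /rot_ix /twist_ix;
  have [-> ->] : c.*2.+1./2 = c /\ odd c.*2.+1 = true by lia.
by rewrite PoszD PoszM; apply; rewrite /m; lia.
Qed.
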